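(* Let $X$ be a compact Hausdorff space, let $V$ be a continuous real vector bundle over $X$ of finite dimension $d$ (fibre $V_x$ over $x\in X$), equipped with a continuous inner product. Let $\mathcal{A}: V\to V$ be a vector bundle automorphism fibering over a homeomorphism $T: X\to X$, and for $x\in X$, $n\in\mathbb{Z}$ let $A^n(x): V_x\to V_{T^n(x)}$ denote the restriction of $\mathcal{A}^n$ to the fibre $V_x$. Let $1\le i\le d-1$. Then the following two assertions are equivalent: (1) There is a dominated splitting of index $i$ for $\mathcal{A}$. (2) There exist $C>0$ and $\tau<1$ such that $$\frac{\sigma_{i+1}(A^n(x))}{\sigma_i(A^n(x))} < C\tau^n \quad\text{for all } x\in X \text{ and } n\ge 0.$$
   Context: For a linear map $B: V_x\to V_y$ between fibres (with norms $\|\cdot\|$ induced by the inner product), $\|B\|$ and $\mathfrak{m}(B)$ denote respectively the supremum and the infimum of $\|Bv\|$ over unit vectors $v\in V_x$ (the same notation is used for restrictions of $B$ to subspaces). The singular values $\sigma_1(B)\ge\cdots\ge\sigma_d(B)$ of $B$ are the eigenvalues (with multiplicity) of $(B^*B)^{1/2}$, where $B^*$ is the adjoint. A splitting $E\oplus F$ of $V$ is a continuous family of splittings $V_x=E_x\oplus F_x$, $x\in X$, where the dimensions of $E_x$ and $F_x$ are constant in $x$; its index is $\dim E_x$. The splitting is invariant if $A^1(x)\cdot E_x=E_{T(x)}$ and $A^1(x)\cdot F_x=F_{T(x)}$ for all $x$. The splitting is dominated for $\mathcal{A}$ if it is invariant and there are constants $C>0$ and $0<\tau<1$ such that $$\frac{\|A^n(x)|F_x\|}{\mathfrak{m}(A^n(x)|E_x)}<C\tau^n\quad\text{for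 every } x\in X \text{ and every } n\ge 0.$$ *)

(* Defs.v *)
From HB Require Import structures.
From mathcomp Require Import all_boot all_order all_algebra.
From mathcomp Require Import all_classical all_reals all_analysis.

Set Implicit Arguments.
Unset Strict Implicit.
Unset Printing Implicit Defensive.

Import Order.TTheory GRing.Theory Num.Theory.
Import numFieldNormedType.Exports.

Local Open Scope classical_set_scope.
Local Open Scope ring_scope.

Definition homeomorphism (S T : topologicalType) (f : S -> T) : Prop :=
  continuous f /\
  exists2 g : T -> S, cancel f g /\ cancel g f & continuous g.

(* The total space is the disjoint union of the fibres as a set; its topology
   is data (it is not the topology of the disjoint sum). *)
Record vfamily (R : realType) (X : topologicalType) := VFamily {
  fibre : X -> vectType R ;
  topen : set_system {x : X & fibre x} ;
  topenT : topen setT ;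
  topenI : setI_closed topen ;
  topen_bigU : forall (I : Type) (f : I -> set {x : X & fibre x}),
    (forall i, topen (f i)) -> topen (\bigcup_i f i)
}.

Definition total_space (R : realType) (X : topologicalType) (V : vfamily R X) : Type :=
  {x : X & fibre V x}.

HB.instance Definition _ (R : realType) (X : topologicalType) (V : vfamily R X) :=
  Choice.on (total_space V).
HB.instance Definition _ (R : realType) (X : topologicalType) (V : vfamily R X) :=
  @isOpenTopological.Build (total_space V)
    (@topen R X V) (@topenT R X V) (@topenI R X V) (@topen_bigU R X V).

Section VectorBundles.
Variables (R : realType) (X : topologicalType).

Definition vec (V : vfamily R X) (x : X) (v : fibre V x) : total_space V :=
  existT _ x v.

Definition bproj (V : vfamily R X) (e : total_space V) : X := projT1 e.

(* psi x is the inverse of phi x for x in U; the last two conditions say that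
   e |-> (bproj e, phi e) is a homeomorphism from bproj^-1(U) onto U x R^d. *)
Definition locally_trivial (V : vfamily R X) (d : nat) : Prop :=
  forall x0 : X, exists (U : set X)
    (phi : forall x, 'Hom(fibre V x, 'rV[R]_d))
    (psi : forall x, 'Hom('rV[R]_d, fibre V x)),
  [/\ open U /\ U x0,
      forall x, U x -> cancel (phi x) (psi x) /\ cancel (psi x) (phi x),
      {within @bproj V @^-1` U,
        continuous (fun e : total_space V => (bproj e, phi (projT1 e) (projT2 e)))} &
      {within [set p : X * 'rV[R]_d | U p.1],
        continuous (fun p : X * 'rV[R]_d => vec (psi p.1 p.2))}].

Record vector_bundle (d : nat) := VectorBundle {
  vb_family :> vfamily R X ;
  vb_bproj_continuous : continuous (@bproj vb_family) ;
  vb_trivial : locally_trivial vb_family d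
}.

(* Pairs of vectors in a common fibre, as a subspace of V x V. *)
Definition fibre_product (V : vfamily R X) : Type :=
  initial_topology (fun p : {x : X & (fibre V x * fibre V x)%type} =>
    (vec (projT2 p).1, vec (projT2 p).2) : (total_space V * total_space V)%type).

HB.instance Definition _ (V : vfamily R X) := Topological.on (fibre_product V).

Record continuous_inner_product (V : vfamily R X) := ContinuousInnerProduct {
  ip :> forall x : X, {dot fibre V x for idfun} ;
  ip_continuous : continuous (fun p : fibre_product V =>
    ip (projT1 p) (projT2 p).1 (projT2 p).2)
}.

Definition total_map (V : vfamily R X) (T : X -> X)
    (A : forall x, 'Hom(fibre V x, fibre V (T x))) (e : total_space V) : total_space V :=
  vec (A (projT1 e) (projT2 e)).

Record bundle_automorphism (V : vfamily R X) (T : X -> X) :=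
  BundleAutomorphism {
  auto_map :> forall x : X, 'Hom(fibre V x, fibre V (T x)) ;
  auto_homeomorphism : homeomorphism (total_map auto_map)
}.

Fixpoint bundle_iter (V : vfamily R X) (T : X -> X) (A : bundle_automorphism V T)
    (n : nat) (x : X) : 'Hom(fibre V x, fibre V (iter n T x)) :=
  if n is m.+1 then (A (iter m T x) \o bundle_iter A m x)%VF else \1%VF.

End VectorBundles.

Section LinearMaps.
Variables (R : realType) (U W : vectType R).
Variables (dU : {dot U for idfun}) (dW : {dot W for idfun}).

Definition enorm (L : vectType R) (dL : {dot L for idfun}) (v : L) : R :=
  Num.sqrt (dL v v).

Definition norm_on (B : 'Hom(U, W)) (E : {vspace U}) : R :=
  sup [set enorm dW (B v) | v in [set v | v \in E /\ enorm dU v = 1]].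

Definition conorm_on (B : 'Hom(U, W)) (E : {vspace U}) : R :=
  inf [set enorm dW (B v) | v in [set v | v \in E /\ enorm dU v = 1]].

(* xget x0 P is an element of P, or x0 if P is empty. The adjoint exists and is
   unique; so do the square root of a self-adjoint P >= 0 and the list of
   eigenvalues of a self-adjoint S (for which all notions of multiplicity
   agree), and these are the only cases used. *)
Definition adjoint (B : 'Hom(U, W)) : 'Hom(W, U) :=
  xget 0 [set B' : 'Hom(W, U) | forall u w, dW (B u) w = dU u (B' w)].

Definition psd_sqrt (P : 'End(U)) : 'End(U) :=
  xget 0 [set S : 'End(U) |
    [/\ forall u v, dU (S u) v = dU u (S v),
        forall u, 0 <= dU (S u) u &
        (S \o S)%VF = P]].

Definition eigenvalues (S : 'End(U)) : seq R :=
  xget [::] [set s : seq R |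
    sorted >=%R s /\
    forall a : R, count_mem a s = \dim (passmx.leigenspace S a)].

Definition singular_values (B : 'Hom(U, W)) : seq R :=
  eigenvalues (psd_sqrt (adjoint B \o B)%VF).

(* Numbered from 1: sigma 1 >= sigma 2 >= ... *)
Definition sigma (k : nat) (B : 'Hom(U, W)) : R :=
  nth 0 (singular_values B) k.-1.

End LinearMaps.

Section Splittings.
Variables (R : realType) (X : topologicalType) (V : vfamily R X).

(* Continuity of x |-> E x, with dim (E x) = k, is the existence of local
   continuous frames. *)
Definition continuous_subspaces (k : nat) (E : forall x, {vspace fibre V x}) :
    Prop :=
  forall x0 : X, exists (U : set X) (e : 'I_k -> forall x, fibre V x),
  [/\ open U /\ U x0,
      forall j, {within U, continuous (fun x => vec (e j x))} &
      forall x, U x -> basis_of (E x) [tuple e j x | j < k]].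

Definition splitting (i : nat) (E F : forall x, {vspace fibre V x}) : Prop :=
  [/\ continuous_subspaces i E,
      exists k, continuous_subspaces k F &
      forall x, (E x + F x = fullv)%VS /\ (E x :&: F x = 0)%VS].

Variables (g : continuous_inner_product V).
Variables (T : X -> X) (A : bundle_automorphism V T).

Definition invariant (E F : forall x, {vspace fibre V x}) : Prop :=
  forall x, (A x @: E x = E (T x))%VS /\ (A x @: F x = F (T x))%VS.

Definition dominated (E F : forall x, {vspace fibre V x}) : Prop :=
  invariant E F /\
  exists C tau : R, [/\ 0 < C, 0 < tau < 1 &
    forall (x : X) (n : nat),
      norm_on (g x) (g (iter n T x)) (bundle_iter A n x) (F x) /
      conorm_on (g x) (g (iter n T x)) (bundle_iter A n x) (E x) < C * tau ^+ n].

Definition has_dominated_splitting (i : nat) : Prop :=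
  exists E F : forall x, {vspace fibre V x}, splitting i E F /\ dominated E F.

End Splittings.

(* Main.v *)
(* Fix orthonormal frames in all fibres, so that the automorphism becomes a
   cocycle of invertible matrices, bounded together with its inverse. A dominated
   splitting forces the gap between singular values by the Courant-Fischer principle.

   Conversely let S_n(x) be the span of the d-i weakest singular directions of
   A^n(x). The gap makes the orthogonal projections onto S_n(x) a Cauchy sequence
   with geometric rate, uniformly in x; the limit is F(x), and E(x) is the
   same limit for the inverse cocycle. Invariance and continuity follow from the
   uniformity. The main point is that E and F are uniformly transverse:
   if they almost meet along a long orbit segment, then the largest expansion a_k
   of i-dimensional volume in time k satisfies a_2k <= D tau^(k/2) a_k^2, hence
   decays faster than any exponential, which contradicts the bound on the inverse.
   Transversality then identifies the growth on E and F with the singular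
   values of index i and i+1. *)
From HB Require Import structures.
Require Import Defs.
From mathcomp Require Import all_boot all_order all_algebra.
From mathcomp Require Import all_classical all_reals all_analysis.
From mathcomp Require Import ring lra zify.
Import Order.TTheory GRing.Theory Num.Theory.
Import numFieldNormedType.Exports.
Set Implicit Arguments.
Unset Strict Implicit.
Unset Printing Implicit Defensive.
Local Open Scope classical_set_scope.
Local Open Scope ring_scope.

(** * Euclidean geometry of row vectors *)

(** The frames come from choice and need not vary continuously with the point, so neither do the
    matrices of the cocycle. Only squared lengths are continuous. Every continuity or local
    boundedness statement therefore goes through Gram matrices in a chart, and nearby base points
    are compared, at one fixed time, up to a factor 2. The gap yields the two limit spaces but says
    nothing about the angle between them. Volume is used for that because it is submultiplicative.
    An i-plane either contains a vector close to the initial slow space, or its image contains a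
    vector close to the fast image. Near tangency makes the latter vector almost slow for the next
    time segment. Either way a factor of volume is lost; the loss compounds when time is doubled,
    while volume shrinks by at most the factor K^(-i) per step. Subspaces are encoded by orthogonal
    projections of constant trace acting on row vectors from the right, so that symmetry,
    idempotence and rank survive in the limit. *)

Section Euclidean.
Variable R : rcfType.
Implicit Types n m p : nat.

Lemma ler_of_eq (x y : R) : x = y -> x <= y.
Proof. by move=> ->. Qed.

Definition dotr n (u v : 'rV[R]_n) : R := (u *m v^T) 0 0.
Definition nrm n (u : 'rV[R]_n) : R := Num.sqrt (dotr u u).

Lemma dotrE n (u v : 'rV[R]_n) : dotr u v = \sum_j u 0 j * v 0 j.
Proof. by rewrite /dotr mxE; apply: eq_bigr => j _; rewrite mxE. Qed.

Lemma dotrC n (u v : 'rV[R]_n) : dotr u v = dotr v u.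
Proof. by rewrite !dotrE; apply: eq_bigr => j _; rewrite mulrC. Qed.

Lemma dotrDl n (u v w : 'rV[R]_n) : dotr (u + v) w = dotr u w + dotr v w.
Proof. by rewrite /dotr mulmxDl mxE. Qed.
Lemma dotrDr n (u v w : 'rV[R]_n) : dotr w (u + v) = dotr w u + dotr w v.
Proof. by rewrite dotrC dotrDl !(dotrC w). Qed.
Lemma dotrZl n a (u v : 'rV[R]_n) : dotr (a *: u) v = a * dotr u v.
Proof. by rewrite /dotr -scalemxAl mxE. Qed.
Lemma dotrZr n a (u v : 'rV[R]_n) : dotr u (a *: v) = a * dotr u v.
Proof. by rewrite dotrC dotrZl dotrC. Qed.
Lemma dotrNl n (u v : 'rV[R]_n) : dotr (- u) v = - dotr u v.
Proof. by rewrite -scaleN1r dotrZl mulN1r. Qed.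
Lemma dotrNr n (u v : 'rV[R]_n) : dotr u (- v) = - dotr u v.
Proof. by rewrite dotrC dotrNl dotrC. Qed.
Lemma dotr0l n (u : 'rV[R]_n) : dotr 0 u = 0.
Proof. by rewrite /dotr mul0mx mxE. Qed.
Lemma dotr0r n (u : 'rV[R]_n) : dotr u 0 = 0.
Proof. by rewrite dotrC dotr0l. Qed.
Lemma dotr_suml n (I : finType) (F : I -> 'rV[R]_n) v :
  dotr (\sum_i F i) v = \sum_i dotr (F i) v.
Proof. by rewrite /dotr mulmx_suml summxE. Qed.
Lemma dotr_sumr n (I : finType) (F : I -> 'rV[R]_n) v :
  dotr v (\sum_i F i) = \sum_i dotr v (F i).
Proof. by rewrite dotrC dotr_suml; under eq_bigr do rewrite dotrC. Qed.

Lemma dotr_mulmx n m (A : 'M[R]_(n, m)) (u : 'rV_n) (v : 'rV_m) :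
  dotr (u *m A) v = dotr u (v *m A^T).
Proof. by rewrite /dotr trmx_mul trmxK mulmxA. Qed.

Lemma dotrr_ge0 n (u : 'rV[R]_n) : 0 <= dotr u u.
Proof. by rewrite dotrE sumr_ge0// => j _; rewrite -expr2 sqr_ge0. Qed.

Lemma dotrr_eq0 n (u : 'rV[R]_n) : (dotr u u == 0) = (u == 0).
Proof.
apply/eqP/eqP => [|->]; last exact: dotr0l.
rewrite dotrE => /eqP; rewrite psumr_eq0 => [/allP u0|j _]; last first.
  by rewrite -expr2 sqr_ge0.
apply/rowP => j; rewrite mxE.
by have := u0 j (mem_index_enum _); rewrite -expr2 sqrf_eq0 => /eqP.
Qed.

Lemma nrm_ge0 n (u : 'rV[R]_n) : 0 <= nrm u.
Proof. exact: sqrtr_ge0. Qed.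
Lemma nrm2 n (u : 'rV[R]_n) : nrm u ^+ 2 = dotr u u.
Proof. by rewrite sqr_sqrtr// dotrr_ge0. Qed.
Lemma nrm_eq0 n (u : 'rV[R]_n) : (nrm u == 0) = (u == 0).
Proof. by rewrite -sqrf_eq0 nrm2 dotrr_eq0. Qed.
Lemma nrm_gt0 n (u : 'rV[R]_n) : (0 < nrm u) = (u != 0).
Proof. by rewrite lt_def nrm_ge0 andbT nrm_eq0. Qed.
Lemma nrm0 n : nrm (0 : 'rV[R]_n) = 0.
Proof. by apply/eqP; rewrite nrm_eq0. Qed.
Lemma nrmZ n a (u : 'rV[R]_n) : nrm (a *: u) = `|a| * nrm u.
Proof.
by rewrite /nrm dotrZl dotrZr mulrA -expr2 sqrtrM ?sqr_ge0// sqrtr_sqr.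
Qed.
Lemma nrmN n (u : 'rV[R]_n) : nrm (- u) = nrm u.
Proof. by rewrite -scaleN1r nrmZ normrN1 mul1r. Qed.
Lemma nrmBC n (u v : 'rV[R]_n) : nrm (u - v) = nrm (v - u).
Proof. by rewrite -nrmN opprB. Qed.

Lemma dotr_le_nrm n (u v : 'rV[R]_n) : dotr u v <= nrm u * nrm v.
Proof.
have [->|u0] := eqVneq u 0; first by rewrite dotr0l nrm0 mul0r.
have [->|v0] := eqVneq v 0; first by rewrite dotr0r nrm0 mulr0.
have a0 : 0 < nrm u by rewrite nrm_gt0.
have b0 : 0 < nrm v by rewrite nrm_gt0.
have := dotrr_ge0 (nrm v *: u - nrm u *: v).
rewrite !(dotrDl, dotrDr, dotrNl, dotrNr, dotrZl, dotrZr) -!nrm2 (dotrC v u).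
move=> h; suff : 0 <= (2 * nrm u * nrm v) * (nrm u * nrm v - dotr u v).
  by rewrite pmulr_rge0 ?subr_ge0// !mulr_gt0.
by apply: le_trans h _; apply: ler_of_eq; ring.
Qed.

Lemma ler_nrmD n (u v : 'rV[R]_n) : nrm (u + v) <= nrm u + nrm v.
Proof.
rewrite -(@ler_pXn2r _ 2) ?nnegrE ?addr_ge0 ?nrm_ge0//.
rewrite nrm2 !(dotrDl, dotrDr) (dotrC v u) sqrrD !nrm2.
have := dotr_le_nrm u v; lra.
Qed.

Lemma ler_nrmB n (u v : 'rV[R]_n) : nrm (u - v) <= nrm u + nrm v.
Proof. by rewrite -(nrmN v) ler_nrmD. Qed.

Lemma ler_nrm_dist n (u v w : 'rV[R]_n) : nrm (u - w) <= nrm (u - v) + nrm (v - w).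
Proof. by apply: le_trans (ler_nrmD _ _); rewrite addrA subrK. Qed.

Lemma nrm_pyth n (u v : 'rV[R]_n) : dotr u v = 0 ->
  nrm (u + v) ^+ 2 = nrm u ^+ 2 + nrm v ^+ 2.
Proof. by move=> uv; rewrite !nrm2 !(dotrDl, dotrDr) (dotrC v u) uv; ring. Qed.

Lemma ler_nrm_coord n (u : 'rV[R]_n) j : `|u 0 j| <= nrm u.
Proof.
rewrite -(@ler_pXn2r _ 2) ?nnegrE ?nrm_ge0// nrm2 dotrE (bigD1 j)//=.
rewrite real_normK ?num_real// -expr2 lerDl sumr_ge0// => k _.
by rewrite -expr2 sqr_ge0.
Qed.

Definition oproj n (P : 'M[R]_n) := P^T = P /\ P *m P = P.

Lemma oprojC n (P : 'M[R]_n) : oproj P -> oproj (1%:M - P).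
Proof.
move=> [PT PP]; split; first by rewrite linearB/= trmx1 PT.
by rewrite mulmxBl mul1mx mulmxBr mulmx1 PP subrr subr0.
Qed.

Lemma mulmx_compl m n (v : 'M[R]_(m, n)) P : v *m (1%:M - P) = v - v *m P.
Proof. by rewrite mulmxBr mulmx1. Qed.

Lemma oprojC_mul n (P : 'M[R]_n) : oproj P -> (1%:M - P) *m P = 0.
Proof. by move=> [_ PP]; rewrite mulmxBl mul1mx PP subrr. Qed.

Lemma oproj_dot n (P : 'M[R]_n) u v : oproj P ->
  dotr (u *m P) (v *m (1%:M - P)) = 0.
Proof.
by move=> HP; rewrite dotr_mulmx HP.1 -mulmxA oprojC_mul// mulmx0 dotr0r.
Qed.

Lemma oproj_pyth n (P : 'M[R]_n) v : oproj P ->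
  nrm v ^+ 2 = nrm (v *m P) ^+ 2 + nrm (v *m (1%:M - P)) ^+ 2.
Proof.
by move=> HP; rewrite -nrm_pyth ?oproj_dot// mulmx_compl addrC subrK.
Qed.

Lemma oproj_le n (P : 'M[R]_n) v : oproj P -> nrm (v *m P) <= nrm v.
Proof.
move=> /(oproj_pyth v) E.
by rewrite -(@ler_pXn2r _ 2) ?nnegrE ?nrm_ge0// E lerDl sqr_ge0.
Qed.

Lemma oprojC_le n (P : 'M[R]_n) v : oproj P -> nrm (v *m (1%:M - P)) <= nrm v.
Proof. by move=> /oprojC /oproj_le. Qed.

(** An upper bound for the operator norm, kept as a predicate so that no supremum has to be
    formed. *)
Definition mxbound m n (A : 'M[R]_(m, n)) (K : R) := forall v, nrm (v *m A) <= K * nrm v.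

Lemma mxbound_mul m n p (A : 'M[R]_(m, n)) (B : 'M[R]_(n, p)) a b : 0 <= b ->
  mxbound A a -> mxbound B b -> mxbound (A *m B) (a * b).
Proof.
move=> b0 Aa Bb v; rewrite mulmxA (le_trans (Bb _))// (mulrC a) -mulrA.
by rewrite ler_wpM2l.
Qed.

Lemma nrm_delta n (i : 'I_n) : nrm (delta_mx 0 i : 'rV[R]_n) = 1.
Proof.
apply/eqP; rewrite -(@eqrXn2 _ 2) ?nrm_ge0// nrm2 dotrE (bigD1 i)//= big1.
  by rewrite !mxE !eqxx mulr1 addr0 expr1n.
by move=> k ki; rewrite !mxE eqxx (negPf ki) mulr0.
Qed.

Lemma nrm_sum n (I : finType) (F : I -> 'rV[R]_n) :
  nrm (\sum_i F i) <= \sum_i nrm (F i).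
Proof.
elim/big_ind2: _ => [|x y z t xy zt|//]; first by rewrite nrm0.
by rewrite (le_trans (ler_nrmD _ _))// lerD.
Qed.

Lemma mxbound_entries m n (A : 'M[R]_(m, n)) a : 0 <= a ->
  (forall i j, `|A i j| <= a) -> mxbound A (m%:R * n%:R * a).
Proof.
move=> a0 Aa v.
have -> : v *m A = \sum_i \sum_j (v 0 i * A i j) *: delta_mx 0 j.
  rewrite {1}[v *m A]matrix_sum_delta big_ord1 exchange_big/=.
  apply: eq_bigr => j _; rewrite mxE scaler_suml//.
apply: le_trans (nrm_sum _) _.
have H (i : 'I_m) : nrm (\sum_j (v 0 i * A i j) *: (delta_mx 0 j : 'rV_n)) <= n%:R * (nrm v * a).
  apply: le_trans (nrm_sum _) _.
  have -> : n%:R * (nrm v * a) = \sum_(j < n) nrm v * a.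
    by rewrite sumr_const card_ord mulr_natl.
  apply: ler_sum => j _.
  rewrite nrmZ nrm_delta mulr1 normrM ler_pM//; exact: ler_nrm_coord.
apply: le_trans (ler_sum _ (fun i _ => H i)) _.
by rewrite sumr_const card_ord -mulr_natl; apply: ler_of_eq; ring.
Qed.

Lemma mxbound_exists m n (A : 'M[R]_(m, n)) : exists2 K, 0 < K & mxbound A K.
Proof.
pose a := \sum_i \sum_j `|A i j|.
have a0 : 0 <= a by rewrite sumr_ge0// => i _; rewrite sumr_ge0.
exists (m%:R * n%:R * a + 1); first by rewrite ltr_wpDl// !mulr_ge0.
move=> v; apply: le_trans (mxbound_entries a0 _ v) _ => [i j|]; last first.
  by rewrite ler_wpM2r ?nrm_ge0 ?lerDl.
rewrite /a (bigD1 i)//= (bigD1 j)//= -addrA lerDl addr_ge0 ?sumr_ge0// => k _.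
by rewrite sumr_ge0.
Qed.

Lemma mxbound_inv n (N : 'M[R]_n) K v : N \in unitmx ->
  mxbound (invmx N) K -> nrm v <= K * nrm (v *m N).
Proof. by move=> uN /(_ (v *m N)); rewrite mulmxK. Qed.

End Euclidean.

(** * Spectral theorem *)

Lemma exists_kernel_vector (F : fieldType) m n (A : 'M[F]_(m, n)) : (n < m)%N ->
  exists2 v : 'rV_m, v != 0 & v *m A = 0.
Proof.
move=> nm; have : kermx A != 0.
  rewrite -mxrank_eq0 mxrank_ker -lt0n subn_gt0.
  exact: leq_ltn_trans (rank_leq_col A) nm.
by case/rowV0Pn => v /sub_kermxP vA v0; exists v.
Qed.

Section Spectral.
Variable R : realType.

Lemma sum_continuous (T : topologicalType) (I : finType) (F : I -> T -> R) x :
  (forall i, F i y @[y --> x] --> F i x) ->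
  (\sum_i F i y) @[y --> x] --> \sum_i F i x.
Proof.
move=> cF; apply: (@cvg_big R I +%R 0 predT) => //.
exact: (@add_continuous R).
Qed.

(** Entrywise continuity at one point; sums and products then reduce to scalar limits. *)
Definition mxcontinuous (T : topologicalType) m n (f : T -> 'M[R]_(m, n)) (x : T) :=
  forall i j, f y i j @[y --> x] --> f x i j.

Lemma mxcontinuous_id m n (x : 'M[R]_(m, n)) : mxcontinuous id x.
Proof. by move=> i j; exact: coord_continuous. Qed.

Lemma mxcontinuous_cst (T : topologicalType) m n (A : 'M[R]_(m, n)) (x : T) :
  mxcontinuous (fun=> A) x.
Proof. by move=> i j; exact: cvg_cst. Qed.

Lemma mxcontinuous_tr (T : topologicalType) m n (f : T -> 'M[R]_(m, n)) x :
  mxcontinuous f x -> mxcontinuous (fun y => (f y)^T) x.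
Proof.
by move=> cf i j; rewrite mxE; under eq_fun do rewrite mxE; exact: cf.
Qed.

Lemma mxcontinuous_mul (T : topologicalType) m n p (f : T -> 'M[R]_(m, n))
    (g : T -> 'M[R]_(n, p)) x :
  mxcontinuous f x -> mxcontinuous g x -> mxcontinuous (fun y => f y *m g y) x.
Proof.
move=> cf cg i j; rewrite mxE; under eq_fun do rewrite mxE.
apply: (@sum_continuous _ _ (fun k y => f y i k * g y k j)) => k.
by apply: cvgM; [exact: cf|exact: cg].
Qed.

Lemma dotr_continuous (T : topologicalType) n (f g : T -> 'rV[R]_n) x :
  mxcontinuous f x -> mxcontinuous g x ->
  dotr (f y) (g y) @[y --> x] --> dotr (f x) (g x).
Proof.
by move=> cf cg; apply: (mxcontinuous_mul cf (mxcontinuous_tr cg)).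
Qed.

(** First variation at a maximizer of the Rayleigh quotient: along [v + t w] the deficit is a
    nonnegative quadratic in [t] without constant term, so its linear coefficient vanishes. The
    values [- q] and [- q / c] of [t] make this explicit. *)
Lemma dotr_mx_le n (A : 'M[R]_n) (l : R) (v w : 'rV[R]_n) (S : set 'rV[R]_n) :
  A^T = A -> dotr (v *m A) v = l * dotr v v ->
  (forall a b u1 u2, S u1 -> S u2 -> S (a *: u1 + b *: u2)) ->
  (forall u, S u -> dotr (u *m A) u <= l * dotr u u) ->
  S v -> S w -> dotr (v *m A) w = l * dotr v w.
Proof.
move=> AT Av Slin Sle Sv Sw.
pose q := l * dotr v w - dotr (v *m A) w.
pose c := l * dotr w w - dotr (w *m A) w.
have H t : 0 <= 2 * t * q + t ^+ 2 * c.
  have := Sle _ (Slin 1 t v w Sv Sw).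
  rewrite scale1r !(mulmxDl, dotrDl, dotrDr, dotrZl, dotrZr) -!scalemxAl.
  rewrite !(mulmxDl, dotrDl, dotrDr, dotrZl, dotrZr) Av.
  rewrite (dotrC w v) (dotr_mulmx A w v) AT (dotrC w) /q /c.
  set x := dotr _ _; set y := dotr _ _; set z := dotr _ _; set x' := dotr _ _.
  set y' := dotr _ _; lra.
have c0 : 0 <= c by rewrite subr_ge0; exact: Sle.
suff : q = 0 by rewrite /q => /eqP; rewrite subr_eq0 => /eqP.
apply/eqP/negPn/negP => q0.
have [c_eq|c_pos] := eqVneq c 0.
  have := H (- q); rewrite c_eq; have : 0 < q * q by rewrite -expr2 exprn_even_gt0.
  nra.
have := H (- q / c).
have -> : 2 * (- q / c) * q + (- q / c) ^+ 2 * c = - (q ^+ 2 / c) by field.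
rewrite oppr_ge0 leNgt divr_gt0 ?exprn_even_gt0//.
by rewrite lt_def c_pos.
Qed.

(* The eigenvectors are successive maximizers of the Rayleigh quotient. *)
Lemma spectral_partial n (A : 'M[R]_n) k : A^T = A -> (k <= n)%N ->
  exists (e : nat -> 'rV[R]_n) (l : nat -> R),
  [/\ forall i j, (i < k)%N -> (j < k)%N -> dotr (e i) (e j) = (i == j)%:R,
      forall i, (i < k)%N -> e i *m A = l i *: e i,
      forall i j, (i <= j)%N -> (j < k)%N -> l j <= l i &
      forall w i, (forall j, (j < k)%N -> dotr w (e j) = 0) -> (i < k)%N ->
        dotr (w *m A) w <= l i * dotr w w].
Proof.
move=> AT; elim: k => [|k IH] kn; first by exists (fun=> 0), (fun=> 0); split.
have [e [l [eo el lm lmax]]] := IH (ltnW kn).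
pose S := [set v : 'rV[R]_n | forall j, (j < k)%N -> dotr v (e j) = 0].
have Slin a b u1 u2 : S u1 -> S u2 -> S (a *: u1 + b *: u2).
  by move=> S1 S2 j jk; rewrite dotrDl !dotrZl S1// S2// !mulr0 addr0.
pose B := S `&` [set v | dotr v v = 1].
have B0 : B !=set0.
  have [v v0 vM] := @exists_kernel_vector _ n k (\matrix_(a < n, b < k) e b 0 a) kn.
  have nv : nrm v != 0 by rewrite nrm_eq0.
  exists ((nrm v)^-1 *: v); split.
    move=> j jk; rewrite dotrZl.
    have := congr1 (fun M : 'rV[R]_k => M 0 (Ordinal jk)) vM.
    rewrite !mxE dotrE => E; rewrite [X in _ * X](_ : _ = 0) ?mulr0// -[RHS]E.
    by apply: eq_bigr => a _; rewrite !mxE.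
  by rewrite /= dotrZl dotrZr -nrm2; field.
have cB : compact B.
  apply: bounded_closed_compact.
    exists 1; split => // M M1 v [_ /= v1].
    rewrite /Num.norm/= mx_normrE; apply/bigmax_leP; split => [|[i j] _] /=.
      by rewrite (le_trans ler01)// ltW.
    rewrite (ord1 i) (le_trans (ler_nrm_coord v j))//.
    rewrite (_ : nrm v = 1) 1?ltW//.
    by apply/eqP; rewrite -(@eqrXn2 _ 2) ?nrm_ge0// nrm2 v1 expr1n.
  apply: closedI.
    have -> : S = \bigcap_(j in [set j | (j < k)%N]) [set v | dotr v (e j) = 0] by [].
    apply: closed_bigI => j _.
    apply: (@preimage_closed _ _ (fun v : 'rV[R]_n => dotr v (e j)) [set 0]).
      by move=> v _; apply: dotr_continuous; [exact: mxcontinuous_id|exact: mxcontinuous_cst].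
    exact: closed_eq.
  apply: (@preimage_closed _ _ (fun v : 'rV[R]_n => dotr v v) [set 1]).
    by move=> v _; apply: dotr_continuous; exact: mxcontinuous_id.
  exact: closed_eq.
have cq : {within B, continuous (fun v : 'rV[R]_n => dotr (v *m A) v)}.
  apply: continuous_subspaceT => v; apply: dotr_continuous; last exact: mxcontinuous_id.
  by apply: mxcontinuous_mul; [exact: mxcontinuous_id|exact: mxcontinuous_cst].
have [v /set_mem [vS /= v1] vmax] := EVT_max_rV B0 cB cq.
pose lv := dotr (v *m A) v.
have Sle u : S u -> dotr (u *m A) u <= lv * dotr u u.
  move=> Su; have [->|u0] := eqVneq u 0; first by rewrite mul0mx !dotr0l mulr0.
  have nu : nrm u != 0 by rewrite nrm_eq0.
  have : B ((nrm u)^-1 *: u).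
    split; last by rewrite /= dotrZl dotrZr -nrm2; field.
    by move=> j jk; rewrite dotrZl Su// mulr0.
  move=> /mem_set /vmax; rewrite -scalemxAl dotrZl dotrZr -nrm2 -/lv => h.
  have : (nrm u)^+2 * ((nrm u)^-1 * ((nrm u)^-1 * dotr (u *m A) u)) <= (nrm u)^+2 * lv.
    by rewrite ler_wpM2l ?sqr_ge0.
  have -> : (nrm u)^+2 * ((nrm u)^-1 * ((nrm u)^-1 * dotr (u *m A) u)) = dotr (u *m A) u by field.
  by rewrite mulrC.
have SA u : S u -> S (u *m A).
  by move=> Su j jk; rewrite dotr_mulmx AT el// dotrZr Su// mulr0.
(* The residual [z] stays in [S] because [A] preserves [S], and the first variation makes it
   orthogonal to [S], hence to itself. *)
have vA : v *m A = lv *: v.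
  pose z := v *m A - lv *: v.
  have Sz : S z.
    by rewrite /z -[v *m A]scale1r -scaleNr; apply: Slin => //; exact: SA.
  have Hz : dotr z z = 0.
    have := @dotr_mx_le n A lv v z S AT _ Slin Sle vS Sz.
    rewrite v1 mulr1 => /(_ erefl) h.
    by rewrite {1}/z dotrDl dotrNl dotrZl h subrr.
  by apply/eqP; rewrite -subr_eq0 -/z -dotrr_eq0 Hz.
exists (fun j => if (j < k)%N then e j else v), (fun j => if (j < k)%N then l j else lv).
split.
- move=> i j; rewrite !ltnS => ik jk.
  case: ifPn => ik'; case: ifPn => jk'.
  + exact: eo.
  + by rewrite dotrC vS// (_ : (i == j) = false)//; apply/negP => /eqP; lia.
  + by rewrite vS// (_ : (i == j) = false)//; apply/negP => /eqP; lia.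
  + by rewrite v1 (_ : (i == j) = true)//; apply/eqP; lia.
- by move=> i _; case: ifPn => // ik; exact: el.
- move=> i j ij; rewrite ltnS => jk.
  case: ifPn => jk'; case: ifPn => ik' //; [exact: lm | lia |].
  by have := lmax v i vS ik'; rewrite v1 mulr1.
- move=> w i Hw; rewrite ltnS => ik.
  have Sw : S w.
    by move=> j jk; have := Hw j (ltn_trans jk (ltnSn k)); rewrite jk.
  by case: ifPn => ik'; [exact: lmax | exact: Sle].
Qed.
End Spectral.

(** * Singular values *)

Section Idempotents.
Variable R : rcfType.

(** For a full rank factorization P = X Y, idempotence forces Y X = 1 after cancelling on both
    sides. This turns rank into a quantity that passes to limits. *)
Lemma mxtrace_idempotent n (P : 'M[R]_n) : P *m P = P -> \tr P = (\rank P)%:R.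
Proof.
move=> PP.
have /row_freeP [B rB] := row_base_free P.
have /row_fullP [C Cc] := col_base_full P.
have := mulmx_base P; move: (col_base P) (row_base P) B C rB Cc => X Y B C rB Cc XY.
rewrite -[X in \tr X]XY mxtrace_mulC; suff -> : Y *m X = 1%:M by rewrite mxtrace1.
have : C *m (X *m Y *m (X *m Y)) *m B = C *m (X *m Y) *m B by rewrite XY PP.
by rewrite !mulmxA Cc !mul1mx -!mulmxA rB !mulmx1.
Qed.

End Idempotents.

(** * Orthonormal families and projections onto their tails *)

Section OrthonormalFamilies.
Variables (R : rcfType) (n : nat).
Implicit Types (e : nat -> 'rV[R]_n) (v w : 'rV[R]_n).

(** Indexed by [nat], with only the indices below [n] constrained, so that reversing or shifting the
    numbering needs no casts. *)
Definition orthofam e :=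
  forall i j, (i < n)%N -> (j < n)%N -> dotr (e i) (e j) = (i == j)%:R.

Lemma orthofam_expand e v : orthofam e -> v = \sum_(j < n) dotr v (e j) *: e j.
Proof.
move=> eo; pose O := \matrix_(j < n) e j.
have OO : O *m O^T = 1%:M.
  apply/matrixP => a b; rewrite !mxE -(eo a b)// dotrE.
  by apply: eq_bigr => j _; rewrite !mxE.
have OO' := mulmx1C OO.
rewrite -[LHS]mulmx1 -OO' mulmxA mulmx_sum_row.
apply: eq_bigr => j _; rewrite rowK; congr (_ *: _).
by rewrite mxE dotrE; apply: eq_bigr => k _; rewrite !mxE.
Qed.

Lemma orthofam_dot e v w : orthofam e ->
  dotr v w = \sum_(j < n) dotr v (e j) * dotr w (e j).
Proof.
move=> eo; rewrite {1}(orthofam_expand v eo) dotr_suml.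
by apply: eq_bigr => j _; rewrite dotrZl (dotrC w).
Qed.

Lemma orthofam_nrm e v : orthofam e ->
  nrm v ^+ 2 = \sum_(j < n) dotr v (e j) ^+ 2.
Proof. by move=> eo; rewrite nrm2 (orthofam_dot v v eo). Qed.

(** The orthogonal projection onto the span of the [e j] with [i <= j < n], as a sum of rank one
    projections. For a singular system in decreasing order these are the weakest directions. *)
Definition botproj e (i : nat) : 'M[R]_n :=
  \sum_(j < n | (i <= j)%N) (e j)^T *m e j.

Lemma mul_botproj e i v :
  v *m botproj e i = \sum_(j < n | (i <= j)%N) dotr v (e j) *: e j.
Proof.
rewrite /botproj mulmx_sumr; apply: eq_bigr => j _.
by rewrite mulmxA [v *m _]mx11_scalar mul_scalar_mx.
Qed.

Lemma botproj_coord e i v k : orthofam e -> (k < n)%N ->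
  dotr (v *m botproj e i) (e k) = if (i <= k)%N then dotr v (e k) else 0.
Proof.
move=> eo kn; rewrite mul_botproj big_mkcond dotr_suml (bigD1 (Ordinal kn))//= big1.
  by case: ifP => _; rewrite ?dotr0l ?dotrZl ?eo// ?eqxx ?mulr1 addr0.
move=> j jk; case: ifP => _; rewrite ?dotr0l// dotrZl eo//.
case: eqP; rewrite ?mulr0// => E.
by move/eqP: jk; case; exact/val_inj.
Qed.

Lemma botprojC_coord e i v k : orthofam e -> (k < n)%N ->
  dotr (v *m (1%:M - botproj e i)) (e k) = if (i <= k)%N then 0 else dotr v (e k).
Proof.
move=> eo kn; rewrite mulmx_compl dotrDl dotrNl botproj_coord//.
by case: ifP => _; rewrite ?subrr ?subr0.
Qed.

Lemma botproj_oproj e i : orthofam e -> oproj (botproj e i).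
Proof.
move=> eo; split.
  rewrite /botproj raddf_sum/=; apply: eq_bigr => j _.
  by rewrite trmx_mul trmxK.
apply/row_matrixP => k; rewrite !row_mul !rowE.
rewrite [LHS](orthofam_expand _ eo) [RHS](orthofam_expand _ eo).
by apply: eq_bigr => j _; congr (_ *: _); rewrite !botproj_coord//; case: (i <= j)%N.
Qed.

Lemma tr_botproj e i : orthofam e -> (i <= n)%N -> \tr (botproj e i) = (n - i)%:R.
Proof.
move=> eo iN; rewrite /botproj raddf_sum/=.
under eq_bigr => j _.
  rewrite mxtrace_mulC /mxtrace big_ord1 -/(dotr (e j) (e j)) eo// eqxx; over.
rewrite sumr_const; congr _%:R.
rewrite -sum1_card big_mkcond/=.
rewrite -(big_mkord xpredT (fun j => if (i <= j)%N then 1%N else 0%N)).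
rewrite (@big_cat_nat _ _ _ i)//= big_nat_cond big1 ?add0n => [|j]; last first.
  by rewrite andbT => /andP[_ ji]; rewrite leqNgt ji.
rewrite big_nat_cond (eq_bigr (fun=> 1%N)) => [|j /andP[/andP[-> _] _]//].
by rewrite -big_nat_cond sum_nat_const_nat muln1.
Qed.

Lemma rank_botproj e i : orthofam e -> (i <= n)%N -> \rank (botproj e i) = (n - i)%N.
Proof.
move=> eo iN; apply/eqP; rewrite -(eqr_nat R) -mxtrace_idempotent.
  by rewrite tr_botproj.
by have [] := botproj_oproj i eo.
Qed.

End OrthonormalFamilies.

(** * Singular systems of an invertible matrix and consequences of a gap *)

Section SVD.
Variables (R : rcfType) (n : nat).
Implicit Types (N L : 'M[R]_n) (e : nat -> 'rV[R]_n) (s : nat -> R) (v w : 'rV[R]_n).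

(** [e] consists of the input singular vectors; the output vectors are left implicit, as the
    orthogonal images [e i *m N] of length [s i]. Numbering starts at 0, so [s i] is the singular
    value of index i + 1. *)
Record svd N e s : Prop := SVD {
  svd_ortho : orthofam e ;
  svd_image : forall i j, (i < n)%N -> (j < n)%N ->
    dotr (e i *m N) (e j *m N) = (i == j)%:R * s i ^+ 2 ;
  svd_anti : forall i j, (i <= j)%N -> (j < n)%N -> s j <= s i ;
  svd_gt0 : forall i, (i < n)%N -> 0 < s i
}.

Lemma svd_dot N e s v w : svd N e s ->
  dotr (v *m N) (w *m N) = \sum_(j < n) dotr v (e j) * dotr w (e j) * s j ^+ 2.
Proof.
move=> [eo eN _ _].
rewrite {1}(orthofam_expand v eo) mulmx_suml dotr_suml; apply: eq_bigr => j _.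
rewrite -scalemxAl dotrZl -mulrA; congr (_ * _).
rewrite {1}(orthofam_expand w eo) mulmx_suml dotr_sumr (bigD1 j)//= big1.
  by rewrite -scalemxAl dotrZr eN// eqxx mul1r addr0.
move=> k kj; rewrite -scalemxAl dotrZr eN//.
case: eqP; rewrite ?mul0r ?mulr0// => E.
by move/eqP: kj; case; exact/val_inj.
Qed.

Lemma svd_nrm N e s v : svd N e s ->
  nrm (v *m N) ^+ 2 = \sum_(j < n) dotr v (e j) ^+ 2 * s j ^+ 2.
Proof. by move=> H; rewrite nrm2 (svd_dot _ _ H). Qed.

Lemma svd_le N e s v k : svd N e s -> (k < n)%N ->
  (forall j, (j < k)%N -> dotr v (e j) = 0) -> nrm (v *m N) <= s k * nrm v.
Proof.
move=> H kn vk; have sk := ltW (svd_gt0 H kn).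
rewrite -(@ler_pXn2r _ 2) ?nnegrE ?mulr_ge0 ?nrm_ge0//.
rewrite exprMn (svd_nrm _ H) (orthofam_nrm v (svd_ortho H)) mulr_sumr.
apply: ler_sum => j _; have [jk|kj] := ltnP j k.
  by rewrite vk// expr0n mul0r mulr0.
rewrite mulrC ler_wpM2r ?sqr_ge0// ler_pXn2r ?nnegrE//.
  exact: (svd_anti H).
exact: ltW (svd_gt0 H (ltn_ord j)).
Qed.

Lemma svd_ge N e s v k : svd N e s -> (k < n)%N ->
  (forall j, (k < j < n)%N -> dotr v (e j) = 0) -> s k * nrm v <= nrm (v *m N).
Proof.
move=> H kn vk; have sk := ltW (svd_gt0 H kn).
rewrite -(@ler_pXn2r _ 2) ?nnegrE ?mulr_ge0 ?nrm_ge0//.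
rewrite exprMn (svd_nrm _ H) (orthofam_nrm v (svd_ortho H)) mulr_sumr.
apply: ler_sum => j _; have [jk|kj] := leqP j k; last first.
  by rewrite vk ?kj ?ltn_ord// expr0n mul0r mulr0.
rewrite mulrC ler_wpM2l ?sqr_ge0// ler_pXn2r ?nnegrE//.
  exact: (svd_anti H).
exact: ltW (svd_gt0 H (ltn_ord j)).
Qed.

Lemma exists_orth (f : nat -> 'rV[R]_n) k : (k < n)%N ->
  exists2 v, v != 0 & forall j, (j < n)%N -> j != k -> dotr v (f j) = 0.
Proof.
move=> kn.
pose A := \matrix_(a < n, b < n.-1) f (lift (Ordinal kn) b) 0 a.
have [|v v0 vA] := exists_kernel_vector A; first by case: n kn {A}.
exists v => // j jn jk.
have [b E|E] := unliftP (Ordinal kn) (Ordinal jn); last first.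
  by move/(congr1 val): E jk => /= ->; rewrite eqxx.
have := congr1 (fun M : 'rV[R]_n.-1 => M 0 b) vA.
rewrite !mxE => E0; rewrite dotrE -[RHS]E0; apply: eq_bigr => a _.
by rewrite mxE -E.
Qed.

(* Courant-Fischer, in the form of a comparison between two maps. *)
Lemma svd_compare N e s N' e' s' L K k : svd N e s -> svd N' e' s' ->
  (k < n)%N -> mxbound L K -> (forall v, nrm (v *m N') <= nrm (v *m L *m N)) ->
  s' k <= K * s k.
Proof.
move=> H H' kn LK N'N.
(* The n - 1 conditions say that [v] is orthogonal to [e' j] for j > k and [v *m L] to [e j] for j <
   k. Thus [N'] stretches [v] by at least [s' k], and [N] stretches [v *m L] by at most [s k]. *)
pose f j := if (j < k)%N then e j *m L^T else e' j.
have [v v0 vf] := exists_orth f kn.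
have v0' : 0 < nrm v by rewrite nrm_gt0.
rewrite -(ler_pM2r v0'); apply: le_trans (svd_ge (v := v) H' kn _) _.
  move=> j /andP[kj jn]; have := vf j jn; rewrite /f ltnNge ltnW//=.
  by apply; rewrite neq_ltn kj orbT.
apply: le_trans (N'N v) _; apply: le_trans (svd_le H kn _) _.
  move=> j jk; have := vf j (ltn_trans jk kn); rewrite /f jk dotr_mulmx.
  by apply; rewrite neq_ltn jk.
by rewrite (mulrC K) -mulrA ler_wpM2l// ltW// (svd_gt0 H).
Qed.

(** The normalized images of the [e j] are singular vectors of the inverse, with reciprocal singular
    values. Taking reciprocals reverses the order, whence the index [n - j.+1]. *)
Lemma svd_inv N e s : svd N e s -> N \in unitmx ->
  svd (invmx N) (fun j => (s (n - j.+1)%N)^-1 *: (e (n - j.+1)%N *m N))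
    (fun j => (s (n - j.+1)%N)^-1).
Proof.
move=> H uN; have Hn j : (j < n)%N -> (n - j.+1 < n)%N by lia.
split => [i j|i j|i j|i].
- move=> iN jN; rewrite dotrZl dotrZr (svd_image H) ?Hn//.
  have -> : (n - i.+1 == n - j.+1)%N = (i == j) by apply/eqP/eqP; lia.
  case: eqP => [->|_]; last by rewrite mul0r !mulr0.
  have sj : s (n - j.+1)%N != 0 by rewrite gt_eqF// (svd_gt0 H) ?Hn.
  by rewrite mul1r expr2 mulKf// mulVf.
- move=> iN jN; rewrite -!scalemxAl !mulmxK// dotrZl dotrZr (svd_ortho H) ?Hn//.
  have -> : (n - i.+1 == n - j.+1)%N = (i == j) by apply/eqP/eqP; lia.
  by case: eqP => [->|_]; rewrite ?mulr1 ?mul1r ?mul0r ?mulr0// expr2.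
- move=> ij jN; rewrite lef_pV2 ?posrE ?(svd_gt0 H) ?Hn//; last by lia.
  by apply: (svd_anti H); lia.
- by move=> iN; rewrite invr_gt0 (svd_gt0 H) ?Hn.
Qed.

Section Gap.
Variables (N : 'M[R]_n) (e : nat -> 'rV[R]_n) (s : nat -> R) (i : nat).
Hypotheses (H : svd N e s) (i0 : (0 < i)%N) (iN : (i < n)%N).
Let P := botproj e i.

Lemma bot_le v : nrm (v *m P *m N) <= s i * nrm (v *m P).
Proof.
apply: (svd_le H iN) => j ji.
have jN := ltn_trans ji iN.
by rewrite (botproj_coord _ _ (svd_ortho H) jN) leqNgt ji.
Qed.

Lemma bot_le_fix v : v *m P = v -> nrm (v *m N) <= s i * nrm v.
Proof. by move=> vP; have := bot_le v; rewrite vP. Qed.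

Lemma top_ge v : s i.-1 * nrm (v *m (1%:M - P)) <= nrm (v *m (1%:M - P) *m N).
Proof.
have iN' : (i.-1 < n)%N by lia.
apply: (svd_ge H iN') => j /andP[ij jN].
rewrite (botprojC_coord _ _ (svd_ortho H) jN) (_ : (i <= j)%N)//; lia.
Qed.

Lemma bot_top_orth v w : dotr (v *m P *m N) (w *m (1%:M - P) *m N) = 0.
Proof.
rewrite (svd_dot _ _ H) big1// => j _; have eo := svd_ortho H.
by rewrite botproj_coord// botprojC_coord//; case: ifP; rewrite ?mulr0 !mul0r.
Qed.

(** The images of the weak and strong parts are orthogonal, so discarding the weak part can only
    shorten the image. *)
Lemma top_ge_full v : s i.-1 * nrm (v *m (1%:M - P)) <= nrm (v *m N).
Proof.
apply: le_trans (top_ge v) _.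
rewrite -(@ler_pXn2r _ 2) ?nnegrE ?nrm_ge0//.
have -> : v *m N = v *m P *m N + v *m (1%:M - P) *m N.
  by rewrite -mulmxDl mulmx_compl addrC subrK.
by rewrite (nrm_pyth (bot_top_orth v v)) lerDr sqr_ge0.
Qed.

End Gap.

(** The image under [L] of a weak vector of [N] is stretched little by [N'], whereas its strong
    component for [N'] is stretched by at least [s' i.-1]; hence that component is small. Of the
    factors K, one comes from comparing the two maps and two from comparing [s i] with [s' i]. It
    serves three times: for consecutive times, along the orbit, and for nearby base points. *)
Lemma bot_compare N e s N' e' s' L K i v : svd N e s -> svd N' e' s' ->
  (0 < i < n)%N -> 0 <= K -> mxbound L K ->
  (forall v, nrm (v *m L *m N') <= K * nrm (v *m N)) ->
  (forall v, nrm (v *m N) <= K * nrm (v *m L *m N')) ->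
  nrm (v *m botproj e i *m L *m (1%:M - botproj e' i)) <=
    K ^+ 3 * (s' i / s' i.-1) * nrm v.
Proof.
move=> H H' /andP[i0 iN] K0 LK h1 h2; set P := botproj e i.
have s0 : 0 < s' i.-1 by apply: (svd_gt0 H'); lia.
rewrite -(ler_pM2l s0).
apply: le_trans (top_ge_full H' i0 iN _) _.
apply: le_trans (h1 _) _.
have ss : s i <= (K * K) * s' i.
  apply: (svd_compare (L := K *: L) H' H iN).
    by move=> u; rewrite -scalemxAr nrmZ ger0_norm// -mulrA ler_wpM2l.
  by move=> u; rewrite -scalemxAr -scalemxAl nrmZ ger0_norm// -mulmxA mulmxA.
have : nrm (v *m P *m N) <= K * K * s' i * nrm v.
  apply: le_trans (bot_le H iN v) _.
  apply: ler_pM => //; rewrite ?nrm_ge0 ?(ltW (svd_gt0 H iN))//.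
  exact: oproj_le (botproj_oproj i (svd_ortho H)).
move=> /(ler_wpM2l K0) /le_trans; apply; apply: ler_of_eq.
by field; rewrite gt_eqF.
Qed.

End SVD.

(** * Limits of orthogonal projections *)

Section Frobenius.
Variable R : rcfType.

Lemma mxtraceB n (A B : 'M[R]_n) : \tr (A - B) = \tr A - \tr B.
Proof. exact: raddfB. Qed.

Definition frob2 m n (A : 'M[R]_(m, n)) : R := \tr (A *m A^T).

Lemma frob2E m n (A : 'M[R]_(m, n)) : frob2 A = \sum_i nrm (row i A) ^+ 2.
Proof.
apply: eq_bigr => i _; rewrite nrm2 dotrE mxE.
by apply: eq_bigr => j _; rewrite !mxE.
Qed.

Lemma entry_frob2 m n (A : 'M[R]_(m, n)) i j : A i j ^+ 2 <= frob2 A.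
Proof.
rewrite frob2E (bigD1 i)//= (le_trans (y := nrm (row i A) ^+ 2))//; last first.
  by rewrite lerDl sumr_ge0// => k _; rewrite sqr_ge0.
have := ler_nrm_coord (row i A) j; rewrite mxE => h.
by rewrite -real_normK ?num_real// ler_pXn2r ?nnegrE ?nrm_ge0.
Qed.

Lemma frob2_le m n (A : 'M[R]_(m, n)) K : mxbound A K ->
  frob2 A <= m%:R * K ^+ 2.
Proof.
move=> AK; rewrite frob2E mulr_natl -[X in _ *+ X]card_ord -sumr_const.
apply: ler_sum => i _; rewrite rowE.
have := AK (delta_mx 0 i); rewrite nrm_delta mulr1 => h.
by rewrite ler_pXn2r ?nnegrE ?nrm_ge0 ?(le_trans (nrm_ge0 _) h).
Qed.

(* For orthogonal projections of equal rank the two one-sided gaps agree. *)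
Lemma frob2_oproj n (P Q : 'M[R]_n) : oproj P -> oproj Q -> \tr P = \tr Q ->
  frob2 (P - Q) = 2 * frob2 (Q *m (1%:M - P)).
Proof.
move=> [PT PP] [QT QQ] PQ; rewrite /frob2.
have -> : \tr ((P - Q) *m (P - Q)^T) = \tr P + \tr Q - 2 * \tr (Q *m P).
  rewrite linearB/= PT QT mulmxBl !mulmxBr PP QQ !mxtraceB/= (mxtrace_mulC P Q).
  lra.
have [CT CC] := oprojC (conj PT PP).
rewrite trmx_mul CT QT -mulmxA (mulmxA (1%:M - P)) CC mulmxA (mxtrace_mulC (Q *m _)).
rewrite mulmxA QQ mulmx_compl mxtraceB/= PQ; lra.
Qed.

Lemma oproj_entry n (P Q : 'M[R]_n) K i j : oproj P -> oproj Q -> \tr P = \tr Q ->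
  0 <= K -> mxbound (Q *m (1%:M - P)) K -> `|P i j - Q i j| <= 2 * n%:R * K.
Proof.
move=> HP HQ PQ K0 /frob2_le h.
(* With n >= 1 the quantity 2 n K^2 is at most (2 n K)^2. *)
have n1 : 1 <= n%:R :> R by rewrite ler1n; case: n i {j P Q HP HQ PQ h} => // -[].
rewrite -(@ler_pXn2r _ 2) ?nnegrE ?mulr_ge0// real_normK ?num_real//.
have := entry_frob2 (P - Q) i j; rewrite !mxE => /le_trans; apply.
rewrite frob2_oproj//; have := sqr_ge0 K; rewrite !exprMn; nra.
Qed.

End Frobenius.

Section Limits.
Variable R : realType.

Lemma geometric_small (C tau eps : R) : 0 < tau < 1 -> 0 < eps ->
  exists n, forall m, (n <= m)%N -> C * tau ^+ m < eps.
Proof.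
move=> /andP[t0 t1] e0.
have : (C * tau ^+ n) @[n --> \oo] --> (0 : R).
  by apply: cvg_geometric; rewrite ger0_norm ?ltW.
move=> /(@cvgrPdist_lt _ _ _ _ eventually_filter) /(_ _ e0) [n _ nP].
exists n => m nm; have := nP m nm.
by rewrite sub0r normrN; apply: le_lt_trans; rewrite ler_norm.
Qed.

(** Identities between limit projections are obtained by applying this to the norm of their
    defect. *)
Lemma le0_geometric (C tau x : R) : 0 < tau < 1 ->
  (forall n, x <= C * tau ^+ n) -> x <= 0.
Proof.
move=> t01 xC; rewrite leNgt; apply/negP => x0.
have [n nP] := geometric_small C t01 x0.
by have := le_lt_trans (xC n) (nP n (leqnn n)); rewrite ltxx.
Qed.

Lemma geometric_limit (u : nat -> R) C tau : 0 < tau < 1 -> 0 <= C ->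
  (forall n, `|u n - u n.+1| <= C * tau ^+ n) ->
  exists l, forall n, `|l - u n| <= C / (1 - tau) * tau ^+ n.
Proof.
move=> /andP[t0 t1] C0 du; pose c := C / (1 - tau).
have t1' : 0 < 1 - tau by rewrite subr_gt0.
have c0 : 0 <= c by rewrite divr_ge0// ltW.
have CE : C = c * (1 - tau) by rewrite /c; field; rewrite gt_eqF.
have step n : u n - c * tau ^+ n <= u n.+1 - c * tau ^+ n.+1 /\
              u n.+1 + c * tau ^+ n.+1 <= u n + c * tau ^+ n.
  by have := du n; rewrite CE exprS ler_norml => /andP[h1 h2]; split; nra.
have lo : {homo (fun n => u n - c * tau ^+ n) : m n / (m <= n)%N >-> m <= n}.
  by apply: homo_leq => [//|x y z|n]; [exact: le_trans|have [] := step n].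
have hi : {homo (fun n => u n + c * tau ^+ n) : m n / (m <= n)%N >-> n <= m}.
  by apply: homo_leq => [//|x y z yx zy|n]; [exact: le_trans zy yx|have [] := step n].
have lohi m n : u m - c * tau ^+ m <= u n + c * tau ^+ n.
  apply: le_trans (lo _ _ (leq_maxl m n)) _.
  apply: le_trans _ (hi _ _ (leq_maxr m n)).
  have : 0 <= c * tau ^+ maxn m n by rewrite mulr_ge0// exprn_ge0// ltW.
  lra.
pose A := range (fun n => u n - c * tau ^+ n).
have supA : has_sup A.
  split; first by exists (u 0%N - c * tau ^+ 0); exists 0%N.
  by exists (u 0%N + c * tau ^+ 0) => _ [n _ <-].
exists (sup A) => n; rewrite ler_norml; apply/andP; split.
  by rewrite lerBrDr addrC; apply: ub_le_sup; [case: supA|exists n].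
rewrite lerBlDl; apply: ge_sup; first by case: supA.
by move=> _ [m _ <-].
Qed.

Lemma limit_oproj n (P : nat -> 'M[R]_n) (t C tau : R) : 0 < tau < 1 -> 0 <= C ->
  (forall k, oproj (P k)) -> (forall k, \tr (P k) = t) ->
  (forall k i j, `|P k i j - P k.+1 i j| <= C * tau ^+ k) ->
  exists Q, [/\ oproj Q, \tr Q = t &
    forall k, mxbound (Q - P k) (n%:R * n%:R * (C / (1 - tau) * tau ^+ k))].
Proof.
move=> t01 C0 HP trP dP; have /andP[t0 t1] := t01.
have /choice[q qP] (ij : 'I_n * 'I_n) :
    exists l, forall k, `|l - P k ij.1 ij.2| <= C / (1 - tau) * tau ^+ k.
  exact: (geometric_limit t01 C0 (fun k => dP k ij.1 ij.2)).
pose Q := \matrix_(i, j) q (i, j); pose c := C / (1 - tau).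
have c0 : 0 <= c by rewrite divr_ge0// subr_ge0 ltW.
have ct k : 0 <= c * tau ^+ k by rewrite mulr_ge0// exprn_ge0// ltW.
have QP k i j : `|Q i j - P k i j| <= c * tau ^+ k.
  by rewrite mxE; exact: (qP (i, j)).
have QPb k : mxbound (Q - P k) (n%:R * n%:R * (c * tau ^+ k)).
  by apply: mxbound_entries => // i j; have := QP k i j; rewrite !mxE.
exists Q; split => //; [split|].
- apply/matrixP => i j; rewrite mxE; apply/eqP; rewrite -subr_eq0 -normr_le0.
  apply: (@le0_geometric (2 * c) tau) => // k.
  have [PT _] := HP k.
  have -> : Q j i - Q i j = (Q j i - P k j i) - (Q i j - P k i j).
    by have -> : P k i j = P k j i; [rewrite -{1}PT mxE|ring].
  by rewrite (le_trans (ler_normB _ _))// -mulrA mulr_natl mulr2n lerD.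
- apply/row_matrixP => i; rewrite !rowE mulmxA; set v := delta_mx 0 i.
  apply/eqP; rewrite -subr_eq0 -nrm_eq0 eq_le nrm_ge0 andbT.
  set N2 := n%:R * n%:R in QPb.
  have N20 : 0 <= N2 by rewrite mulr_ge0.
  apply: (@le0_geometric (N2 * c * (nrm (v *m Q) + nrm v + nrm v)) tau) => // k.
  have -> : v *m Q *m Q - v *m Q = (v *m Q) *m (Q - P k) +
      (v *m (Q - P k) *m P k - v *m (Q - P k)).
    rewrite !mulmxBr !mulmxBl -(mulmxA v (P k)) (HP k).2.
    move: (v *m Q *m Q) (v *m Q *m P k) (v *m P k) (v *m Q) => a b c' d'.
    by apply/rowP => j; rewrite !mxE; ring.
  apply: le_trans (ler_nrmD _ _) _.
  have h1 := QPb k (v *m Q); have h2 := QPb k v.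
  have h3 := ler_nrmB (v *m (Q - P k) *m P k) (v *m (Q - P k)).
  have h4 := oproj_le (v *m (Q - P k)) (HP k).
  have -> : N2 * c * (nrm (v *m Q) + nrm v + nrm v) * tau ^+ k =
    N2 * (c * tau ^+ k) * nrm (v *m Q) + (N2 * (c * tau ^+ k) * nrm v + N2 * (c * tau ^+ k) * nrm v) by ring.
  by apply: lerD => //; apply: le_trans h3 _; apply: lerD => //; apply: le_trans h4 _.
- apply/eqP; rewrite -subr_eq0 -normr_le0.
  apply: (@le0_geometric (n%:R * c) tau) => // k.
  rewrite -(trP k) -mxtraceB (le_trans (ler_norm_sum _ _ _))//.
  rewrite -mulrA mulr_natl -[X in _ *+ X]card_ord -sumr_const.
  by apply: ler_sum => i _; have := QP k i i; rewrite !mxE.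
Qed.

(** Consecutive weak spaces are compared by [bot_compare] with [L] the identity. In the rate,
    [2 * n%:R] comes from passing to entries, [1 - tau] from the geometric series and [n%:R * n%:R]
    from passing back to an operator bound. *)
Lemma limit_space n (N : nat -> 'M[R]_n) e s i K C tau :
  (forall k, svd (N k) (e k) (s k)) -> (0 < i < n)%N -> 1 <= K ->
  0 < tau < 1 -> 0 <= C ->
  (forall k v, nrm (v *m N k.+1) <= K * nrm (v *m N k)) ->
  (forall k v, nrm (v *m N k) <= K * nrm (v *m N k.+1)) ->
  (forall k, s k i / s k i.-1 <= C * tau ^+ k) ->
  exists Q, [/\ oproj Q, \rank Q = (n - i)%N & forall k,
    mxbound (Q - botproj (e k) i)
      (n%:R * n%:R * (2 * n%:R * (K ^+ 3 * C) / (1 - tau) * tau ^+ k))].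
Proof.
move=> H iN K1 t01 C0 h1 h2 gap.
have K0 : 0 <= K := le_trans ler01 K1.
have t0 : 0 <= tau by have /andP[/ltW] := t01.
have HP k := botproj_oproj i (svd_ortho (H k)).
have trP k : \tr (botproj (e k) i) = (n - i)%:R.
  by apply: tr_botproj; [exact: svd_ortho (H k)|lia].
have [|k a b|Q [Q1 Q2 Q3]] :=
    limit_oproj (C := 2 * n%:R * (K ^+ 3 * C)) t01 _ HP trP.
- by rewrite !mulr_ge0// exprn_ge0.
- apply: le_trans (oproj_entry (K := K ^+ 3 * (C * tau ^+ k)) _ _ _ _ _ _ _) _ => //.
  + by rewrite !trP.
  + by rewrite !mulr_ge0 ?exprn_ge0.
  + move=> v; rewrite mulmxA.
    have := bot_compare (L := 1%:M) v (H k.+1) (H k) iN K0.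
    rewrite mulmx1 => h; apply: le_trans (h _ _ _) _ => [u|u|u|].
    * by rewrite mulmx1 ler_peMl// nrm_ge0.
    * by rewrite mulmx1.
    * by rewrite mulmx1.
    * by rewrite ler_wpM2r ?nrm_ge0// ler_wpM2l ?exprn_ge0.
  + by apply: ler_of_eq; ring.
exists Q; split => //; apply/eqP; rewrite -(eqr_nat R) -mxtrace_idempotent ?Q2//.
by case: Q1.
Qed.

End Limits.

(** * Volume expansion *)

Section Volume.
Variable R : rcfType.

Lemma rank_mul_tr m n (Q : 'M[R]_(m, n)) : \rank (Q *m Q^T) = \rank Q.
Proof.
rewrite -(mxrank_mul_ker Q Q^T) (_ : (Q :&: kermx Q^T)%MS = 0) ?mxrank0 ?addn0//.
apply/eqP/rowV0P => u; rewrite sub_capmx => /andP[/submxP[c ->] /sub_kermxP h].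
by apply/eqP; rewrite -dotrr_eq0 dotr_mulmx h dotr0r.
Qed.

(** The normal equations of orthogonal projection onto the row space; they are solvable even for
    dependent rows, since [Q *m Q^T] has the rank of [Q]. *)
Lemma orth_decomp m n (Q : 'M[R]_(m, n)) (v : 'rV[R]_n) :
  exists c : 'rV_m, (v - c *m Q) *m Q^T = 0.
Proof.
have QQ : (Q^T <= Q *m Q^T)%MS.
  have := mxrank_leqif_sup (submxMl Q Q^T).
  by rewrite rank_mul_tr mxrank_tr => -[_ <-].
have /submxP[c cE] : (v *m Q^T <= Q *m Q^T)%MS by exact: submx_trans (submxMl _ _) QQ.
by exists c; rewrite mulmxBl cE mulmxA subrr.
Qed.

Definition gram m n (Q : 'M[R]_(m, n)) : R := \det (Q *m Q^T).

Lemma gram_mul m n (g : 'M[R]_m) (Q : 'M[R]_(m, n)) :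
  gram (g *m Q) = \det g ^+ 2 * gram Q.
Proof. by rewrite /gram trmx_mul mulmxA -(mulmxA g) !det_mulmx det_tr; ring. Qed.

Lemma gram_col_orth m n (q : 'rV[R]_n) (Q : 'M[R]_(m, n)) : q *m Q^T = 0 ->
  gram (col_mx q Q) = nrm q ^+ 2 * gram Q.
Proof.
move=> qQ; rewrite /gram tr_col_mx mul_col_row qQ det_lblock nrm2; congr (_ * _).
by rewrite [q *m q^T]mx11_scalar det_scalar1.
Qed.

Lemma gram_shear m n (q : 'rV[R]_n) (Q : 'M[R]_(m, n)) c :
  gram (col_mx (q - c *m Q) Q) = gram (col_mx q Q).
Proof.
have -> : col_mx (q - c *m Q) Q = block_mx 1%:M (- c) 0 1%:M *m col_mx q Q.
  by rewrite mul_block_col !mul1mx mul0mx add0r mulNmx.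
by rewrite gram_mul det_ublock !det1 mulr1 expr1n mul1r.
Qed.

(** The volume of the parallelepiped spanned by the rows. It stands in for the norm of their wedge
    product and vanishes on dependent rows. *)
Definition vol m n (Q : 'M[R]_(m, n)) : R := Num.sqrt (gram Q).

Lemma vol_ge0 m n (Q : 'M[R]_(m, n)) : 0 <= vol Q.
Proof. exact: sqrtr_ge0. Qed.

Lemma vol_mul m n (g : 'M[R]_m) (Q : 'M[R]_(m, n)) :
  vol (g *m Q) = `|\det g| * vol Q.
Proof. by rewrite /vol gram_mul sqrtrM ?sqr_ge0// sqrtr_sqr. Qed.

Lemma vol_col m n (q : 'rV[R]_n) (Q : 'M[R]_(m, n)) c : (q - c *m Q) *m Q^T = 0 ->
  vol (col_mx q Q) = nrm (q - c *m Q) * vol Q.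
Proof.
move=> h; rewrite /vol -(gram_shear q Q c) gram_col_orth//.
by rewrite sqrtrM ?sqr_ge0// sqrtr_sqr ger0_norm ?nrm_ge0.
Qed.

Lemma vol_col_orth m n (q : 'rV[R]_n) (Q : 'M[R]_(m, n)) : q *m Q^T = 0 ->
  vol (col_mx q Q) = nrm q * vol Q.
Proof.
by move=> h; rewrite (@vol_col _ _ _ _ 0) ?mul0mx ?subr0.
Qed.

Lemma vol_col_le m n (q : 'rV[R]_n) (Q : 'M[R]_(m, n)) :
  vol (col_mx q Q) <= nrm q * vol Q.
Proof.
have [c qc] := orth_decomp Q q.
rewrite (vol_col qc) ler_wpM2r ?vol_ge0//.
rewrite -(@ler_pXn2r _ 2) ?nnegrE ?nrm_ge0//.
have <- : q - c *m Q + c *m Q = q by rewrite subrK.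
rewrite (@nrm_pyth _ _ (q - c *m Q)) ?addrK ?lerDl ?sqr_ge0//.
by rewrite dotrC dotr_mulmx qc dotr0r.
Qed.

(** With the other rows fixed, the volume is a constant times the distance from the first row to
    their span, which is a seminorm. *)
Lemma vol_col_triangle m n (s t : 'rV[R]_n) (Q : 'M[R]_(m, n)) :
  vol (col_mx (s + t) Q) <= vol (col_mx s Q) + vol (col_mx t Q).
Proof.
have [c sc] := orth_decomp Q s; have [b tb] := orth_decomp Q t.
have E : s + t - (c + b) *m Q = (s - c *m Q) + (t - b *m Q).
  by rewrite mulmxDl opprD addrACA.
rewrite (vol_col sc) (vol_col tb) (@vol_col _ _ _ _ (c + b)); last first.
  by rewrite E mulmxDl sc tb addr0.
by rewrite E -mulrDl ler_wpM2r ?vol_ge0// ler_nrmD.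
Qed.

(** Induction on the rows: the first row is replaced by its part orthogonal to the others, a shear
    that commutes with the action of [N] and preserves both volumes. *)
Lemma vol_mxbound m n (N : 'M[R]_n) K (Q : 'M[R]_(m, n)) : 0 <= K -> mxbound N K ->
  vol (Q *m N) <= K ^+ m * vol Q.
Proof.
move=> K0 NK; elim: m Q => [|m IH] Q; first by rewrite /vol /gram !det_mx00 mul1r.
rewrite -[Q](@vsubmxK _ 1 m n); set q := usubmx _; set Q' := dsubmx _.
have [c qc] := orth_decomp Q' q.
rewrite (vol_col qc) (@mul_col_mx _ 1 m).
rewrite {1}/vol -(gram_shear _ _ c) mulmxA -mulmxBl -/(vol _).
apply: le_trans (vol_col_le _ _) _.
have -> : K ^+ m.+1 * (nrm (q - c *m Q') * vol Q') = (K * nrm (q - c *m Q')) * (K ^+ m * vol Q').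
  by rewrite exprS; ring.
by apply: ler_pM; rewrite ?nrm_ge0 ?vol_ge0// NK.
Qed.

Lemma exists_first_row m (c : 'rV[R]_(1 + m)) : c != 0 ->
  exists2 g : 'M[R]_(1 + m), g \in unitmx & usubmx g = c.
Proof.
move=> c0; have := mulmx_ebase c; rewrite rank_rV c0.
set a := col_ebase c; set g := row_ebase c => E.
have ug : g \in unitmx := row_ebase_unit c.
have E2 : c = a *m usubmx g.
  by rewrite -{1}E -mulmxA; congr (_ *m _); rewrite -{1}[g]vsubmxK pid_mx_row
     mul_row_col mul1mx mul0mx addr0.
exists (block_mx a 0 0 1%:M *m g).
  rewrite unitmx_mul ug andbT unitmxE det_lblock det1 mulr1 -unitmxE.
  exact: col_ebase_unit.
by rewrite -[g in LHS]vsubmxK mul_block_col mul0mx addr0 col_mxKu -E2.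
Qed.

(** One step of Gram-Schmidt around a chosen vector of the row span. Changing [Q] by [g] multiplies
    the volumes before and after any map by the same [|\det g|], so inequalities between them may be
    checked on the new rows. *)
Lemma exists_orth_rows m n (Q : 'M[R]_(1 + m, n)) (c : 'rV[R]_(1 + m)) : c *m Q != 0 ->
  exists (g : 'M[R]_(1 + m)) Q', [/\ g \in unitmx, g *m Q = col_mx (c *m Q) Q' &
    (c *m Q) *m Q'^T = 0].
Proof.
move=> q0; have c0 : c != 0 by apply: contraNneq q0 => ->; rewrite mul0mx.
have [g ug gc] := exists_first_row c0.
set q := c *m Q in q0 *; pose Q'' := dsubmx (g *m Q).
have gQ : g *m Q = col_mx q Q''.
  rewrite -[LHS]vsubmxK; congr col_mx.
  by rewrite -{1}[g]vsubmxK gc mul_col_mx col_mxKu.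
clearbody q; have n0 : nrm q ^+ 2 != 0 by rewrite sqrf_eq0 nrm_eq0.
pose b := (nrm q ^+ 2)^-1 *: (Q'' *m q^T).
exists (block_mx 1%:M 0 (- b) 1%:M *m g), (Q'' - b *m q); split.
- by rewrite unitmx_mul ug andbT unitmxE det_lblock !det1 mulr1 unitr1.
- by rewrite -mulmxA gQ mul_block_col !mul1mx mul0mx addr0 mulNmx addrC.
- rewrite linearB/= mulmxBr /b -scalemxAl linearZ/= -scalemxAr !trmx_mul trmxK.
  rewrite !mulmxA [q *m q^T]mx11_scalar -/(dotr q q) -nrm2 mul_scalar_mx.
  by rewrite -scalemxAl scalerA mulVf// scale1r subrr.
Qed.

(** A vector [z] among the top m + 1 directions is added to [Q], chosen with image orthogonal to the
    image of [Q]: m conditions on m + 1 unknowns. The added row contributes at least [s m * nrm z]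
    to the image volume and at most [nrm z] to the initial one. *)
Lemma svd_vol_ge m n (N : 'M[R]_n) e s a (Q : 'M[R]_(m, n)) : svd N e s ->
  (m < n)%N -> 0 <= a ->
  (forall Q' : 'M[R]_(1 + m, n), vol (Q' *m N) <= a * vol Q') ->
  s m * vol (Q *m N) <= a * vol Q.
Proof.
move=> H mn a0 Na; have eo := svd_ortho H.
pose O := \matrix_(j < m.+1) e j.
have [c c0 cE] := exists_kernel_vector (O *m N *m (Q *m N)^T) (ltnSn m).
pose z := c *m O.
have kn (k : 'I_m.+1) : (k < n)%N := leq_trans (ltn_ord k) mn.
have zE j : (j < n)%N -> dotr z (e j) = if (j <= m)%N then c 0 (inord j) else 0.
  move=> jn; rewrite /z mulmx_sum_row dotr_suml.
  have [jm|jm] := leqP j m.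
    rewrite (bigD1 (inord j))//= big1.
      by rewrite dotrZl rowK inordK// eo// eqxx mulr1 addr0.
    move=> k kj; rewrite dotrZl rowK (eo _ _ (kn k) jn).
    case: eqP; rewrite ?mulr0// => E; move/eqP: kj; case; apply/val_inj.
    by rewrite /= -E inordK.
  rewrite big1// => k _; rewrite dotrZl rowK (eo _ _ (kn k) jn).
  by rewrite (_ : (_ == _) = false) ?mulr0//; apply/eqP; have := ltn_ord k; lia.
have z0 : z != 0.
  apply: contraNneq c0 => z0; apply/eqP/rowP => j; rewrite mxE.
  have jm := ltn_ord j; have := zE j (leq_trans jm mn).
  by rewrite z0 dotr0l -ltnS jm inord_val.
have zN : s m * nrm z <= nrm (z *m N).
  by apply: (svd_ge H mn) => j /andP[mj jn]; rewrite zE// leqNgt mj.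
have zp : 0 < nrm z by rewrite nrm_gt0.
have zorth : (z *m N) *m (Q *m N)^T = 0 by rewrite /z -!mulmxA mulmxA -cE !mulmxA.
have := Na (col_mx z Q); rewrite mul_col_mx vol_col_orth// => h.
rewrite -(ler_pM2l zp).
apply: le_trans (_ : nrm (z *m N) * vol (Q *m N) <= _).
  by rewrite mulrA ler_wpM2r ?vol_ge0// mulrC.
apply: le_trans h _; rewrite mulrCA ler_wpM2l// vol_col_le//.
Qed.

(* Replacing a vector of the plane that is almost in the slow space by its slow
   part costs the factor s m.+1 / s m in the expansion of volume. *)
Lemma vol_near_bot m n (N : 'M[R]_n) e s a r dlt (Q : 'M[R]_(1 + m, n)) c :
  svd N e s -> (m.+1 < n)%N -> 0 <= a -> 0 <= r -> s m.+1 <= r * s m ->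
  (forall Q' : 'M[R]_(1 + m, n), vol (Q' *m N) <= a * vol Q') ->
  c *m Q != 0 ->
  nrm (c *m Q *m (1%:M - botproj e m.+1)) <= dlt * nrm (c *m Q) ->
  vol (Q *m N) <= (dlt + r) * a * vol Q.
Proof.
move=> H mn a0 r0 sr Na q0 qd.
have [g [Q' [ug gQ qQ']]] := exists_orth_rows q0.
set q := c *m Q in q0 qd gQ qQ'; set P := botproj e m.+1 in qd.
have dg : 0 < `|\det g| by rewrite normr_gt0 -unitfE -unitmxE.
rewrite -(ler_pM2l dg) -vol_mul mulmxA gQ mulrCA -vol_mul gQ.
rewrite [vol (col_mx _ _) in leRHS]vol_col_orth// mul_col_mx.
(* The weak part of [q] is stretched by at most [s m.+1], and [s m] times the volume of the other
   images is at most [a * vol Q']; this gives the term in [r]. The strong part has length at most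
   [dlt * nrm q], which gives the other term. *)
have -> : q *m N = q *m P *m N + q *m (1%:M - P) *m N.
  by rewrite -mulmxDl mulmx_compl addrC subrK.
apply: le_trans (vol_col_triangle _ _ _) _.
rewrite [leRHS](_ : _ = r * nrm q * (a * vol Q') + a * (dlt * nrm q * vol Q')); last by ring.
apply: lerD.
  apply: le_trans (vol_col_le _ _) _.
  apply: le_trans (_ : (s m.+1 * nrm q) * vol (Q' *m N) <= _).
    rewrite ler_wpM2r ?vol_ge0//; apply: le_trans (bot_le H mn q) _.
    rewrite ler_wpM2l ?(ltW (svd_gt0 H mn))//.
    exact: oproj_le (botproj_oproj _ (svd_ortho H)).
  apply: le_trans (_ : r * nrm q * (s m * vol (Q' *m N)) <= _).
    rewrite [leRHS](_ : _ = (r * s m) * (nrm q * vol (Q' *m N))); last by ring.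
    by rewrite -mulrA ler_wpM2r// mulr_ge0 ?nrm_ge0 ?vol_ge0.
  by rewrite ler_wpM2l ?mulr_ge0 ?nrm_ge0// (svd_vol_ge Q' H (ltnW mn) a0 Na).
rewrite -mul_col_mx; apply: le_trans (Na _) _.
rewrite ler_wpM2l//; apply: le_trans (vol_col_le _ _) _.
by rewrite ler_wpM2r ?vol_ge0.
Qed.

End Volume.

(** * Cocycles and slow spaces *)

Section Cocycles.
Variables (R : realType) (X : Type) (n : nat).

Fixpoint cocycle (T : X -> X) (M : X -> 'M[R]_n) k x : 'M[R]_n :=
  if k is j.+1 then cocycle T M j x *m M (iter j T x) else 1%:M.

Lemma cocycleD T M j k x :
  cocycle T M (j + k) x = cocycle T M j x *m cocycle T M k (iter j T x).
Proof.
elim: k => [|k IH]; first by rewrite addn0 mulmx1.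
by rewrite addnS /= IH mulmxA -iterD addnC.
Qed.

Lemma cocycleSr T M k x : cocycle T M k.+1 x = M x *m cocycle T M k (T x).
Proof. by rewrite -add1n cocycleD /= mul1mx. Qed.

Lemma cocycle_unit T M k x : (forall y, M y \in unitmx) -> cocycle T M k x \in unitmx.
Proof. by move=> uM; elim: k => [|k IH] /=; rewrite ?unitmx1// unitmx_mul IH uM. Qed.

Lemma cocycle_bound T M K k x : 0 <= K -> (forall y, mxbound (M y) K) ->
  mxbound (cocycle T M k x) (K ^+ k).
Proof.
move=> K0 MK; elim: k => [|k IH] v /=; first by rewrite mulmx1 mul1r.
by rewrite exprSr; apply: mxbound_mul.
Qed.

(** The inverse automorphism goes from the fibre over [x] to the fibre over [S x], hence the shifted
    base point. *)
Definition invcocycle (S : X -> X) (M : X -> 'M[R]_n) x := invmx (M (S x)).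

Lemma invmxM (A B : 'M[R]_n) : A \in unitmx -> B \in unitmx ->
  invmx (A *m B) = invmx B *m invmx A.
Proof.
move=> uA uB; have uAB : A *m B \in unitmx by rewrite unitmx_mul uA uB.
apply: (can_inj (mulmxK uAB)); rewrite mulVmx//.
by rewrite -mulmxA (mulmxA (invmx A)) mulVmx// mul1mx mulVmx.
Qed.

Lemma iter_cancel (T S : X -> X) k : cancel S T -> cancel (iter k S) (iter k T).
Proof. by move=> ST; elim: k => // k IH x; rewrite iterSr /= ST IH. Qed.

Lemma cocycle_inv T S M k x : cancel S T -> (forall y, M y \in unitmx) ->
  cocycle S (invcocycle S M) k x = invmx (cocycle T M k (iter k S x)).
Proof.
move=> ST uM; elim: k x => [|k IH] x; first by rewrite /= invmx1.
rewrite cocycleSr IH -iterSr /= invmxM ?cocycle_unit//; congr (_ *m _).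
by rewrite -iterS iterSr iter_cancel.
Qed.

End Cocycles.

(** * The slow space of a cocycle with a gap, and its invariance *)

Section SlowSpace.
Variables (R : realType) (X : Type) (n : nat).
Variables (T : X -> X) (M : X -> 'M[R]_n) (K : R).
Hypotheses (uM : forall x, M x \in unitmx) (K1 : 1 <= K).
Hypotheses (MK : forall x, mxbound (M x) K) (VK : forall x, mxbound (invmx (M x)) K).
Variables (i : nat) (C tau : R) (e : X -> nat -> nat -> 'rV[R]_n) (s : X -> nat -> nat -> R).
Hypotheses (iN : (0 < i < n)%N) (t01 : 0 < tau < 1) (C0 : 0 <= C).
Hypothesis H : forall x k, svd (cocycle T M k x) (e x k) (s x k).
Hypothesis gap : forall x k, s x k i / s x k i.-1 <= C * tau ^+ k.

Let K0 : 0 <= K := le_trans ler01 K1.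

Lemma cocycleS_le x k v : nrm (v *m cocycle T M k.+1 x) <= K * nrm (v *m cocycle T M k x).
Proof. by rewrite /= mulmxA; exact: MK. Qed.

Lemma cocycleS_ge x k v : nrm (v *m cocycle T M k x) <= K * nrm (v *m cocycle T M k.+1 x).
Proof. by rewrite /= mulmxA; apply: mxbound_inv. Qed.

Definition slow_rate := n%:R * n%:R * (2 * n%:R * (K ^+ 3 * C) / (1 - tau)).

Lemma slow_rate_ge0 : 0 <= slow_rate.
Proof.
have /andP[_ t1] := t01.
by rewrite !mulr_ge0// ?exprn_ge0// invr_ge0 subr_ge0 ltW.
Qed.

Lemma slow_space : exists F : X -> 'M[R]_n,
  [/\ forall x, oproj (F x), forall x, \rank (F x) = (n - i)%N,
      forall x k, mxbound (F x - botproj (e x k) i) (slow_rate * tau ^+ k) &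
      forall x, F x *m M x *m F (T x) = F x *m M x].
Proof.
have /choice[F FP] x := limit_space (H x) iN K1 t01 C0 (cocycleS_le x) (cocycleS_ge x) (gap x).
exists F; split=> [x|x|x k|x]; [by have [] := FP x|by have [] := FP x| |].
  by have [_ _ h] := FP x => v; apply: le_trans (h k v) _; rewrite /slow_rate !mulrA.
have Fb y k : mxbound (F y - botproj (e y k) i) (slow_rate * tau ^+ k).
  by have [_ _ h] := FP y => v; apply: le_trans (h k v) _; rewrite /slow_rate !mulrA.
have OF y : oproj (F y) by have [] := FP y.
have OP y k : oproj (botproj (e y k) i) := botproj_oproj i (svd_ortho (H y k)).
apply/row_matrixP => j; rewrite !rowE !mulmxA.
set u := delta_mx 0 j *m F x.
have uF : u *m F x = u by rewrite /u -mulmxA (OF x).2.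
apply/eqP; rewrite eq_sym -subr_eq0 -mulmx_compl -nrm_eq0 eq_le nrm_ge0 andbT.
have t0 : 0 <= tau by have /andP[/ltW] := t01.
pose a := slow_rate * tau; pose b := K ^+ 3 * C; pose c := slow_rate.
apply: (@le0_geometric _ (K * (a * nrm u) + b * nrm u + c * (K * nrm u)) tau) => // k.
set P := botproj (e x k.+1) i; set P' := botproj (e (T x) k) i.
(* Invariance is tested at time k + 1 over [x] and time k over [T x], whose cocycles differ exactly
   by [M x]. The outer terms are approximation errors of [F]; the middle one is [bot_compare] with
   [L] equal to [M x]. *)
have -> : u *m M x *m (1%:M - F (T x)) =
    u *m (F x - P) *m M x *m (1%:M - P') + u *m P *m M x *m (1%:M - P') -
    u *m M x *m (F (T x) - P').
  rewrite -!mulmxDl -mulmxDr subrK uF mulmxBr mulmx1 mulmxBr mulmx1 mulmxBr.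
  by rewrite opprB addrA subrK.
have h1 : nrm (u *m (F x - P) *m M x *m (1%:M - P')) <= K * (a * tau ^+ k * nrm u).
  apply: le_trans (oprojC_le _ (OP _ _)) _; apply: le_trans (MK _ _) _.
  rewrite ler_wpM2l//; apply: le_trans (Fb _ _ _) _.
  by rewrite /a exprS mulrA.
have h2 : nrm (u *m P *m M x *m (1%:M - P')) <= b * tau ^+ k * nrm u.
  apply: le_trans (bot_compare u (H x k.+1) (H (T x) k) iN K0 (MK x) _ _) _.
  - by move=> v; rewrite cocycleSr mulmxA ler_peMl// nrm_ge0.
  - by move=> v; rewrite cocycleSr mulmxA ler_peMl// nrm_ge0.
  - by rewrite ler_wpM2r ?nrm_ge0// /b -mulrA ler_wpM2l ?exprn_ge0.
have h3 : nrm (u *m M x *m (F (T x) - P')) <= c * tau ^+ k * (K * nrm u).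
  apply: le_trans (Fb _ _ _) _; apply: ler_wpM2l; last exact: MK.
  by rewrite mulr_ge0 ?exprn_ge0// slow_rate_ge0.
apply: le_trans (ler_nrmB _ _) _; have := ler_nrmD (u *m (F x - P) *m M x *m (1%:M - P')) (u *m P *m M x *m (1%:M - P')).
move=> h4; apply: le_trans (lerD (le_trans h4 (lerD h1 h2)) h3) _.
by apply: ler_of_eq; ring.
Qed.

End SlowSpace.

(** * Transversality and domination *)

Section TransversalityStep.
Variables (R : realType) (n : nat).

Lemma rank_oprojC (P : 'M[R]_n) : oproj P -> \rank (1%:M - P) = (n - \rank P)%N.
Proof.
move=> HP; have HC := oprojC HP; apply/eqP.
rewrite -(eqr_nat R) -mxtrace_idempotent ?HC.2// mxtraceB mxtrace1.
by rewrite mxtrace_idempotent ?HP.2// natrB// rank_leq_row.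
Qed.

Lemma exists_preimage m (A : 'M[R]_(m, n)) (P : 'M[R]_n) t :
  \rank A = \rank P -> (forall c : 'rV_m, c *m A *m P = 0 -> c *m A = 0) ->
  exists c : 'rV_m, c *m A *m P = t *m P.
Proof.
move=> rAP inj.
have rk : \rank (A *m P) = \rank A.
  rewrite -[RHS](mxrank_mul_ker A P) (_ : (A :&: kermx P)%MS = 0) ?mxrank0 ?addn0//.
  apply/eqP/rowV0P => u; rewrite sub_capmx => /andP[/submxP[c ->] /sub_kermxP].
  exact: inj.
have PA : (P <= A *m P)%MS.
  by have := mxrank_leqif_sup (submxMl A P); rewrite rk rAP => -[_ <-].
have /submxP[c cE] : (t *m P <= A *m P)%MS by exact: submx_trans (submxMl _ _) PA.
by exists c; rewrite cE mulmxA.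
Qed.

(** Here [w] is almost weak for [N'] and almost in the image of the strong space of [N]. If the
    plane [Q] has a vector within [th] of the weak space of [N], volume is lost under [N]. Otherwise
    [Q] is a graph over the strong space, its image contains a vector near [w], and volume is lost
    under [N']. Transversality with angle [th] costs a factor 1 / th, and r = th^2 leaves r / th =
    th. *)
Lemma transversal_step m (N N' : 'M[R]_n) e s e' s' r a th C C2 (w : 'rV[R]_n)
    (Q : 'M[R]_(1 + m, n)) :
  svd N e s -> svd N' e' s' -> N \in unitmx -> (m.+1 < n)%N -> 0 <= a ->
  0 <= C -> 0 <= C2 -> 0 < th <= 1 -> r = th ^+ 2 ->
  s m.+1 <= C * r * s m -> s' m.+1 <= C * r * s' m ->
  (forall Q' : 'M[R]_(1 + m, n), vol (Q' *m N) <= a * vol Q') ->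
  (forall Q' : 'M[R]_(1 + m, n), vol (Q' *m N') <= a * vol Q') ->
  nrm w = 1 ->
  nrm (w *m (1%:M - botproj e' m.+1)) <= C2 * r ->
  nrm (w *m (1%:M - botproj (fun j => (s (n - j.+1)%N)^-1 *: (e (n - j.+1)%N *m N)) (n - m.+1)))
     <= C2 * r ->
  vol (Q *m N *m N') <= (1 + 10 * (C + C2)) * th * a ^+ 2 * vol Q.
Proof.
move=> H H' uN mn a0 C0 C20 /andP[th0 th1] rE gap gap' Na Na' w1 wb wt.
have r0 : 0 <= r by rewrite rE sqr_ge0.
have rth : r <= th by rewrite rE; nra.
set D := 1 + _.
have D1 : 1 + 10 * C + 10 * C2 <= D by rewrite /D; lra.
have triv : vol (Q *m N *m N') <= a ^+ 2 * vol Q.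
  by rewrite expr2 -mulrA; apply: le_trans (Na' _) _; rewrite ler_wpM2l.
have fin x : x <= D * th -> vol (Q *m N *m N') <= x * a ^+ 2 * vol Q ->
    vol (Q *m N *m N') <= D * th * a ^+ 2 * vol Q.
  move=> xD /le_trans; apply; rewrite ler_wpM2r ?vol_ge0//.
  by rewrite ler_wpM2r ?sqr_ge0.
have Cr0 : 0 <= C * r by rewrite mulr_ge0.
have [[c [q0 qd]]|far] := pselect (exists c : 'rV_(1 + m), c *m Q != 0 /\
    nrm (c *m Q *m (1%:M - botproj e m.+1)) <= th * nrm (c *m Q)).
  have h := vol_near_bot H mn a0 Cr0 gap Na q0 qd.
  apply: (fin (th + C * r)); first by rewrite /D; nra.
  apply: le_trans (Na' _) _.
  rewrite (_ : _ * vol Q = a * ((th + C * r) * a * vol Q)); last by ring.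
  by rewrite ler_wpM2l.
(* Nonzero volume makes the rows of [Q] independent, so that the plane has the dimension of the
   strong space and projects onto it. *)
have [vQ|vQ] := eqVneq (vol Q) 0; first by rewrite vQ mulr0 -(mulr0 (a ^+ 2)) -vQ.
set P := botproj e m.+1 in far.
have OP : oproj P := botproj_oproj _ (svd_ortho H).
have injQ (c : 'rV_(1 + m)) : c *m Q *m (1%:M - P) = 0 -> c *m Q = 0.
  move=> cP; apply/eqP/negPn/negP => q0; apply: far; exists c; split => //.
  by rewrite cP nrm0 mulr_ge0 ?nrm_ge0// ltW.
have rQ : \rank Q = \rank (1%:M - P).
  rewrite rank_oprojC// rank_botproj ?(ltnW mn)//; last exact: svd_ortho H.
  rewrite subKn ?(ltnW mn)// -rank_mul_tr mxrank_unit//.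
  rewrite unitmxE unitfE; apply: contraNneq vQ => d0.
  by rewrite /vol /gram d0 sqrtr0.
have HI := svd_inv H uN.
set e'' := fun j : nat => (s (n - j.+1)%N)^-1 *: _ in wt HI.
set P'' := botproj e'' _ in wt.
have OP'' : oproj P'' := botproj_oproj _ (svd_ortho HI).
(* [z] is the part of [w] in the image of the strong space; its preimage [t] has length at most 1 /
   s_m. The plane then supplies [p] with the same strong component as [t], so that [p - t] is
   weak. *)
pose z := w *m P''; pose t := z *m invmx N.
have [c ct] := exists_preimage t rQ injQ.
set p := c *m Q in ct.
have sm : 0 < s m by apply: (svd_gt0 H); exact: ltnW.
have sm1 : 0 < s m.+1 by apply: (svd_gt0 H).
have tz : s m * nrm t <= 1.
  have mn' : (m < n)%N := ltnW mn.
  have nmn : (n - m.+1 < n)%N by rewrite ltn_subrL (leq_ltn_trans _ mn).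
  have := bot_le HI nmn w; rewrite -/P'' -/z -/t.
  have -> : (n - (n - m.+1).+1)%N = m by rewrite subnSK// subKn// ltnW.
  rewrite -(ler_pM2l sm) mulrA mulfV ?gt_eqF// mul1r => /le_trans; apply.
  by rewrite -w1 oproj_le.
have pt : th * nrm p <= nrm t.
  have [p0|p0] := eqVneq p 0; first by rewrite p0 nrm0 mulr0 nrm_ge0.
  have : ~~ (nrm (p *m (1%:M - P)) <= th * nrm p).
    by apply/negP => h; apply: far; exists c.
  rewrite -ltNge => /ltW /le_trans; apply; rewrite ct; exact: oprojC_le.
have ptN : nrm ((p - t) *m N) <= s m.+1 * (nrm p + nrm t).
  apply: le_trans (_ : s m.+1 * nrm (p - t) <= _).
    apply: (bot_le_fix H mn); apply/eqP; rewrite eq_sym -subr_eq0 -mulmx_compl.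
    by rewrite mulmxBl ct subrr.
  by rewrite ler_wpM2l ?ler_nrmB// ltW.
have pNz : th * nrm ((p - t) *m N) <= 2 * C * r.
  apply: le_trans (_ : th * (s m.+1 * (nrm p + nrm t)) <= _).
    by rewrite ler_wpM2l// ltW.
  apply: le_trans (_ : s m.+1 * (2 * nrm t) <= _).
    rewrite mulrCA ler_wpM2l ?(ltW sm1)// mulrDr.
    have := nrm_ge0 t; nra.
  apply: le_trans (_ : C * r * s m * (2 * nrm t) <= _).
    by rewrite ler_wpM2r// mulr_ge0 ?nrm_ge0.
  rewrite (_ : _ * (2 * nrm t) = (2 * C * r) * (s m * nrm t)); last by ring.
  by rewrite ler_piMr// !mulr_ge0.
have {pNz} pNz : nrm ((p - t) *m N) <= 2 * C * th.
  by rewrite -(ler_pM2l th0); apply: le_trans pNz _; rewrite rE; apply: ler_of_eq; ring.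
have zw : nrm (z - w) <= C2 * th.
  rewrite nrmBC /z -mulmx_compl; apply: le_trans wt _; exact: ler_wpM2l.
have pw : nrm (p *m N - w) <= (2 * C + C2) * th.
  apply: le_trans (ler_nrm_dist _ z _) _.
  have -> : p *m N - z = (p - t) *m N by rewrite mulmxBl /t mulmxKV.
  by rewrite mulrDl lerD.
(* For large [th] the trivial bound a^2 is enough. Otherwise [p *m N] has length at least 1/2, and
   passing to relative errors at most doubles them. *)
have [big|small] := ltP 1 (2 * (2 * C + C2) * th).
  apply: (fin (2 * (2 * C + C2) * th)); first by rewrite ler_wpM2r ?(ltW th0)//; lra.
  apply: le_trans triv _; rewrite ler_wpM2r ?vol_ge0// ler_peMl ?sqr_ge0//.
  exact: ltW.
have pN : 1 / 2 <= nrm (p *m N).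
  have := ler_nrmB (p *m N) (p *m N - w); rewrite opprB addrC subrK w1.
  move: pw small; lra.
have OP' : oproj (botproj e' m.+1) := botproj_oproj _ (svd_ortho H').
have pNb : nrm (p *m N *m (1%:M - botproj e' m.+1)) <= (4 * C + 4 * C2) * th * nrm (p *m N).
  have -> : p *m N = (p *m N - w) + w by rewrite subrK.
  rewrite {1}mulmxDl; apply: le_trans (ler_nrmD _ _) _; rewrite subrK.
  have h1 := oprojC_le (p *m N - w) OP'.
  have h2 : C2 * r <= C2 * th by rewrite ler_wpM2l.
  have h3 : 0 <= C * th by rewrite mulr_ge0// ltW.
  have h4 : 0 <= C2 * th by rewrite mulr_ge0// ltW.
  move: pw wb pN; nra.
have pE : p *m N = c *m (Q *m N) by rewrite mulmxA.
rewrite pE in pN pNb.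
have pN0 : c *m (Q *m N) != 0 by rewrite -nrm_eq0 gt_eqF// (lt_le_trans _ pN).
have h := vol_near_bot H' mn a0 Cr0 gap' Na' pN0 pNb.
apply: (fin ((4 * C + 4 * C2) * th + C * r)).
  have : C * r <= C * th by rewrite ler_wpM2l.
  have : 0 <= C * th by rewrite mulr_ge0// ltW.
  have : 0 <= C2 * th by rewrite mulr_ge0// ltW.
  rewrite /D; lra.
apply: le_trans h _; rewrite -!mulrA ler_wpM2l ?addr_ge0 ?mulr_ge0 ?addr_ge0 ?mulr_ge0 ?(ltW th0)//.
by rewrite ler_wpM2l.
Qed.

End TransversalityStep.

(** * Uniform angle between the limit spaces, and the domination estimate *)

Section Domination.
Variables (R : realType) (X : Type) (n : nat).
Variables (T : X -> X) (M : X -> 'M[R]_n) (K : R).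
Hypotheses (uM : forall x, M x \in unitmx) (K1 : 1 <= K).
Hypotheses (MK : forall x, mxbound (M x) K) (VK : forall x, mxbound (invmx (M x)) K).
Variables (m : nat) (C tau : R) (e : X -> nat -> nat -> 'rV[R]_n) (s : X -> nat -> nat -> R).
Hypotheses (mn : (m.+1 < n)%N) (t01 : 0 < tau < 1) (C0 : 0 <= C).
Hypothesis H : forall x k, svd (cocycle T M k x) (e x k) (s x k).
Hypothesis gap : forall x k, s x k m.+1 / s x k m <= C * tau ^+ k.

Let K0 : 0 <= K := le_trans ler01 K1.
Let t0 : 0 <= tau. Proof. by have /andP[/ltW] := t01. Qed.
Let t1 : tau <= 1. Proof. by have /andP[_ /ltW] := t01. Qed.

(** The singular vectors that [svd_inv] assigns to the inverse of the time k map; they are based at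
    [iter k T x]. *)
Definition invfamily x k (j : nat) : 'rV[R]_n :=
  (s x k (n - j.+1)%N)^-1 *: (e x k (n - j.+1)%N *m cocycle T M k x).

Lemma cocycle_inv_bound k x : mxbound (invmx (cocycle T M k x)) (K ^+ k).
Proof.
elim: k => [|k IH] /=; first by move=> v; rewrite invmx1 mulmx1 mul1r.
rewrite invmxM ?cocycle_unit// exprS; apply: mxbound_mul => //.
by rewrite exprn_ge0.
Qed.

Lemma gap_mul x k : s x k m.+1 <= C * tau ^+ k * s x k m.
Proof. by rewrite -ler_pdivrMr// (svd_gt0 (H x k))// ltnW. Qed.

(* Volumes of m.+1-planes are expanded at most a_k in time k. If the fast and
   the slow spaces almost meet along the orbit, then a_{2k} <= D tau^(k/2) a_k^2,
   which makes a_k decay faster than any exponential. *)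
Lemma no_near_tangency (C2 : R) : 0 <= C2 -> exists J : nat, forall x (w : nat -> 'rV[R]_n),
  (forall j, (j <= J)%N -> nrm (w j) = 1) ->
  (forall j k, (j <= J)%N -> (k <= J)%N ->
    nrm (w j *m (1%:M - botproj (e (iter j T x) k) m.+1)) <= C2 * tau ^+ k) ->
  (forall j k, (j + k <= J)%N ->
    nrm (w (j + k)%N *m (1%:M - botproj (invfamily (iter j T x) k) (n - m.+1)))
      <= C2 * tau ^+ k) -> False.
Proof.
move=> C20; pose D := 1 + 10 * (C + C2); pose B := K ^+ m.+1.
have D1 : 1 <= D by rewrite lerDl mulr_ge0// addr_ge0.
have D0 : 0 < D := lt_le_trans ltr01 D1.
have B0 : 0 <= B by rewrite exprn_ge0.
have [tp tl] := andP t01.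
(* At time k the step has r = tau^k, so th = tau^(k/2) = q^(2k): doubling the time then gains
   exactly one factor [q] in the base of the power 2k. *)
pose q := Num.sqrt (Num.sqrt tau).
have qE : q ^+ 4 = tau by rewrite -[4%N]/(2 * 2)%N exprM !sqr_sqrtr// sqrtr_ge0.
have q0 : 0 < q by rewrite !sqrtr_gt0.
have q1 : q < 1.
  rewrite ltNge; apply/negP => q1; have := @exprn_ege1 _ 4 _ q1.
  by rewrite qE leNgt tl.
(* One factor [B] comes from the upper bound on volume, the other from the lower bound given by the
   inverse; [p0] doublings make [q ^+ p0] beat both. *)
have [|p0 Hp0] := @geometric_small _ (D * B ^+ 2) q 1 _ ltr01; first by rewrite q0.
exists (2 ^ p0)%N => x w w1 wb wt.
have claim p j : (j + 2 ^ p <= 2 ^ p0)%N -> forall Q : 'M[R]_(1 + m, n),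
    D * vol (Q *m cocycle T M (2 ^ p) (iter j T x)) <=
    (D * B * q ^+ p) ^+ (2 ^ p) * vol Q.
  elim: p j => [|p IH] j jp Q.
    rewrite expn0 expr1 expr0 mulr1 /= mul1mx -mulrA ler_wpM2l ?(ltW D0)//.
    exact: vol_mxbound.
  set k := (2 ^ p)%N in IH.
  have kk : (2 ^ p.+1 = k + k)%N by rewrite expnS mul2n addnn.
  rewrite kk in jp; rewrite kk cocycleD mulmxA.
  pose a := (D * B * q ^+ p) ^+ k / D.
  have a0 : 0 <= a by rewrite divr_ge0 ?exprn_ge0 ?mulr_ge0 ?exprn_ge0 ?(ltW D0) ?(ltW q0).
  have volA j' : (j' + k <= 2 ^ p0)%N -> forall Q' : 'M[R]_(1 + m, n),
      vol (Q' *m cocycle T M k (iter j' T x)) <= a * vol Q'.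
    move=> jk Q'; rewrite -(ler_pM2l D0) /a.
    rewrite (_ : D * (_ / D * _) = (D * B * q ^+ p) ^+ k * vol Q'); first exact: IH.
    by field; rewrite gt_eqF.
  have jk1 : (j + k <= 2 ^ p0)%N by apply: leq_trans jp; rewrite leq_add2l leq_addr.
  have kp0 : (k <= 2 ^ p0)%N by apply: leq_trans jk1; rewrite leq_addl.
  have yE : iter k T (iter j T x) = iter (j + k) T x by rewrite -iterD addnC.
  have th01 : 0 < q ^+ (2 * k) <= 1.
    by rewrite exprn_gt0// exprn_ile1// ltW.
  have rE : tau ^+ k = (q ^+ (2 * k)) ^+ 2.
    by rewrite -qE -!exprM mulnAC.
  have := @transversal_step R n m _ _ _ _ _ _ _ a _ C C2 (w (j + k)%N) Q
    (H (iter j T x) k) (H (iter k T (iter j T x)) k)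
    (cocycle_unit T k (iter j T x) uM) mn a0 C0 C20 th01 rE (gap_mul _ _) (gap_mul _ _)
    (volA j jk1).
  rewrite yE => /(_ (volA (j + k)%N _)).
  rewrite -addnA => /(_ jp (w1 _ jk1) (wb _ _ jk1 kp0) (wt _ _ jk1)).
  rewrite -(ler_pM2l D0) => /le_trans; apply; apply: ler_of_eq.
  rewrite -/D /a; set P := D * B * q ^+ p.
  have -> : D * B * q ^+ p.+1 = P * q by rewrite /P exprSr mulrA.
  rewrite !exprMn !exprD expr0.
  by field; rewrite gt_eqF.
have := claim p0 0%N (leqnn _) (pid_mx m.+1).
(* Any plane of volume 1 will do as a witness; the inverse bound prevents its volume from falling
   below B^(-k) at time k = 2^p0. *)
have vol1 : vol (pid_mx m.+1 : 'M[R]_(1 + m, n)) = 1.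
  rewrite /vol /gram tr_pid_mx mul_pid_mx minnn.
  by rewrite (minn_idPr _) ?pid_mx_1 ?det1 ?sqrtr1// ltnW.
rewrite /= vol1 mulr1; set N := cocycle _ _ _ _; set Q := pid_mx _ => h.
have uN : N \in unitmx by exact: cocycle_unit.
have := vol_mxbound (Q *m N) (exprn_ge0 _ K0) (@cocycle_inv_bound (2 ^ p0) x).
rewrite -/N mulmxK// vol1 -exprM mulnC exprM -/B => h2.
set k := (2 ^ p0)%N in h h2.
have Bk : 0 <= B ^+ k by rewrite exprn_ge0.
have h3 : D <= (D * B ^+ 2 * q ^+ p0) ^+ k.
  rewrite -[leLHS]mulr1; apply: le_trans (ler_wpM2l (ltW D0) h2) _.
  rewrite mulrCA; apply: le_trans (ler_wpM2l Bk h) _.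
  by rewrite -exprMn; apply: ler_of_eq; congr (_ ^+ _); ring.
have := Hp0 p0 (leqnn _); set y := D * B ^+ 2 * q ^+ p0 in h3 * => y1.
have y0 : 0 <= y by rewrite !mulr_ge0 ?exprn_ge0// ltW.
have : y ^+ k < 1 by rewrite exprn_ilt1// -lt0n expn_gt0.
by rewrite ltNge (le_trans D1 h3).
Qed.

Variables (F E : X -> 'M[R]_n) (c1 c2 : R).
Hypotheses (OF : forall x, oproj (F x)) (OE : forall x, oproj (E x)).
Hypotheses (c10 : 0 <= c1) (c20 : 0 <= c2).
Hypotheses (rE : forall x, \rank (E x) = m.+1).
Hypothesis apF : forall x k, mxbound (F x - botproj (e x k) m.+1) (c1 * tau ^+ k).
Hypothesis apE : forall x k,
  mxbound (E (iter k T x) - botproj (invfamily x k) (n - m.+1)) (c2 * tau ^+ k).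
Hypothesis invF : forall x, F x *m M x *m F (T x) = F x *m M x.
Hypothesis invE : forall x, E x *m M x *m E (T x) = E x *m M x.

Lemma cocycle_fix (G : X -> 'M[R]_n) k x (v : 'rV[R]_n) :
  (forall x, G x *m M x *m G (T x) = G x *m M x) -> v *m G x = v ->
  v *m cocycle T M k x *m G (iter k T x) = v *m cocycle T M k x.
Proof.
move=> invG vG; elim: k => [|k IH]; first by rewrite /= mulmx1.
rewrite /= mulmxA; set y := iter k T x in IH *.
set c := v *m _ in IH *.
by rewrite -{1}IH -(mulmxA c) -(mulmxA c) invG mulmxA IH.
Qed.

Lemma near_fix (G P : 'M[R]_n) c (v : 'rV[R]_n) : mxbound (G - P) c -> v *m G = v ->
  nrm (v *m (1%:M - P)) <= c * nrm v.
Proof. by move=> GP vG; apply: le_trans (GP v); rewrite mulmx_compl mulmxBr vG. Qed.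

(** If a vector of [E] is very close to [F], its whole orbit up to time [J] stays close, because the
    relative distance grows by at most K^2 per step. This is the configuration excluded by
    [no_near_tangency]. *)
Lemma uniform_transversality : exists2 alpha : R, 0 < alpha &
  forall x (v : 'rV[R]_n), v *m E x = v -> alpha * nrm v <= nrm (v *m (1%:M - F x)).
Proof.
have [J HJ] := @no_near_tangency (1 + c1 + c2) (addr_ge0 (addr_ge0 ler01 c10) c20).
have [tp _] := andP t01.
have Kp : 0 < K := lt_le_trans ltr01 K1.
(* Dividing by K^(2J) keeps the relative distance below tau^J up to time [J], hence below tau^k for
   every k <= J. In 1 + c1 + c2 the 1 stands for this distance, [c1] and [c2] for the approximations
   of [F] and [E]. *)
pose alpha := tau ^+ J / K ^+ (2 * J).
exists alpha; first by rewrite divr_gt0 ?exprn_gt0.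
move=> x v vE; rewrite leNgt; apply/negP => vF.
have v0 : 0 < nrm v.
  rewrite lt_def nrm_ge0 andbT; apply/eqP => v0; move: vF.
  by rewrite v0 mulr0 ltNge nrm_ge0.
pose u j := v *m cocycle T M j x.
have uge j : nrm v <= K ^+ j * nrm (u j).
  by apply: mxbound_inv; [exact: cocycle_unit|exact: cocycle_inv_bound].
have u0 j : 0 < nrm (u j).
  have := lt_le_trans v0 (uge j); rewrite pmulr_rgt0// exprn_gt0//.
have uE j : u j *m E (iter j T x) = u j by apply: cocycle_fix.
have uF j : nrm (u j *m (1%:M - F (iter j T x))) <= K ^+ j * (alpha * nrm v).
  (* The component in [F x] stays in [F] by invariance, so only the transverse component of [v]
     contributes. *)
  have E1 : u j *m (1%:M - F (iter j T x)) =
      v *m (1%:M - F x) *m cocycle T M j x *m (1%:M - F (iter j T x)).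
    rewrite [v *m (1%:M - F x)]mulmx_compl mulmxBl mulmxBl -/(u j).
    rewrite [v *m F x *m _ *m _]mulmx_compl (@cocycle_fix F)//.
      by rewrite subrr subr0.
    by rewrite -mulmxA (OF x).2.
  rewrite E1; apply: le_trans (oprojC_le _ (OF _)) _.
  apply: le_trans (cocycle_bound T j x K0 MK _) _.
  by rewrite ler_wpM2l ?exprn_ge0// ltW.
pose w j := (nrm (u j))^-1 *: u j.
have wZ j P : nrm (w j *m P) = (nrm (u j))^-1 * nrm (u j *m P).
  by rewrite -scalemxAl nrmZ ger0_norm// invr_ge0 nrm_ge0.
have w1 j : nrm (w j) = 1.
  by rewrite nrmZ ger0_norm ?invr_ge0 ?nrm_ge0// mulVf// gt_eqF.
have wE j : w j *m E (iter j T x) = w j by rewrite -scalemxAl uE.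
have wF j : (j <= J)%N -> nrm (w j *m (1%:M - F (iter j T x))) <= tau ^+ J.
  move=> jJ; rewrite wZ -(ler_pM2l (u0 j)) mulrA mulfV ?gt_eqF// mul1r.
  apply: le_trans (uF j) _.
  apply: le_trans (_ : K ^+ j * (alpha * (K ^+ j * nrm (u j))) <= _).
    rewrite ler_wpM2l ?exprn_ge0// ler_wpM2l// divr_ge0 ?exprn_ge0//.
  have KJ : K ^+ j * K ^+ j <= K ^+ (2 * J).
    by rewrite -exprD ler_weXn2l// mul2n -addnn leq_add.
  rewrite (_ : _ * (alpha * _) = (K ^+ j * K ^+ j) * (alpha * nrm (u j))); last by ring.
  apply: le_trans (ler_wpM2r _ KJ) _.
    by rewrite mulr_ge0 ?nrm_ge0// divr_ge0 ?exprn_ge0.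
  by apply: ler_of_eq; rewrite /alpha; field; rewrite gt_eqF// exprn_gt0.
have tk k : 0 <= tau ^+ k by rewrite exprn_ge0.
apply: (HJ x w) => [j _|j k jJ kJ|j k jk]; first exact: w1.
  have h1 := wF j jJ; have h2 := apF (iter j T x) k (w j).
  have h3 : tau ^+ J <= tau ^+ k by apply: ler_wiXn2l.
  have -> : w j *m (1%:M - botproj (e (iter j T x) k) m.+1) =
     w j *m (1%:M - F (iter j T x)) + w j *m (F (iter j T x) - botproj (e (iter j T x) k) m.+1).
    by rewrite -mulmxDr addrA subrK.
  apply: le_trans (ler_nrmD _ _) _; apply: le_trans (lerD (le_trans h1 h3) h2) _.
  by rewrite w1 mulr1 !mulrDl mul1r lerDl mulr_ge0.
have yE : iter (j + k) T x = iter k T (iter j T x) by rewrite -iterD addnC.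
have h := apE (iter j T x) k; rewrite -yE in h.
apply: le_trans (near_fix h (wE _)) _.
by rewrite w1 mulr1 ler_wpM2r// lerDr addr_ge0.
Qed.

(** A vector [v] of [F] is only approximately weak at time k, and its error might be stretched by
    the largest singular value. It is corrected by some [u'] in [E] so that [p = u' + v] is exactly
    weak. Transversality at the start bounds [u'] by [v]; transversality at the end bounds the image
    of [v] by that of [p]. *)
Lemma domination : exists2 c : R, 0 < c & forall k x (u v : 'rV[R]_n),
  u *m E x = u -> v *m F x = v ->
  nrm (v *m cocycle T M k x) * nrm u <= c * tau ^+ k * (nrm (u *m cocycle T M k x) * nrm v).
Proof.
have [al al0 trans] := uniform_transversality.
have [tp _] := andP t01.
have Kp : 0 < K := lt_le_trans ltr01 K1.
have al2 : 0 < al / 2 by rewrite divr_gt0.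
(* From time [n0] on, the weak space is so close to [F] that it keeps half of the angle with [E].
   Earlier times are absorbed in the constant [B] by the crude bound K^(2k). *)
have [n0 Hn0] := geometric_small c1 t01 al2.
pose A := (1 + al^-1) * 2 * C * (2 / al).
pose B := K ^+ (2 * n0) / tau ^+ n0.
have A0 : 0 <= A by rewrite !mulr_ge0// ?addr_ge0// ?invr_ge0 ltW.
have B0 : 0 < B by rewrite divr_gt0 ?exprn_gt0.
exists (A + B); first by rewrite ltr_wpDl.
move=> k x u v uE vF; set N := cocycle T M k x.
have z0 : 0 <= nrm (u *m N) * nrm v by rewrite mulr_ge0 ?nrm_ge0.
have tk : 0 <= tau ^+ k by rewrite exprn_ge0.
have [kn|nk] := ltnP k n0.
  have h1 : nrm (v *m N) <= K ^+ k * nrm v := cocycle_bound T k x K0 MK v.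
  have h2 : nrm u <= K ^+ k * nrm (u *m N).
    by apply: mxbound_inv; [exact: cocycle_unit|exact: cocycle_inv_bound].
  apply: le_trans (ler_pM (nrm_ge0 _) (nrm_ge0 _) h1 h2) _.
  rewrite (_ : _ * (K ^+ k * _) = K ^+ k * K ^+ k * (nrm (u *m N) * nrm v)); last by ring.
  rewrite ler_wpM2r//; apply: le_trans (_ : B * tau ^+ k <= _); last first.
    by rewrite mulrDl lerDr mulr_ge0.
  rewrite -exprD /B mulrAC ler_pdivlMr ?exprn_gt0//.
  apply: ler_pM; rewrite ?exprn_ge0//.
    by rewrite ler_weXn2l// mul2n -addnn leq_add// ltnW.
  by rewrite ler_wiXn2l// ltnW.
have small : c1 * tau ^+ k <= al / 2 by rewrite ltW// Hn0.
set P := botproj (e x k) m.+1.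
have OP : oproj P := botproj_oproj _ (svd_ortho (H x k)).
have EP (u' : 'rV[R]_n) : u' *m E x = u' -> al / 2 * nrm u' <= nrm (u' *m (1%:M - P)).
  move=> u'E; have h1 := trans x u' u'E; have h2 := apF x k u'.
  have -> : u' *m (1%:M - P) = u' *m (1%:M - F x) + u' *m (F x - P).
    by rewrite -mulmxDr addrA subrK.
  have h3 := ler_nrmB (u' *m (1%:M - F x) + u' *m (F x - P)) (u' *m (F x - P)).
  rewrite addrK in h3.
  have h4 : c1 * tau ^+ k * nrm u' <= al / 2 * nrm u' by rewrite ler_wpM2r ?nrm_ge0.
  rewrite -/P in h2; lra.
have [c cE] : exists c, c *m E x *m (1%:M - P) = (- v) *m (1%:M - P).
  apply: exists_preimage.
    rewrite rE rank_oprojC// rank_botproj ?subKn ?(ltnW mn)//; exact: svd_ortho (H x k).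
  move=> c' c'0; apply/eqP; rewrite -nrm_eq0 eq_le nrm_ge0 andbT.
  have := EP (c' *m E x); rewrite c'0 nrm0 -mulmxA (OE x).2 => /(_ erefl).
  by rewrite pmulr_rle0.
set u' := c *m E x in cE.
have u'E : u' *m E x = u' by rewrite /u' -mulmxA (OE x).2.
pose p := u' + v.
have pP : p *m P = p.
  apply/eqP; rewrite eq_sym -subr_eq0 -mulmx_compl mulmxDl cE mulNmx addNr //.
have vP : nrm (v *m (1%:M - P)) <= al / 2 * nrm v.
  by apply: le_trans (near_fix (apF x k) vF) _; rewrite ler_wpM2r ?nrm_ge0.
have u'v : nrm u' <= nrm v.
  rewrite -(ler_pM2l al2); apply: le_trans (EP u' u'E) _.
  by rewrite cE mulNmx nrmN.
have sm0 := svd_gt0 (H x k) (ltnW mn); have sm1 := svd_gt0 (H x k) mn.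
have pN : nrm (p *m N) <= s x k m.+1 * (2 * nrm v).
  apply: le_trans (bot_le_fix (H x k) mn pP) _.
  rewrite ler_wpM2l ?(ltW sm1)//; apply: le_trans (ler_nrmD _ _) _.
  by rewrite mulr_natl mulr2n lerD.
have u'N : al * nrm (u' *m N) <= nrm (p *m N).
  apply: le_trans (trans _ _ (cocycle_fix k invE u'E)) _.
  have -> : u' *m N *m (1%:M - F (iter k T x)) = p *m N *m (1%:M - F (iter k T x)).
    rewrite /p mulmxDl [RHS]mulmxDl -[LHS]addr0; congr (_ + _).
    by rewrite mulmx_compl (cocycle_fix k invF vF) subrr.
  exact: oprojC_le.
have vN : nrm (v *m N) <= (1 + al^-1) * nrm (p *m N).
  have -> : v *m N = p *m N - u' *m N by rewrite -mulmxBl /p addrC addKr.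
  apply: le_trans (ler_nrmB _ _) _; rewrite mulrDl mul1r lerD2l.
  by rewrite -(ler_pM2l al0) mulrA mulfV ?gt_eqF// mul1r.
have uN : s x k m * (al / 2 * nrm u) <= nrm (u *m N).
  apply: le_trans (_ : s x k m * nrm (u *m (1%:M - P)) <= _).
    by rewrite ler_wpM2l ?(ltW sm0)// EP.
  exact: (top_ge_full (H x k) (ltn0Sn m) mn u).
have al1 : 0 <= 1 + al^-1 by rewrite addr_ge0// invr_ge0 ltW.
apply: le_trans (_ : A * tau ^+ k * (nrm (u *m N) * nrm v) <= _); last first.
  by rewrite ler_wpM2r// ler_wpM2r// lerDl ltW.
apply: le_trans (_ : (1 + al^-1) * (C * tau ^+ k * s x k m * (2 * nrm v)) * nrm u <= _).
  rewrite ler_wpM2r ?nrm_ge0//; apply: le_trans vN _; rewrite ler_wpM2l//.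
  apply: le_trans pN _; rewrite ler_wpM2r ?gap_mul// mulr_ge0 ?nrm_ge0//.
rewrite [leLHS](_ : _ = A * tau ^+ k * (s x k m * (al / 2 * nrm u) * nrm v)); last first.
  by rewrite /A; field; rewrite gt_eqF.
apply: ler_wpM2l; first by rewrite mulr_ge0.
by apply: ler_wpM2r; rewrite ?nrm_ge0.
Qed.

End Domination.

(** * Singular values of maps between fibres *)

Section Frames.
Variables (R : realType) (L : vectType R) (dL : {dot L for idfun}).

Lemma dotC u v : dL u v = dL v u.
Proof. by rewrite hermC expr0 mul1r. Qed.

Lemma dot_linear_l a u v w : dL (a *: u + v) w = a * dL u w + dL v w.
Proof. by rewrite linearDl linearZl_LR. Qed.

Lemma dot_suml (I : finType) (F : I -> L) v : dL (\sum_i F i) v = \sum_i dL (F i) v.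
Proof.
elim/big_ind2: _ => [|x a y b <- <-|//]; first by rewrite linear0l.
by rewrite linearDl.
Qed.

Lemma dotZl a u v : dL (a *: u) v = a * dL u v.
Proof. by rewrite linearZl_LR. Qed.

Lemma dotZr a u v : dL u (a *: v) = a * dL u v.
Proof. by rewrite dotC dotZl dotC. Qed.

Lemma dot_gt0 u : u != 0 -> 0 < dL u u.
Proof. exact: neq0_dnorm_gt0. Qed.

(** A linear isometry onto R^d together with its inverse, in a single fibre. *)
Definition frame d (f : 'Hom(L, 'rV[R]_d)) (h : 'Hom('rV[R]_d, L)) :=
  [/\ cancel f h, cancel h f & forall u v, dL u v = dotr (f u) (f v)].

Definition dots k (o : nat -> L) (v : L) : 'rV[R]_k := \row_j dL v (o j).

Lemma dots_linear k o : linear (dots k o).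
Proof. by move=> a u v; apply/rowP => j; rewrite !mxE dot_linear_l. Qed.

HB.instance Definition _ k o := GRing.isLinear.Build R L 'rV[R]_k _ (dots k o) (dots_linear k o).

Definition combination d (o : nat -> L) (c : 'rV[R]_d) : L := \sum_(j < d) c 0 j *: o j.

Lemma combination_linear d o : linear (@combination d o).
Proof.
move=> a b c; rewrite /combination scaler_sumr -big_split/=; apply: eq_bigr => j _.
by rewrite !mxE scalerDl scalerA.
Qed.

HB.instance Definition _ d o :=
  GRing.isLinear.Build R 'rV[R]_d L _ (@combination d o) (@combination_linear d o).

Lemma exists_orthonormal k : (k <= \dim {:L})%N ->
  exists o : nat -> L, forall i j, (i < k)%N -> (j < k)%N -> dL (o i) (o j) = (i == j)%:R.
Proof.
elim: k => [|k IH] kd; first by exists (fun=> 0).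
case: (IH (ltnW kd)) => o oo.
pose h : 'Hom(L, 'rV[R]_k) := linfun (dots k o).
have : lker h != 0%VS.
  rewrite -dimv_eq0 -lt0n; have := limg_ker_dim h fullv; rewrite capfv.
  have : (\dim (limg h) <= k)%N.
    by apply: leq_trans (dimvS (subvf _)) _; rewrite dimvf dim_matrix mul1r.
  lia.
rewrite -vpick0; set v := vpick _ => v0.
have hv : h v = 0 by apply/eqP; rewrite -memv_ker; exact: memv_pick.
have vo j : (j < k)%N -> dL v (o j) = 0.
  move=> jk; have := congr1 (fun r : 'rV[R]_k => r 0 (Ordinal jk)) hv.
  by rewrite lfunE/= !mxE.
pose r := Num.sqrt (dL v v).
have r0 : r != 0 by rewrite gt_eqF// sqrtr_gt0 dot_gt0.
have rr : dL v v = r * r by rewrite -expr2 sqr_sqrtr// ltW// dot_gt0.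
exists (fun j => if (j < k)%N then o j else r^-1 *: v) => i j ik jk.
case: ifPn => ik'; case: ifPn => jk'.
- exact: oo.
- by rewrite dotZr dotC vo// mulr0 (_ : (i == j) = false)//; apply/negP => /eqP; lia.
- by rewrite dotZl vo// mulr0 (_ : (i == j) = false)//; apply/negP => /eqP; lia.
- have -> : (i == j) = true by apply/eqP; lia.
  by rewrite dotZl dotZr rr mulrA mulrACA mulVf// mul1r.
Qed.

Lemma exists_frame d : \dim {:L} = d -> exists f h, @frame d f h.
Proof.
move=> dimL; have : (d <= \dim {:L})%N by rewrite dimL.
case/exists_orthonormal => o oo.
pose f : 'Hom(L, 'rV[R]_d) := linfun (dots d o).
pose h : 'Hom('rV[R]_d, L) := linfun (@combination d o).
have fE v j : f v 0 j = dL v (o j) by rewrite lfunE/= mxE.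
have hf : cancel h f.
  move=> c; apply/rowP => j; rewrite fE lfunE/= dot_suml (bigD1 j)//= big1.
    by rewrite dotZl oo// eqxx mulr1 addr0.
  move=> k kj; rewrite dotZl oo//; case: eqP; rewrite ?mulr0// => E.
  by move/eqP: kj; case; exact/val_inj.
have fullh : limg h = fullv.
  apply/eqP; rewrite eqEdim subvf limg_dim_eq.
    by rewrite dimL dimvf dim_matrix mul1r leqnn.
  by apply/eqP; rewrite capfv; apply/lker0P; exact: can_inj hf.
have fh : cancel f h.
  move=> v; have : v \in limg h by rewrite fullh memvf.
  by case/memv_imgP => c _ ->; rewrite hf.
exists f, h; split=> // u v.
rewrite dotrE -{1}(fh u) [h _]lfunE/= dot_suml.
by apply: eq_bigr => j _; rewrite dotZl (dotC (o j)) !fE.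
Qed.

End Frames.

Section SingularValues.
Variables (R : realType) (U W : vectType R) (d : nat).
Variables (dU : {dot U for idfun}) (dW : {dot W for idfun}).
Variables (fU : 'Hom(U, 'rV[R]_d)) (hU : 'Hom('rV[R]_d, U)).
Variables (fW : 'Hom(W, 'rV[R]_d)) (hW : 'Hom('rV[R]_d, W)).
Hypotheses (FU : frame dU fU hU) (FW : frame dW fW hW).

Lemma spectral (A : 'M[R]_d) : A^T = A ->
  exists (e : nat -> 'rV[R]_d) (l : nat -> R), [/\ orthofam e,
    forall i, (i < d)%N -> e i *m A = l i *: e i &
    forall i j, (i <= j)%N -> (j < d)%N -> l j <= l i].
Proof. by move=> AT; have [e [l [? ? ? _]]] := spectral_partial AT (leqnn d); exists e, l. Qed.

Definition transport (L L' : vectType R) (f : 'Hom(L, 'rV[R]_d)) (h : 'Hom('rV[R]_d, L'))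
    (A : 'M[R]_d) : 'Hom(L, L') := (h \o (linfun (mulmxr A) \o f))%VF.

Lemma transportE (L L' : vectType R) (f : 'Hom(L, 'rV[R]_d)) (h : 'Hom('rV[R]_d, L')) A v :
  transport f h A v = h (f v *m A).
Proof. by rewrite /transport !comp_lfunE/= lfunE. Qed.

Lemma frame_matrix (S : 'End(U)) : exists A : 'M[R]_d, forall u, fU (S u) = fU u *m A.
Proof.
have [fh hf _] := FU.
exists (lin1_mx (fU \o S \o hU)) => u.
by rewrite mul_rV_lin1/= fh.
Qed.

(** The transpose in coordinates shows that an adjoint exists, so [xget] does not return its
    default; nondegeneracy then identifies the value returned. *)
Lemma adjoint_frame (B : 'Hom(U, W)) (N : 'M[R]_d) :
  (forall u, fW (B u) = fU u *m N) ->
  forall w, fU (adjoint dU dW B w) = fW w *m N^T.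
Proof.
have [fh hf dE] := FU; have [fh' hf' dE'] := FW.
move=> BN; have : forall u w, dW (B u) w = dU u (adjoint dU dW B w).
  rewrite /adjoint; apply: (@xgetPex _ 0 [set B' : 'Hom(W, U) | forall u w, dW (B u) w = dU u (B' w)]).
  exists (transport fW hU N^T) => u w.
  by rewrite transportE dE dE' hf BN dotr_mulmx.
move=> adj w; apply/eqP; rewrite -subr_eq0 -dotrr_eq0.
set z := (X in dotr X X); have := adj (hU z) w.
rewrite dE dE' BN hf dotr_mulmx => E.
by rewrite {2}/z dotrDr dotrNr E subrr.
Qed.

(** The eigenspace of [a] is spanned by the [e j] with [s j = a], so both lists have the same
    multiplicities; two sorted lists with equal counts coincide. *)
Lemma eigenvalues_frame (S : 'End(U)) (A : 'M[R]_d) e (s : nat -> R) :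
  (forall u, fU (S u) = fU u *m A) -> orthofam e ->
  (forall i, (i < d)%N -> e i *m A = s i *: e i) ->
  (forall i j, (i <= j)%N -> (j < d)%N -> s j <= s i) ->
  eigenvalues S = mkseq s d.
Proof.
have [fh hf dE] := FU => SA eo eA sm.
pose b := [tuple hU (e j) | j < d].
have Sb j : (j < d)%N -> S (hU (e j)) = s j *: hU (e j).
  by move=> jd; apply: (can_inj fh); rewrite SA hf eA// linearZ/= hf.
have ej0 j : (j < d)%N -> hU (e j) != 0.
  move=> jd; apply/eqP => h0; have := eo j j jd jd.
  by rewrite -(hf (e j)) h0 linear0 dotr0l eqxx => /eqP; rewrite eq_sym oner_eq0.
have fb : free b.
  apply/freeP => k k0 j.
  have : fU (\sum_(i < d) k i *: b`_i) = 0 by rewrite k0 linear0.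
  have bE (i : 'I_d) : b`_i = hU (e i) by rewrite -tnth_nth tnth_mktuple.
  under eq_bigr do rewrite bE.
  rewrite linear_sum/=; under eq_bigr do rewrite linearZ/= hf.
  move=> /(congr1 (fun v => dotr v (e j))); rewrite dotr0l dotr_suml (bigD1 j)//= big1.
    by rewrite addr0 dotrZl eo// eqxx mulr1.
  move=> i ij; rewrite dotrZl eo//; case: eqP; rewrite ?mulr0// => E.
  by move/eqP: ij; case; exact/val_inj.
have dimK a : \dim (passmx.leigenspace S a) = count_mem a (mkseq s d).
  pose p (v : U) := S v == a *: v.
  have inK v : (v \in passmx.leigenspace S a) = p v.
    by rewrite memv_ker add_lfunE opp_lfunE scale_lfunE id_lfunE /p subr_eq0.
  have -> : passmx.leigenspace S a = <<[seq v <- b | p v]>>%VS.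
    apply/eqP; rewrite eqEsubv; apply/andP; split; last first.
      by apply/span_subvP => v; rewrite mem_filter inK => /andP[].
    apply/subvP => v; rewrite inK => /eqP Sv.
    rewrite -(fh v) (orthofam_expand (fU v) eo) linear_sum/=.
    apply: memv_suml => j _; rewrite linearZ/=.
    have [sj|sj] := eqVneq (s j) a.
      apply/memvZ/memv_span; rewrite mem_filter /p Sb// sj eqxx/=.
      by apply/mapP; exists j; rewrite ?mem_enum.
    have : dotr (fU (S v)) (e j) = a * dotr (fU v) (e j) by rewrite Sv linearZ/= dotrZl.
    rewrite SA (orthofam_expand (fU v) eo) mulmx_suml dotr_suml.
    rewrite (bigD1 j)//= big1.
      rewrite -scalemxAl eA// !dotrZl eo// eqxx mulr1 addr0 -(orthofam_expand (fU v) eo).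
      move/eqP; rewrite mulrC -subr_eq0 -mulrBl mulf_eq0 subr_eq0 (negPf sj)/= => /eqP ->.
      by rewrite scale0r mem0v.
    move=> k kj; rewrite -scalemxAl eA// !dotrZl eo//; case: eqP; rewrite ?mulr0// => E.
    by move/eqP: kj; case; exact/val_inj.
  have /eqP -> := filter_free p fb.
  rewrite size_filter /b /= count_map.
  rewrite /mkseq -val_enum_ord !count_map.
  apply: eq_count => j /=; rewrite /p Sb//.
  by rewrite -subr_eq0 -scalerBl scaler_eq0 (negPf (ej0 _ _))// orbF subr_eq0.
have srt : sorted >=%R (mkseq s d).
  apply/(sortedP 0) => j; rewrite size_mkseq => jd.
  by rewrite !nth_mkseq ?(ltnW jd)//; exact: sm.
have [srt' cnt'] : sorted >=%R (eigenvalues S) /\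
    forall a : R, count_mem a (eigenvalues S) = \dim (passmx.leigenspace S a).
  rewrite /eigenvalues.
  by apply: (@xgetPex _ [::] [set t : seq R | sorted >=%R t /\
    forall a : R, count_mem a t = \dim (passmx.leigenspace S a)]); exists (mkseq s d); split.
apply: (sorted_eq (leT := >=%R)) => //.
- by move=> x y z /= yx zy; exact: le_trans zy yx.
- by move=> x y /=; rewrite andbC => /le_anti.
- by apply/allP => a _ /=; rewrite cnt' dimK.
Qed.

Lemma sigma_svd (B : 'Hom(U, W)) (N : 'M[R]_d) : N \in unitmx ->
  (forall u, fW (B u) = fU u *m N) ->
  exists e s, svd N e s /\ forall k, (k < d)%N -> sigma dU dW k.+1 B = s k.
Proof.
move=> uN BN; have [fh hf dE] := FU.
set P := (adjoint dU dW B \o B)%VF.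
have PE u : fU (P u) = fU u *m (N *m N^T).
  by rewrite comp_lfunE (adjoint_frame BN) BN mulmxA.
set S := psd_sqrt dU P.
have NN : (N *m N^T)^T = N *m N^T by rewrite trmx_mul trmxK.
have [S1 S2 S3] : [/\ forall u v, dU (S u) v = dU u (S v),
        forall u, 0 <= dU (S u) u & (S \o S)%VF = P].
  rewrite /S /psd_sqrt.
  apply: (@xgetPex _ 0 [set S : 'End(U) | [/\ forall u v, dU (S u) v = dU u (S v),
        forall u, 0 <= dU (S u) u & (S \o S)%VF = P]]).
  have [e [l [eo eA _]]] := spectral NN.
  have l0 i : (i < d)%N -> 0 <= l i.
    move=> id; have : dotr (e i *m (N *m N^T)) (e i) = l i.
      by rewrite eA// dotrZl eo// eqxx mulr1.
    by rewrite mulmxA dotr_mulmx trmxK => <-; exact: dotrr_ge0.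
  pose Q := \sum_(j < d) Num.sqrt (l j) *: ((e j)^T *m e j).
  have QT : Q^T = Q.
    rewrite raddf_sum/=; apply: eq_bigr => j _.
    by rewrite linearZ/= trmx_mul trmxK.
  have vQ v : v *m Q = \sum_(j < d) (Num.sqrt (l j) * dotr v (e j)) *: e j.
    rewrite mulmx_sumr; apply: eq_bigr => j _.
    by rewrite -scalemxAr mulmxA [v *m _]mx11_scalar mul_scalar_mx scalerA.
  have Qe v j : (j < d)%N -> dotr (v *m Q) (e j) = Num.sqrt (l j) * dotr v (e j).
    move=> jd; rewrite vQ dotr_suml (bigD1 (Ordinal jd))//= big1.
      by rewrite dotrZl eo// eqxx mulr1 addr0.
    move=> k kj; rewrite dotrZl eo//; case: eqP; rewrite ?mulr0// => E.
    by move/eqP: kj; case; exact/val_inj.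
  exists (transport fU hU Q); split.
  - by move=> u v; rewrite !dE !transportE !hf dotr_mulmx QT.
  - move=> u; rewrite dE transportE hf (orthofam_dot _ _ eo).
    rewrite sumr_ge0// => j _; rewrite Qe// -mulrA mulr_ge0 ?sqrtr_ge0//.
    by rewrite -expr2 sqr_ge0.
  - apply/lfunP => u; apply: (can_inj fh); rewrite PE comp_lfunE !transportE !hf.
    rewrite [LHS](orthofam_expand _ eo) [RHS](orthofam_expand _ eo).
    apply: eq_bigr => j _; congr (_ *: _); rewrite !Qe//.
    by rewrite mulrA -expr2 sqr_sqrtr ?l0// dotr_mulmx NN eA// dotrZr.
have [A SA] := frame_matrix S.
have AT : A^T = A.
  apply/row_matrixP => i; rewrite !rowE; apply/eqP; rewrite -subr_eq0 -dotrr_eq0.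
  set z := (X in dotr X X); rewrite {2}/z dotrDr dotrNr subr_eq0; apply/eqP.
  have := S1 (hU z) (hU (delta_mx 0 i)); rewrite !dE !SA !hf => <-.
  by rewrite dotr_mulmx.
(* The eigenbasis is that of the square root returned by [xget]; since its square is [N *m N^T], the
   images of these vectors under [N] are orthogonal of lengths [s i]. *)
have [e [s [eo eA sm]]] := spectral AT.
have AA (v : 'rV[R]_d) : v *m A *m A = v *m (N *m N^T).
  rewrite -(hf v) -PE -S3 comp_lfunE !SA //.
have s0 i : (i < d)%N -> 0 <= s i.
  move=> id; have := S2 (hU (e i)); rewrite dE SA hf eA// dotrZl eo// eqxx mulr1 //.
have eN i j : (i < d)%N -> (j < d)%N -> dotr (e i *m N) (e j *m N) = (i == j)%:R * s i ^+ 2.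
  move=> id jd; rewrite dotrC -[N in X in dotr _ X]trmxK -dotr_mulmx -mulmxA -AA.
  rewrite eA// -scalemxAl eA// scalerA dotrZl eo// eq_sym mulrC; case: eqP => [->|_].
    by rewrite expr2.
  by rewrite !mul0r.
exists e, s; split.
  split=> // i id; rewrite lt_def s0// andbT; apply/eqP => si.
  have := eN i i id id; rewrite si expr0n mulr0 => /eqP; rewrite dotrr_eq0 => /eqP eN0.
  have e0 : e i = 0 by rewrite -(mulmxK uN (e i)) eN0 mul0mx.
  have := eo i i id id; rewrite e0 dotr0l eqxx => /eqP.
  by rewrite eq_sym oner_eq0.
move=> k kd; rewrite /sigma /singular_values -/P -/S.
by rewrite (eigenvalues_frame SA eo eA sm)/= nth_mkseq.
Qed.

End SingularValues.

(** * Continuity of the slow space *)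

Section LocalContinuity.
Variables (R : realType) (X : topologicalType) (n : nat).

Lemma near_entries (f : X -> 'M[R]_n) x1 (eps : R) : mxcontinuous f x1 -> 0 < eps ->
  \forall x \near x1, forall i j, `|f x1 i j - f x i j| <= eps.
Proof.
move=> cf e0.
have : \forall x \near x1, forall ij : 'I_n * 'I_n, `|f x1 ij.1 ij.2 - f x ij.1 ij.2| <= eps.
  apply: filter_forall => -[i j] /=.
  have /(@cvgrPdist_le _ _ _ _ (nbhs_filter x1)) := cf i j.
  by move=> /(_ _ e0).
by apply: filterS => x h i j; exact: (h (i, j)).
Qed.

(** Squared lengths are what remains continuous when [B x] is known only up to an isometry depending
    arbitrarily on [x], as with frames taken from choice. *)
Definition form_continuous (B : X -> 'M[R]_n) x1 := forall a : 'rV[R]_n,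
  dotr (a *m B x) (a *m B x) @[x --> x1] --> dotr (a *m B x1) (a *m B x1).

Lemma gram_continuous (B : X -> 'M[R]_n) x1 : form_continuous B x1 ->
  mxcontinuous (fun x => B x *m (B x)^T) x1.
Proof.
move=> cB i j; pose ei : 'rV[R]_n := delta_mx 0 i; pose ej : 'rV[R]_n := delta_mx 0 j.
pose q (a : 'rV[R]_n) x := dotr (a *m B x) (a *m B x).
have E x : (B x *m (B x)^T) i j = (q (ei + ej) x - q ei x - q ej x) / 2.
  have -> : (B x *m (B x)^T) i j = dotr (ei *m B x) (ej *m B x).
    by rewrite -!rowE dotrE mxE; apply: eq_bigr => k _; rewrite !mxE.
  rewrite /q mulmxDl !(dotrDl, dotrDr) (dotrC (ej *m _) (ei *m _)); lra.
rewrite E; under eq_fun do rewrite E.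
by apply: cvgMr_tmp; apply: cvgB; [apply: cvgB|]; exact: cB.
Qed.

(** Since [B x1] is bounded below, additive closeness of the Gram matrices becomes multiplicative
    closeness of lengths. The constant [c] makes the squared lengths differ by at most half of that
    at [x1]. *)
Lemma near_comparable (B : X -> 'M[R]_n) x1 : B x1 \in unitmx -> form_continuous B x1 ->
  \forall x \near x1, forall a,
    nrm (a *m B x) <= 2 * nrm (a *m B x1) /\ nrm (a *m B x1) <= 2 * nrm (a *m B x).
Proof.
move=> uB cB; have [b b0 Bb] := mxbound_exists (invmx (B x1)).
pose c := n%:R * n%:R * b ^+ 2 + 1.
have c0 : 0 < c by rewrite ltr_wpDl// mulr_ge0 ?sqr_ge0// mulr_ge0.
have e0 : 0 < (2 * c)^-1 by rewrite invr_gt0 mulr_gt0.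
apply: filterS (near_entries (gram_continuous cB) e0) => x h a.
have ab : nrm a <= b * nrm (a *m B x1) by exact: mxbound_inv.
set D := B x1 *m (B x1)^T - B x *m (B x)^T.
have DE : dotr (a *m D) a = nrm (a *m B x1) ^+ 2 - nrm (a *m B x) ^+ 2.
  by rewrite !nrm2 /D mulmxBr dotrDl dotrNl !mulmxA !dotr_mulmx !trmxK.
have Dle : mxbound D (n%:R * n%:R * (2 * c)^-1).
  apply: mxbound_entries; first exact: ltW.
  by move=> i j; have := h i j; rewrite !mxE.
have key : `|dotr (a *m D) a| <= nrm (a *m B x1) ^+ 2 / 2.
  have h1 : `|dotr (a *m D) a| <= nrm (a *m D) * nrm a.
    rewrite ler_norml dotr_le_nrm andbT lerNl -dotrNl.
    by rewrite -(nrmN (a *m D)) dotr_le_nrm.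
  apply: le_trans h1 _.
  apply: le_trans (ler_pM (nrm_ge0 _) (nrm_ge0 _) (Dle a) ab) _.
  apply: le_trans (_ : n%:R * n%:R / (2 * c) * (b * nrm (a *m B x1)) * (b * nrm (a *m B x1)) <= _).
    rewrite ler_wpM2r ?mulr_ge0 ?nrm_ge0 ?(ltW b0)//.
    by rewrite ler_wpM2l// mulr_ge0 ?mulr_ge0// ltW.
  set y := nrm _.
  have -> : n%:R * n%:R / (2 * c) * (b * y) * (b * y) = (y ^+ 2 / 2) * ((n%:R * n%:R * b ^+ 2) / c).
    by field; rewrite gt_eqF.
  rewrite ler_piMr// ?divr_ge0 ?sqr_ge0//.
  by rewrite ler_pdivrMr// mul1r /c lerDl.
rewrite DE in key.
have := nrm_ge0 (a *m B x); have := nrm_ge0 (a *m B x1).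
move: key; rewrite ler_norml => /andP[].
set y := nrm (a *m B x1); set z := nrm (a *m B x) => k1 k2 y0 z0.
by split; rewrite -(@ler_pXn2r _ 2) ?nnegrE ?mulr_ge0// exprMn; nra.
Qed.

Lemma exists_row_oproj m (Y : 'M[R]_(m, n)) : exists2 P : 'M[R]_n, oproj P & (P :=: Y)%MS.
Proof.
move: (row_base Y) (row_base_free Y) (eq_row_base Y) => Q fQ QY.
have uQ : Q *m Q^T \in unitmx.
  by rewrite -row_free_unit /row_free rank_mul_tr.
pose P := Q^T *m invmx (Q *m Q^T) *m Q.
have QP : Q *m P = Q by rewrite /P !mulmxA mulmxV// mul1mx.
exists P; first split.
- by rewrite /P !trmx_mul trmxK trmx_inv trmx_mul trmxK mulmxA.
- have -> : P *m P = Q^T *m invmx (Q *m Q^T) *m (Q *m P) by rewrite mulmxA.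
  by rewrite QP.
apply: eqmx_trans QY; apply/eqmxP/andP; split; first exact: submxMl.
by rewrite -{1}QP submxMl.
Qed.

Lemma oproj_fixP (P : 'M[R]_n) (v : 'rV[R]_n) : oproj P -> reflect (v *m P = v) (v <= P)%MS.
Proof.
move=> HP; apply: (iffP idP) => [/submxP[c ->]|<-]; last exact: submxMl.
by rewrite -mulmxA HP.2.
Qed.

(** [P x] is the slow space in chart coordinates. Uniform convergence allows one time [k0] at which
    the weak spaces are good approximations everywhere; for [x] near [x1], the weak spaces at that
    time are compared by [bot_compare] through the change of frames [Lt]. *)
Lemma slow_space_continuous (U : set X) (N : nat -> X -> 'M[R]_n) (L F : X -> 'M[R]_n)
    e (s : X -> nat -> nat -> R) j C tau c x1 :
  (forall x, N 0%N x = 1%:M) -> (forall k x, N k x \in unitmx) ->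
  (forall x k, svd (N k x) (e x k) (s x k)) -> (0 < j < n)%N -> 0 < tau < 1 ->
  0 <= C -> 0 <= c -> (forall x k, s x k j / s x k j.-1 <= C * tau ^+ k) ->
  (forall x, oproj (F x)) -> (forall x, \rank (F x) = (n - j)%N) ->
  (forall x k, mxbound (F x - botproj (e x k) j) (c * tau ^+ k)) ->
  open U -> (forall x, U x -> L x \in unitmx) ->
  (forall k x, U x -> form_continuous (fun y => L y *m N k y) x) -> U x1 ->
  forall P : X -> 'M[R]_n, (forall x, U x -> oproj (P x)) ->
  (forall x, U x -> (P x :=: F x *m invmx (L x))%MS) ->
  mxcontinuous P x1.
Proof.
move=> N0 uN H jn t01 C0 c0 gap OF rF apF oU uL cN Ux1 P OP PE i l.
have [t0 _] := andP t01.
apply/(@cvgrPdist_le _ _ _ _ (nbhs_filter x1)) => eps e0.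
have [b1 b10 Lb1] := mxbound_exists (L x1).
have [b2 b20 Lb2] := mxbound_exists (invmx (L x1)).
(* 8 is the cube of the comparison factor 2, and 4 c collects the two approximation errors, each
   doubled by [Lt]. The factors 2 b1 and b2 come from entering and leaving the frame at [x1]. *)
pose D := (8 * C + 4 * c) * (2 * b1) * b2.
have D0 : 0 <= D by rewrite !mulr_ge0 ?addr_ge0 ?mulr_ge0// ltW.
have [k0 Hk] := geometric_small (2 * n%:R * D) t01 e0.
have {}Hk := Hk k0 (leqnn _); set k := k0 in Hk.
have nU : \forall x \near x1, U x by exact: open_nbhs_nbhs.
have uLN k' : L x1 *m N k' x1 \in unitmx by rewrite unitmx_mul uL// uN.
have n0 := near_comparable (uLN 0%N) (cN 0%N _ Ux1).
have nk := near_comparable (uLN k) (cN k _ Ux1).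
apply: filterS3 nU n0 nk => x Ux h0 hk.
have {}h0 a : nrm (a *m L x) <= 2 * nrm (a *m L x1) /\ nrm (a *m L x1) <= 2 * nrm (a *m L x).
  by have := h0 a; rewrite !N0 !mulmx1.
have rP y : U y -> \rank (P y) = (n - j)%N.
  by move=> Uy; rewrite (PE y Uy) mxrankMfree ?rF// row_free_unit unitmx_inv uL.
have trP : \tr (P x1) = \tr (P x).
  by rewrite !mxtrace_idempotent ?rP//; [exact: (OP x Ux).2|exact: (OP x1 Ux1).2].
apply: le_trans (oproj_entry (K := D * tau ^+ k) _ _ _ _ trP _ _) _.
- exact: OP.
- exact: OP.
- by rewrite mulr_ge0// exprn_ge0// ltW.
- move=> v; rewrite mulmxA; set q := v *m P x.
  have qv : nrm q <= nrm v by apply: oproj_le; exact: OP.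
  pose u := q *m L x.
  have uF : u *m F x = u.
    apply/oproj_fixP => //; have : (q <= F x *m invmx (L x))%MS by rewrite -(PE x Ux) submxMl.
    by move=> /(submxMr (L x)); rewrite mulmxKV// uL.
  (* [q'] is [q] projected to the slow space of [x1] in the orthonormal frame, then returned to the
     chart; being fixed by [P x1], it can be subtracted freely. *)
  pose q' := q *m L x1 *m F x1 *m invmx (L x1).
  have q'P : q' *m (1%:M - P x1) = 0.
    rewrite mulmx_compl; apply/eqP; rewrite subr_eq0 eq_sym; apply/eqP.
    apply/oproj_fixP; first exact: OP.
    by rewrite (PE x1 Ux1) /q' -(mulmxA (q *m L x1)) submxMl.
  have -> : q *m (1%:M - P x1) = (q - q') *m (1%:M - P x1) by rewrite mulmxBl q'P subr0.
  apply: le_trans (oprojC_le _ (OP _ Ux1)) _.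
  apply: le_trans (mxbound_inv (q - q') (uL _ Ux1) Lb2) _.
  have -> : (q - q') *m L x1 = q *m L x1 *m (1%:M - F x1).
    by rewrite mulmxBl /q' mulmxKV ?uL// mulmx_compl.
  set Q := botproj (e x k) j; set Q1 := botproj (e x1 k) j.
  have OQ1 : oproj Q1 := botproj_oproj _ (svd_ortho (H x1 k)).
  pose Lt := invmx (L x) *m L x1.
  have uLt : u *m Lt = q *m L x1 by rewrite /u /Lt mulmxA mulmxK// uL.
  have Ltb : mxbound Lt 2.
    by move=> w; have [_] := h0 (w *m invmx (L x)); rewrite mulmxKV ?uL// /Lt mulmxA.
  have cmp w : nrm (w *m N k x) <= 2 * nrm (w *m Lt *m N k x1) /\
      nrm (w *m Lt *m N k x1) <= 2 * nrm (w *m N k x).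
    have := hk (w *m invmx (L x)); rewrite !mulmxA mulmxKV ?uL//.
  have B1 : nrm (u *m Q *m Lt *m (1%:M - Q1)) <= 8 * C * tau ^+ k * nrm u.
    have := bot_compare u (H x k) (H x1 k) jn (ler0n _ 2) Ltb.
    move=> /(_ (fun w => (cmp w).2) (fun w => (cmp w).1)) /le_trans; apply.
    rewrite ler_wpM2r ?nrm_ge0//; have := gap x1 k.
    move=> /(ler_wpM2l (ler0n R 8)) h; apply: le_trans (le_trans _ h) _.
      by apply: ler_of_eq; ring.
    by apply: ler_of_eq; ring.
  have B2 : nrm (u *m (F x - Q) *m Lt *m (1%:M - Q1)) <= 2 * (c * tau ^+ k * nrm u).
    apply: le_trans (oprojC_le _ OQ1) _; apply: le_trans (Ltb _) _.
    by rewrite ler_wpM2l//; exact: apF.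
  have B3 : nrm (u *m Lt *m (F x1 - Q1)) <= c * tau ^+ k * (2 * nrm u).
    apply: le_trans (apF x1 k _) _; apply: ler_wpM2l; last exact: Ltb.
    by rewrite mulr_ge0 ?exprn_ge0// ltW.
  have split3 : q *m L x1 *m (1%:M - F x1) = u *m Q *m Lt *m (1%:M - Q1) +
      u *m (F x - Q) *m Lt *m (1%:M - Q1) - u *m Lt *m (F x1 - Q1).
    rewrite -!mulmxDl -mulmxDr (addrC Q) subrK.
    by rewrite uF -mulmxBr opprB addrA subrK uLt.
  have B : nrm (q *m L x1 *m (1%:M - F x1)) <= (8 * C + 4 * c) * tau ^+ k * nrm u.
    rewrite split3; apply: le_trans (ler_nrmB _ _) _.
    apply: le_trans (lerD (le_trans (ler_nrmD _ _) (lerD B1 B2)) B3) _.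
    by apply: ler_of_eq; ring.
  have ub : nrm u <= 2 * b1 * nrm v.
    have [h _] := h0 q; apply: le_trans h _; rewrite -mulrA ler_wpM2l//.
    by apply: le_trans (Lb1 q) _; rewrite ler_wpM2l// ltW.
  apply: le_trans (ler_wpM2l (ltW b20) B) _.
  have Ct : 0 <= (8 * C + 4 * c) * tau ^+ k.
    by rewrite mulr_ge0 ?exprn_ge0 ?(ltW t0)// addr_ge0 ?mulr_ge0.
  apply: le_trans (ler_wpM2l (ltW b20) (ler_wpM2l Ct ub)) _.
  by apply: ler_of_eq; rewrite /D; ring.
by rewrite mulrA ltW.
Qed.

End LocalContinuity.

(** * Coordinates on a bundle *)

Section Bundle.
Variables (R : realType) (X : topologicalType) (d : nat).
Variables (V : vector_bundle R X d) (g : continuous_inner_product V).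

Lemma vec_inj x : injective (@vec R X V x).
Proof.
by move=> u v; apply: Eqdep_dec.inj_pair2_eq_dec => a b; exact: decP (a =P b).
Qed.

Lemma dim_fibre x : \dim {: fibre V x} = d.
Proof.
have [U [phi [psi [[_ Ux] bij _ _]]]] := vb_trivial V x.
have [K1 K2] := bij x Ux.
have := limg_ker_dim (phi x) fullv.
have -> : lker (phi x) = 0%VS by apply/eqP/lker0P; exact: can_inj K1.
rewrite capv0 dimv0 add0n => <-.
have -> : limg (phi x) = fullv.
  apply/eqP; rewrite eqEsubv subvf/=; apply/subvP => v _.
  by rewrite -(K2 v) memv_img// memvf.
by rewrite dimvf dim_matrix mul1r.
Qed.

Lemma exists_frames : exists (f : forall x, 'Hom(fibre V x, 'rV[R]_d))
    (h : forall x, 'Hom('rV[R]_d, fibre V x)), forall x, frame (g x) (f x) (h x).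
Proof.
have H x := exists_frame (g x) (dim_fibre x).
exists (fun x => projT1 (cid (H x))), (fun x => projT1 (cid (projT2 (cid (H x))))) => x.
exact: projT2 (cid (projT2 (cid (H x)))).
Qed.

Variables (f : forall x, 'Hom(fibre V x, 'rV[R]_d)) (h : forall x, 'Hom('rV[R]_d, fibre V x)).
Hypothesis fr : forall x, frame (g x) (f x) (h x).

Let fK x : cancel (f x) (h x). Proof. by case: (fr x). Qed.
Let hK x : cancel (h x) (f x). Proof. by case: (fr x). Qed.
Let gE x u v : g x u v = dotr (f x u) (f x v). Proof. by case: (fr x). Qed.

Definition tcoord (e : total_space V) : 'rV[R]_d := f (projT1 e) (projT2 e).

Lemma tcoord_continuous : continuous (fun e : total_space V => dotr (tcoord e) (tcoord e)).
Proof.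
pose diag (e : total_space V) : fibre_product V :=
  existT _ (projT1 e) (projT2 e, projT2 e).
have cd : continuous diag.
  apply: continuous_comp_initial.
  have E : (fun p : {x : X & (fibre V x * fibre V x)%type} =>
      (vec (projT2 p).1, vec (projT2 p).2)) \o diag = (fun e : total_space V => (e, e)).
    by apply: funext => -[x u].
  rewrite E => e.
  by apply: (cvg_pair (FF := nbhs_filter e) (FG := nbhs_filter e) (FH := nbhs_filter e)); exact: cvg_id.
have -> : (fun e => dotr (tcoord e) (tcoord e)) =
    (fun p : fibre_product V => g (projT1 p) (projT2 p).1 (projT2 p).2) \o diag.
  by apply/funext => e /=; rewrite gE.
by move=> e; apply: continuous_comp; [exact: cd|exact: ip_continuous].
Qed.

Variables (T S : X -> X) (A : bundle_automorphism V T).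
Hypotheses (TS : cancel T S) (ST : cancel S T).

Definition coord_mx x : 'M[R]_d := lin1_mx (f (T x) \o A x \o h x).

Lemma coord_mxE x u : f (T x) (A x u) = f x u *m coord_mx x.
Proof. by rewrite mul_rV_lin1/= fK. Qed.

Lemma coord_mx_unit x : coord_mx x \in unitmx.
Proof.
have [_ [G [AG GA] _]] := auto_homeomorphism A.
rewrite -row_free_unit -kermx_eq0; apply/rowV0P => v /sub_kermxP vM.
have : f (T x) (A x (h x v)) = 0 by rewrite coord_mxE hK.
move=> /(congr1 (h (T x))); rewrite fK linear0 => A0.
have A00 : A x 0 = 0 := linear0 _.
have : total_map A (vec (h x v)) = total_map A (vec (0 : fibre V x)).
  by rewrite /total_map /= A0 A00.
move=> /(can_inj AG)/vec_inj /(congr1 (f x)).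
by rewrite hK linear0.
Qed.

Lemma bundle_iter_coord k x u :
  f (iter k T x) (bundle_iter A k x u) = f x u *m cocycle T coord_mx k x.
Proof.
elim: k => [|k IH] /=; first by rewrite id_lfunE mulmx1.
by rewrite comp_lfunE coord_mxE IH mulmxA.
Qed.

Lemma tcoord_total_map e : tcoord (total_map A e) = tcoord e *m coord_mx (projT1 e).
Proof. exact: coord_mxE. Qed.

Lemma tcoord_iter k x (u : fibre V x) : tcoord (iter k (total_map A) (vec u)) =
  f x u *m cocycle T coord_mx k x.
Proof.
have E : iter k (total_map A) (vec u) = vec (bundle_iter A k x u).
  elim: k => [|k IH] /=; first by rewrite id_lfunE.
  by rewrite IH /total_map/= comp_lfunE.
by rewrite E -bundle_iter_coord.
Qed.

Lemma tcoord_inverse (G : total_space V -> total_space V) : cancel G (total_map A) ->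
  forall k x (u : fibre V x),
  tcoord (iter k G (vec u)) = f x u *m cocycle S (invcocycle S coord_mx) k x.
Proof.
move=> GA.
have pG e : projT1 (G e) = S (projT1 e) by rewrite -{2}(GA e) /= TS.
have cG e : tcoord (G e) = tcoord e *m invcocycle S coord_mx (projT1 e).
  by rewrite -{2}(GA e) tcoord_total_map /invcocycle -pG mulmxK// coord_mx_unit.
move=> k x u.
have pk : projT1 (iter k G (vec u)) = iter k S x.
  by elim: k => //= k IH; rewrite pG IH.
elim: k pk => [|k IH] pk /=; first by rewrite mulmx1.
rewrite cG IH; last by elim: k {IH pk} => //= k IH; rewrite pG IH.
rewrite mulmxA; congr (_ *m invcocycle _ _ _).
by elim: k {IH pk} => //= k IH; rewrite pG IH.
Qed.

Section Chart.
Variables (U : set X) (psi : forall x, 'Hom('rV[R]_d, fibre V x)).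
Hypothesis oU : open U.
Hypothesis psi_continuous : {within [set p : X * 'rV[R]_d | U p.1],
  continuous (fun p : X * 'rV[R]_d => vec (psi p.1 p.2))}.

Lemma psi_comp_continuous (v : X -> 'rV[R]_d) x1 : U x1 ->
  v x @[x --> x1] --> v x1 ->
  vec (psi x (v x)) @[x --> x1] --> (vec (psi x1 (v x1)) : total_space V).
Proof.
move=> Ux1 cv.
have oU' : open [set p : X * 'rV[R]_d | U p.1].
  apply: (@open_comp _ _ (fun p : X * 'rV[R]_d => p.1) U) => // p _.
  exact: cvg_fst.
have := psi_continuous; rewrite continuous_open_subspace// => /(_ (x1, v x1)).
rewrite inE/= => /(_ Ux1) cp.
apply: (continuous_comp (f := fun x => (x, v x)) _ cp).
by apply: (cvg_pair (FF := nbhs_filter x1) (FG := nbhs_filter x1) (FH := nbhs_filter (v x1))).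
Qed.

(** The chart read in the orthonormal frame; its Gram matrix is the metric in the chart, which is
    continuous although the matrix itself need not be. *)
Definition chart_mx x : 'M[R]_d := lin1_mx (f x \o psi x).

Lemma chart_mxE x a : f x (psi x a) = a *m chart_mx x.
Proof. by rewrite mul_rV_lin1. Qed.

Lemma chart_form_continuous (H : total_space V -> total_space V) (N : X -> 'M[R]_d) x1 :
  continuous H -> (forall x u, tcoord (H (@vec R X V x u)) = f x u *m N x) -> U x1 ->
  form_continuous (fun x => chart_mx x *m N x) x1.
Proof.
move=> cH HN Ux1 a.
have E x : dotr (a *m (chart_mx x *m N x)) (a *m (chart_mx x *m N x)) =
    dotr (tcoord (H (vec (psi x a)))) (tcoord (H (vec (psi x a)))).
  by rewrite HN chart_mxE mulmxA.
rewrite E; under eq_fun do rewrite E.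
have cp := psi_comp_continuous Ux1 (@cvg_cst _ a _ (nbhs x1) (nbhs_filter x1)).
have cq e : {for e, continuous (fun e => dotr (tcoord (H e)) (tcoord (H e)))}.
  exact: (continuous_comp (cH e) (@tcoord_continuous (H e))).
exact: cvg_comp cp (cq _).
Qed.

End Chart.

Lemma chart_mx_unit (psi : forall x, 'Hom('rV[R]_d, fibre V x)) x :
  injective (psi x) -> chart_mx psi x \in unitmx.
Proof.
move=> ipsi; rewrite -row_free_unit -kermx_eq0; apply/rowV0P => v /sub_kermxP.
rewrite -chart_mxE => /(congr1 (h x)); rewrite fK linear0 -(linear0 (psi x)).
exact: ipsi.
Qed.

Lemma iter_total_continuous (H : total_space V -> total_space V) k :
  continuous H -> continuous (iter k H).
Proof.
move=> cH; elim: k => [|k IH] e; first exact: cvg_id.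
exact: (continuous_comp (IH e) (cH _)).
Qed.

(** Lengths before and after applying the automorphism are each comparable, up to a factor 2, with
    those at [x0]; this accounts for the 4. *)
Lemma local_bound (x0 : X) : exists K : R, \forall x \near x0,
  mxbound (coord_mx x) K /\ mxbound (invmx (coord_mx x)) K.
Proof.
have [U [phi [psi [[oU Ux0] bij _ cpsi]]]] := vb_trivial V x0.
have uL x : U x -> chart_mx psi x \in unitmx.
  by move=> /bij[_ K2]; apply: chart_mx_unit; exact: can_inj K2.
have [cA _] := auto_homeomorphism A.
have c0 := chart_form_continuous (N := fun=> 1%:M) oU cpsi
  (iter_total_continuous (k := 0) cA) (fun x u => esym (mulmx1 (f x u))) Ux0.
have c1 := chart_form_continuous oU cpsi cA (fun x u => tcoord_total_map (vec u)) Ux0.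
have [k1 k10 b1] := mxbound_exists (coord_mx x0).
have [k2 k20 b2] := mxbound_exists (invmx (coord_mx x0)).
have u0 : chart_mx psi x0 *m 1%:M \in unitmx by rewrite mulmx1 uL.
have u1 : chart_mx psi x0 *m coord_mx x0 \in unitmx.
  by rewrite unitmx_mul uL ?coord_mx_unit.
have nU : \forall x \near x0, U x by exact: open_nbhs_nbhs.
exists (4 * (k1 + k2)).
have n0 := near_comparable (B := fun x => chart_mx psi x *m 1%:M) u0 c0.
have n1 := near_comparable (B := fun x => chart_mx psi x *m coord_mx x) u1 c1.
apply: filterS3 nU n0 n1 => x Ux h0 h1.
set L := chart_mx psi in h0 h1.
have {}h0 a : nrm (a *m L x) <= 2 * nrm (a *m L x0) /\ nrm (a *m L x0) <= 2 * nrm (a *m L x).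
  by have := h0 a; rewrite !mulmx1.
have {}h1 a : nrm (a *m L x *m coord_mx x) <= 2 * nrm (a *m L x0 *m coord_mx x0) /\
   nrm (a *m L x0 *m coord_mx x0) <= 2 * nrm (a *m L x *m coord_mx x).
  by have := h1 a; rewrite !mulmxA.
split=> v.
  pose a := v *m invmx (L x); have -> : v = a *m L x by rewrite mulmxKV// uL.
  have [h2 _] := h1 a; have [_ h3] := h0 a; have h4 := b1 (a *m L x0).
  have := nrm_ge0 (a *m L x); have := nrm_ge0 (a *m L x0); nra.
pose w := v *m invmx (coord_mx x); have -> : v = w *m coord_mx x.
  by rewrite mulmxKV// coord_mx_unit.
rewrite mulmxK ?coord_mx_unit//.
pose a := w *m invmx (L x); have -> : w = a *m L x by rewrite mulmxKV// uL.
have [h2 _] := h0 a; have [_ h3] := h1 a.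
have h4 := mxbound_inv (a *m L x0) (coord_mx_unit x0) b2.
have := nrm_ge0 (a *m L x *m coord_mx x); nra.
Qed.

Lemma uniform_bound : compact [set: X] -> exists K : R,
  [/\ 1 <= K, forall x, mxbound (coord_mx x) K & forall x, mxbound (invmx (coord_mx x)) K].
Proof.
move=> /compact_near_coveringP cov.
pose good (K : R) x := 1 <= K /\ mxbound (coord_mx x) K /\ mxbound (invmx (coord_mx x)) K.
have loc x : [set: X] x -> \forall x' \near x & K \near +oo, good K x'.
  move=> _; have [K0 K0P] := local_bound x.
  exists ([set y | mxbound (coord_mx y) K0 /\ mxbound (invmx (coord_mx y)) K0],
          [set K | Num.max 1 K0 <= K]); first by split=> //; apply: nbhs_pinfty_ge; rewrite num_real.
  move=> [y K] [/= [b1 b2]]; rewrite ge_max => /andP[K1 KK]; split=> //.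
  by split=> v; [apply: le_trans (b1 v) _|apply: le_trans (b2 v) _]; rewrite ler_wpM2r ?nrm_ge0.
have [K [_ KP]] := cov R +oo good _ loc.
have /KP {}KP : K < K + 1 by rewrite ltrDl.
exists (Num.max 1 (K + 1)); split; first by rewrite le_max lexx.
  move=> x v; have [K1 [b1 _]] := KP x I; apply: le_trans (b1 v) _.
  by rewrite ler_wpM2r ?nrm_ge0// le_max lexx orbT.
move=> x v; have [K1 [_ b1]] := KP x I; apply: le_trans (b1 v) _.
by rewrite ler_wpM2r ?nrm_ge0// le_max lexx orbT.
Qed.

(** The subspace of the fibre that corresponds to the row space of the projection [P]. *)
Definition fixspace x (P : 'M[R]_d) : {vspace fibre V x} :=
  lker (transport (f x) (h x) (1%:M - P)).

Lemma mem_fixspace x (P : 'M[R]_d) v : (v \in fixspace x P) = (f x v *m P == f x v).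
Proof.
rewrite memv_ker transportE -(can_eq (@fK x)) linear0 hK mulmx_compl subr_eq0.
by rewrite eq_sym.
Qed.

Lemma basis_fixspace x (P : 'M[R]_d) r (Q : 'M[R]_(r, d)) : oproj P -> row_free Q ->
  (Q :=: P)%MS -> basis_of (fixspace x P) [tuple h x (row j Q) | j < r].
Proof.
move=> OP fQ QP; set b := [tuple _ | _ < _].
have bE (i : 'I_r) : b`_i = h x (row i Q) by rewrite -tnth_nth tnth_mktuple.
have sumE (k : 'I_r -> R) : \sum_(i < r) k i *: b`_i = h x ((\row_i k i) *m Q).
  under eq_bigr do rewrite bE; rewrite mulmx_sum_row linear_sum/=.
  by apply: eq_bigr => i _; rewrite linearZ/= mxE.
rewrite /basis_of; apply/andP; split; last first.
  apply/freeP => k; rewrite sumE => k0 i.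
  have : (\row_i k i) *m Q = 0.
    by move/(congr1 (f x)): k0; rewrite hK linear0.
  have /row_freeP [Q' QQ'] := fQ.
  move=> /(congr1 (mulmx^~ Q')); rewrite mul0mx -mulmxA QQ' mulmx1 => /rowP /(_ i).
  by rewrite !mxE.
apply/eqP/vspaceP => v; rewrite mem_fixspace; apply/idP/eqP => [/coord_span ->|vP].
  rewrite sumE hK; apply/oproj_fixP => //.
  by rewrite -QP submxMl.
have /submxP[c cE] : (f x v <= Q)%MS by rewrite QP; apply/oproj_fixP.
have -> : v = \sum_(i < r) c 0 i *: b`_i.
  rewrite sumE -(fK v) cE; congr (h x (_ *m _)).
  by apply/rowP => i; rewrite mxE.
apply: memv_suml => i _; apply/memvZ/memv_span/mem_nth; by rewrite size_tuple.
Qed.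

Lemma exists_row_base m n (Y : 'M[R]_(m, n)) r : \rank Y = r ->
  exists Q : 'M[R]_(r, n), row_free Q /\ (Q :=: Y)%MS.
Proof. by move=> <-; exists (row_base Y); split; [exact: row_base_free|exact: eq_row_base]. Qed.

Lemma mxcontinuous_cvg n (v : X -> 'rV[R]_n) x1 : mxcontinuous v x1 ->
  v x @[x --> x1] --> v x1.
Proof.
move=> cv; apply/(@cvg_ballP _ _ _ _ (nbhs_filter x1)) => eps e0.
have : \forall x \near x1, forall ij : 'I_1 * 'I_n, `|v x1 ij.1 ij.2 - v x ij.1 ij.2| < eps.
  apply: filter_forall => -[i j] /=.
  by have /(@cvgrPdist_lt _ _ _ _ (nbhs_filter x1)) /(_ _ e0) := cv i j.
by apply: filterS => x hx; split => // i j; exact: (hx (i, j)).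
Qed.

Lemma slow_space_subspaces (H : nat -> total_space V -> total_space V)
    (N : nat -> X -> 'M[R]_d) (F : X -> 'M[R]_d) e (s : X -> nat -> nat -> R) j C tau c :
  (forall k, continuous (H k)) ->
  (forall k x u, tcoord (H k (@vec R X V x u)) = f x u *m N k x) ->
  (forall x, N 0%N x = 1%:M) -> (forall k x, N k x \in unitmx) ->
  (forall x k, svd (N k x) (e x k) (s x k)) -> (0 < j < d)%N -> 0 < tau < 1 ->
  0 <= C -> 0 <= c -> (forall x k, s x k j / s x k j.-1 <= C * tau ^+ k) ->
  (forall x, oproj (F x)) -> (forall x, \rank (F x) = (d - j)%N) ->
  (forall x k, mxbound (F x - botproj (e x k) j) (c * tau ^+ k)) ->
  continuous_subspaces (d - j) (fun x => fixspace x (F x)).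
Proof.
move=> cH HN N0 uN Hsvd jd t01 C0 c0 gap OF rF apF x0.
have [U [phi [psi [[oU Ux0] bij _ cpsi]]]] := vb_trivial V x0.
pose L := chart_mx psi.
have uL x : U x -> L x \in unitmx.
  by move=> /bij[_ K2]; apply: chart_mx_unit; exact: can_inj K2.
have /choice[P PP] x : exists P : 'M[R]_d, oproj P /\ (P :=: F x *m invmx (L x))%MS.
  by have [P OP PE] := exists_row_oproj (F x *m invmx (L x)); exists P.
have OP x : oproj (P x) := (PP x).1.
have PE x : (P x :=: F x *m invmx (L x))%MS := (PP x).2.
have cP x : U x -> mxcontinuous P x.
  move=> Ux; apply: (slow_space_continuous (U := U) (L := L) N0 uN Hsvd jd t01 C0 c0 gap OF rF apF) => //.
  by move=> k y Uy; exact: (chart_form_continuous oU cpsi (cH k) (HN k) Uy).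
have rP x : U x -> \rank (P x) = (d - j)%N.
  by move=> Ux; rewrite (PE x) mxrankMfree ?rF// row_free_unit unitmx_inv uL.
have [Q0 [fQ0 Q0E]] := exists_row_base (rP x0 Ux0).
(* A fixed basis of the space at [x0] is projected to the space at [x]. On [W] the projections
   differ by at most 1/2, so no nonzero combination of the basis is sent to 0. *)
pose Q x := Q0 *m P x.
pose W := U `&` [set x | mxbound (P x0 - P x) (1 / 2)]°.
have Wx0 : W x0.
  split=> //; have e0 : 0 < ((d%:R * d%:R + 1)^-1 / 2 : R).
    by rewrite divr_gt0// invr_gt0 ltr_wpDl// mulr_ge0.
  apply: filterS (near_entries (cP _ Ux0) e0) => x hx v.
  apply: le_trans (mxbound_entries (ltW e0) _ v) _ => [a b|].
    by have := hx a b; rewrite !mxE.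
  rewrite ler_wpM2r ?nrm_ge0//.
  rewrite [leLHS](_ : _ = (d%:R * d%:R) / (d%:R * d%:R + 1) / 2); last by rewrite !mulrA.
  by rewrite ler_wpM2r// ler_pdivrMr ?mul1r ?lerDl// ltr_wpDl// mulr_ge0.
exists W, (fun a x => psi x (row a (Q x))); split.
- by split=> //; apply: openI => //; exact: open_interior.
- move=> a; apply: continuous_in_subspaceT => x /set_mem [Ux _].
  apply: (psi_comp_continuous oU cpsi Ux); apply: mxcontinuous_cvg => i b.
  rewrite mxE; under eq_fun do rewrite mxE.
  by apply: (mxcontinuous_mul (f := fun=> Q0) (g := P)); [exact: mxcontinuous_cst|exact: cP].
move=> x [Ux /interior_subset /= bx].
have QF : row_free (Q x).
  rewrite -kermx_eq0; apply/rowV0P => v /sub_kermxP vQ.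
  have vQ0 : v *m Q0 = 0.
    apply/eqP; rewrite -nrm_eq0 eq_le nrm_ge0 andbT.
    have := bx (v *m Q0); rewrite mulmxBr -[v *m Q0 *m P x]mulmxA vQ subr0.
    have -> : v *m Q0 *m P x0 = v *m Q0 by apply/oproj_fixP => //; rewrite -Q0E submxMl.
    have := nrm_ge0 (v *m Q0); lra.
  have /row_freeP [Q' QQ'] := fQ0.
  by rewrite -[v]mulmx1 -QQ' mulmxA vQ0 mul0mx.
have QLF : row_free (Q x *m L x) by rewrite /row_free mxrankMfree ?row_free_unit ?uL.
have QLE : (Q x *m L x :=: F x)%MS.
  have sub : (Q x *m L x <= F x)%MS.
    have : (Q x <= F x *m invmx (L x))%MS by rewrite -PE submxMl.
    by move=> /(submxMr (L x)); rewrite mulmxKV// uL.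
  apply/eqmxP; rewrite sub/=.
  have := mxrank_leqif_sup sub; move: QLF; rewrite /row_free => /eqP ->.
  by rewrite rF => -[_ <-].
suff : basis_of (fixspace x (F x)) [tuple psi x (row a (Q x)) | a < d - j] by [].
have <- : [tuple h x (row a (Q x *m L x)) | a < d - j] =
    [tuple psi x (row a (Q x)) | a < d - j].
  apply: eq_mktuple => a.
  by apply: (can_inj (@fK x)); rewrite hK chart_mxE row_mul.
exact: basis_fixspace.
Qed.

End Bundle.

(** * Dominated splittings *)

Section RestrictedNorms.
Variables (R : realType) (U W : vectType R) (d : nat).
Variables (dU : {dot U for idfun}) (dW : {dot W for idfun}).
Variables (fU : 'Hom(U, 'rV[R]_d)) (hU : 'Hom('rV[R]_d, U)).
Variables (fW : 'Hom(W, 'rV[R]_d)) (hW : 'Hom('rV[R]_d, W)).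
Hypotheses (FU : frame dU fU hU) (FW : frame dW fW hW).
Variables (B : 'Hom(U, W)) (N : 'M[R]_d).
Hypotheses (BN : forall u, fW (B u) = fU u *m N) (uN : N \in unitmx).

Lemma enorm_frameU u : enorm dU u = nrm (fU u).
Proof. by rewrite /enorm; have [_ _ ->] := FU. Qed.

Lemma enorm_frameW u : enorm dW (B u) = nrm (fU u *m N).
Proof. by rewrite /enorm; have [_ _ ->] := FW; rewrite BN. Qed.

Lemma frame_neq0 u : u != 0 -> nrm (fU u) != 0.
Proof.
by rewrite nrm_eq0; have [K _ _] := FU; rewrite -(can_eq K) linear0.
Qed.

Lemma unit_vector (E : {vspace U}) u : u \in E -> u != 0 ->
  exists v, [/\ v \in E, enorm dU v = 1 & v = (nrm (fU u))^-1 *: u].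
Proof.
move=> uE /frame_neq0 u0; exists ((nrm (fU u))^-1 *: u); split => //; first exact: memvZ.
by rewrite enorm_frameU linearZ/= nrmZ ger0_norm ?invr_ge0 ?nrm_ge0// mulVf.
Qed.

Let sphere (E : {vspace U}) := [set enorm dW (B v) | v in [set v | v \in E /\ enorm dU v = 1]].

Lemma sphere_neq0 (E : {vspace U}) : (0 < \dim E)%N -> sphere E !=set0.
Proof.
rewrite lt0n dimv_eq0 -vpick0 => E0.
have [v [vE v1 _]] := unit_vector (memv_pick E) E0.
by exists (enorm dW (B v)); exists v.
Qed.

Lemma norm_on_ge (E : {vspace U}) u : u \in E -> u != 0 ->
  nrm (fU u *m N) / nrm (fU u) <= norm_on dU dW B E.
Proof.
move=> uE u0; have [v [vE v1 vu]] := unit_vector uE u0.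
apply: ub_le_sup; last first.
  exists v => //; rewrite enorm_frameW vu linearZ/= -scalemxAl nrmZ.
  by rewrite ger0_norm ?invr_ge0 ?nrm_ge0// mulrC.
have [b b0 bN] := mxbound_exists N.
exists b => _ [w [_ w1] <-]; rewrite enorm_frameW.
by have := bN (fU w); rewrite -enorm_frameU w1 mulr1.
Qed.

Lemma conorm_on_le (E : {vspace U}) u : u \in E -> u != 0 ->
  conorm_on dU dW B E <= nrm (fU u *m N) / nrm (fU u).
Proof.
move=> uE u0; have [v [vE v1 vu]] := unit_vector uE u0.
apply: ge_inf; last first.
  exists v => //; rewrite enorm_frameW vu linearZ/= -scalemxAl nrmZ.
  by rewrite ger0_norm ?invr_ge0 ?nrm_ge0// mulrC.
by exists 0 => _ [w _ <-]; rewrite enorm_frameW nrm_ge0.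
Qed.

Lemma conorm_on_gt0 (E : {vspace U}) : (0 < \dim E)%N -> 0 < conorm_on dU dW B E.
Proof.
move=> E0; have [b b0 bN] := mxbound_exists (invmx N).
apply: lt_le_trans (_ : b^-1 <= _); first by rewrite invr_gt0.
apply: lb_le_inf; first exact: sphere_neq0.
move=> _ [w [_ w1] <-]; rewrite enorm_frameW -[leLHS]mulr1 -w1 enorm_frameU.
by rewrite ler_pdivrMl//; exact: mxbound_inv.
Qed.

Lemma norm_ratio_le (E F : {vspace U}) c : (0 < \dim E)%N -> (0 < \dim F)%N -> 0 < c ->
  (forall u v, u \in E -> v \in F ->
    nrm (fU v *m N) * nrm (fU u) <= c * (nrm (fU u *m N) * nrm (fU v))) ->
  norm_on dU dW B F / conorm_on dU dW B E <= c.
Proof.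
move=> E0 F0 c0 dom; rewrite ler_pdivrMr ?conorm_on_gt0// -ler_pdivrMl//.
apply: lb_le_inf; first exact: sphere_neq0.
move=> _ [u [uE u1] <-]; rewrite ler_pdivrMl//.
apply: ge_sup; first exact: sphere_neq0.
move=> _ [v [vF v1] <-]; have := dom u v uE vF.
by rewrite !enorm_frameW -!enorm_frameU u1 v1 !mulr1.
Qed.

Lemma exists_orth_in (E : {vspace U}) p (e : nat -> 'rV[R]_d) : (p < \dim E)%N ->
  exists u, [/\ u \in E, u != 0 & forall j, (j < p)%N -> dotr (fU u) (e j) = 0].
Proof.
move=> pE; pose b := vbasis E.
pose M := \matrix_(a < \dim E, j < p) dotr (fU b`_a) (e j).
have [c c0 cM] := exists_kernel_vector M pE.
exists (\sum_(a < \dim E) c 0 a *: b`_a); split.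
- by apply: memv_suml => a _; apply/memvZ/vbasis_mem/mem_nth; rewrite size_tuple.
- apply: contraNneq c0 => s0; apply/eqP/rowP => a; rewrite mxE.
  by have /freeP := basis_free (vbasisP E); apply.
- move=> j jp; have := congr1 (fun r : 'rV[R]_p => r 0 (Ordinal jp)) cM.
  rewrite !mxE => E0; rewrite linear_sum/= dotr_suml -[RHS]E0.
  by apply: eq_bigr => a _; rewrite mxE linearZ/= dotrZl.
Qed.

(** By dimension count, [E] has a vector orthogonal to the first i - 1 singular directions, which
    bounds the conorm above; [F] has one orthogonal to all directions after the first i + 1, which
    bounds the norm below. *)
Lemma sigma_ratio_le (E F : {vspace U}) i : (0 < i < d)%N ->
  \dim E = i -> \dim F = (d - i)%N ->
  sigma dU dW i.+1 B / sigma dU dW i B <= norm_on dU dW B F / conorm_on dU dW B E.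
Proof.
move=> /andP[i0 id] dE dF.
have [e [s [H sE]]] := sigma_svd FU FW uN BN.
have i1 : (i.-1 < d)%N by rewrite prednK// ltnW.
rewrite sE// -[in sigma _ _ i B](prednK i0) sE//.
have E0 : (0 < \dim E)%N by rewrite dE.
have s1 : 0 < s i.-1 := svd_gt0 H i1.
have pE : (i.-1 < \dim E)%N by rewrite dE prednK.
have [u [uE u0 ue]] := exists_orth_in e pE.
have pF : (d - i.+1 < \dim F)%N by rewrite dF ltn_sub2l.
have [v [vF v0 ve]] := @exists_orth_in F (d - i.+1) (fun j => e (i.+1 + j)%N) pF.
have nu : 0 < nrm (fU u) by rewrite lt_def nrm_ge0 andbT frame_neq0.
have nv : 0 < nrm (fU v) by rewrite lt_def nrm_ge0 andbT frame_neq0.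
apply: ler_pM.
- exact: ltW (svd_gt0 H id).
- by rewrite invr_ge0 ltW.
- apply: le_trans (norm_on_ge vF v0); rewrite ler_pdivlMr//.
  apply: (svd_ge H id) => j /andP[ij jd].
  by rewrite -(subnKC ij) ve// ltn_sub2r// (leq_ltn_trans ij jd).
- rewrite lef_pV2 ?posrE ?conorm_on_gt0//.
  apply: le_trans (conorm_on_le uE u0) _; rewrite ler_pdivrMr//.
  exact: (svd_le H i1).
Qed.

End RestrictedNorms.

(** * The two implications for a bundle with chosen frames *)

Section Splitting.
Variables (R : realType) (X : topologicalType) (d : nat).
Variables (V : vector_bundle R X d) (g : continuous_inner_product V).
Variables (f : forall x, 'Hom(fibre V x, 'rV[R]_d)) (h : forall x, 'Hom('rV[R]_d, fibre V x)).
Hypothesis fr : forall x, frame (g x) (f x) (h x).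

Lemma continuous_subspaces_dim k (E : forall x, {vspace fibre V x}) x :
  continuous_subspaces k E -> \dim (E x) = k.
Proof.
move=> /(_ x) [U [e [[_ Ux] _ /(_ x Ux) bE]]].
exact: size_basis bE.
Qed.

Lemma dim_fixspace x (P : 'M[R]_d) : oproj P -> \dim (fixspace f h x P) = \rank P.
Proof.
move=> OP; have := basis_fixspace fr x OP (row_base_free P) (eq_row_base P).
exact: size_basis.
Qed.

Lemma dominated_singular_gap (T : X -> X) (A : bundle_automorphism V T) (S : X -> X) i :
  cancel T S -> (0 < i < d)%N -> has_dominated_splitting g A i ->
  exists C tau : R, [/\ 0 < C, tau < 1 & forall (x : X) (n : nat),
    sigma (g x) (g (iter n T x)) i.+1 (bundle_iter A n x) /
    sigma (g x) (g (iter n T x)) i (bundle_iter A n x) < C * tau ^+ n].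
Proof.
move=> TS id [E [F [[cE [k cF] EF] [_ [C [tau [C0 /andP[t0 t1] dom]]]]]]].
exists C, tau; split => // x n; apply: le_lt_trans (dom x n).
have uN : cocycle T (coord_mx f h A) n x \in unitmx.
  by apply: cocycle_unit => y; exact: (coord_mx_unit fr A y).
have dE := continuous_subspaces_dim x cE.
have dF : \dim (F x) = (d - i)%N.
  have [sumEF capEF] := EF x.
  have := dimv_disjoint_sum capEF; rewrite sumEF dim_fibre dE => dd.
  by apply: (@addnI i); rewrite -dd subnKC// ltnW//; case/andP: id.
exact: (sigma_ratio_le (fr x) (fr (iter n T x)) (@bundle_iter_coord _ _ _ _ _ _ _ fr _ A n x) uN id dE dF).
Qed.

Lemma fixspace_image (T : X -> X) (A : bundle_automorphism V T) (P : X -> 'M[R]_d) r :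
  (forall x, oproj (P x)) -> (forall x, \rank (P x) = r) ->
  (forall x, P x *m coord_mx f h A x *m P (T x) = P x *m coord_mx f h A x) ->
  forall x, (A x @: fixspace f h x (P x) = fixspace f h (T x) (P (T x)))%VS.
Proof.
move=> OP rP invP x; apply/eqP; rewrite eqEdim; apply/andP; split.
  apply/subvP => _ /memv_imgP[u uP ->]; move: uP; rewrite !(mem_fixspace fr) => /eqP uP.
  rewrite (coord_mxE fr); set N := coord_mx f h A x in invP *.
  by rewrite -uP -(mulmxA _ (P x)) -(mulmxA _ _ (P (T x))) invP.
rewrite dim_fixspace// rP limg_dim_eq ?dim_fixspace ?rP//.
have -> : lker (A x) = 0%VS; last exact: capv0.
apply/eqP/lker0P; apply: (can_inj (g := fun v => h x (f (T x) v *m invmx (coord_mx f h A x)))).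
move=> u; rewrite (coord_mxE fr) mulmxK ?(coord_mx_unit fr)//.
by have [-> _ _] := fr x.
Qed.

Lemma singular_gap_dominated (T : X -> X) (A : bundle_automorphism V T) (S : X -> X) i C tau :
  compact [set: X] -> cancel T S -> cancel S T -> (0 < i < d)%N ->
  0 < C -> 0 < tau < 1 ->
  (forall (x : X) (n : nat), sigma (g x) (g (iter n T x)) i.+1 (bundle_iter A n x) /
    sigma (g x) (g (iter n T x)) i (bundle_iter A n x) < C * tau ^+ n) ->
  has_dominated_splitting g A i.
Proof.
move=> cX TS ST id C0 t01 gap; have /andP[i0 iltd] := id.
have [tp _] := andP t01.
pose M := coord_mx f h A.
have uM x : M x \in unitmx := coord_mx_unit fr A x.
have [K [K1 MK VK]] := uniform_bound fr A cX.
have i1 : (i.-1 < d)%N by rewrite prednK// ltnW.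
have /choice[es esP] (p : X * nat) : exists es : (nat -> 'rV[R]_d) * (nat -> R),
    svd (cocycle T M p.2 p.1) es.1 es.2 /\ es.2 i / es.2 i.-1 <= C * tau ^+ p.2.
  case: p => x k /=.
  have [e [s [H sE]]] := sigma_svd (fr x) (fr (iter k T x)) (cocycle_unit T k x uM)
    (@bundle_iter_coord _ _ _ _ _ _ _ fr _ A k x).
  exists (e, s); split => //=; have := gap x k.
  by rewrite sE// -[in sigma _ _ i _](prednK i0) sE// => /ltW.
pose e x k := (es (x, k)).1; pose s x k := (es (x, k)).2.
have H x k : svd (cocycle T M k x) (e x k) (s x k) := (esP (x, k)).1.
have Hgap x k : s x k i / s x k i.-1 <= C * tau ^+ k := (esP (x, k)).2.
have C0' := ltW C0.
have [F [OF rF apF invF]] := slow_space uM K1 MK VK id t01 C0' H Hgap.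
(* The fast space is the slow space of the inverse cocycle. *)
pose M' := invcocycle S M; pose j := (d - i)%N.
have jd : (0 < j < d)%N by rewrite subn_gt0 iltd ltn_subrL i0 (leq_ltn_trans _ iltd).
have uM' x : M' x \in unitmx by rewrite unitmx_inv uM.
have VK' x : mxbound (invmx (M' x)) K by rewrite invmxK; exact: MK.
have cE k x : cocycle S M' k x = invmx (cocycle T M k (iter k S x)) := cocycle_inv k x ST uM.
pose e' x k := invfamily T M e s (iter k S x) k.
pose s' x k (l : nat) := (s (iter k S x) k (d - l.+1)%N)^-1.
have H' x k : svd (cocycle S M' k x) (e' x k) (s' x k).
  by rewrite cE; apply: svd_inv => //; exact: cocycle_unit.
have Hgap' x k : s' x k j / s' x k j.-1 <= C * tau ^+ k.
  apply: le_trans (Hgap (iter k S x) k); rewrite /s' invrK mulrC.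
  have -> : (d - j.+1)%N = i.-1 by rewrite /j; lia.
  by have -> : (d - j.-1.+1)%N = i by rewrite /j; lia.
have [E [OE rE apE invE']] := slow_space uM' K1 (fun x => VK (S x)) VK' jd t01 C0' H' Hgap'.
have {}rE x : \rank (E x) = i by rewrite rE subKn// ltnW.
(* Invariance under the inverse cocycle is an inclusion in the wrong direction; equality of ranks
   makes it an equality, which can then be pushed forward by [M x]. *)
have invE x : E x *m M x *m E (T x) = E x *m M x.
  have := invE' (T x); rewrite TS /M' /invcocycle TS => h1.
  have sub : (E (T x) *m invmx (M x) <= E x)%MS by rewrite -h1 submxMl.
  have : (E x <= E (T x) *m invmx (M x))%MS.
    have := mxrank_leqif_sup sub.
    by rewrite mxrankMfree ?row_free_unit ?unitmx_inv// !rE => -[_ <-].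
  move=> /(submxMr (M x)); rewrite mulmxKV// => /submxP[D ->].
  by rewrite -mulmxA (OE (T x)).2.
have im : i = i.-1.+1 by rewrite prednK.
have apE2 x k : mxbound (E (iter k T x) - botproj (invfamily T M e s x k) (d - i.-1.+1))
    (slow_rate d K C tau * tau ^+ k).
  have := apE (iter k T x) k; rewrite /e' (iter_cancel k TS) /j.
  by rewrite -im.
have c0 := slow_rate_ge0 d K1 t01 C0'.
rewrite {1}im in iltd.
have Hgap2 x k : s x k i.-1.+1 / s x k i.-1 <= C * tau ^+ k by rewrite -im; exact: Hgap.
have rE2 x : \rank (E x) = i.-1.+1 by rewrite -im.
have apF2 x k : mxbound (F x - botproj (e x k) i.-1.+1) (slow_rate d K C tau * tau ^+ k).
  by rewrite -im; exact: apF.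
have [al al0 trans] := uniform_transversality uM K1 MK VK iltd t01 C0' H Hgap2 OF c0 c0
  apF2 apE2 invF invE.
have [c cp dom] := domination uM K1 MK VK iltd t01 C0' H Hgap2 OF OE c0 c0 rE2
  apF2 apE2 invF invE.
have [cA [G [AG GA] cG]] := auto_homeomorphism A.
have contF : continuous_subspaces (d - i) (fun x => fixspace f h x (F x)).
  apply: (slow_space_subspaces fr (fun k => iter_total_continuous (k := k) cA) _ _ _ H id t01 C0' c0 Hgap OF rF apF) => //.
  - by move=> k x u; exact: tcoord_iter.
  - by move=> k x; exact: cocycle_unit.
have contE : continuous_subspaces i (fun x => fixspace f h x (E x)).
  have ij : i = (d - j)%N by rewrite subKn// ltnW//; case/andP: id.
  rewrite {1}ij.
  apply: (slow_space_subspaces fr (fun k => iter_total_continuous (k := k) cG) _ _ _ H' jd t01 C0' c0 Hgap' OE _ apE) => //.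
  - by move=> k x u; exact: (tcoord_inverse fr TS GA).
  - by move=> k x; exact: cocycle_unit.
  - by move=> x; rewrite rE.
have iltd' : (i < d)%N by case/andP: id.
exists (fun x => fixspace f h x (E x)), (fun x => fixspace f h x (F x)); split; split => //.
- by exists (d - i)%N.
- move=> x.
  have cap0 : (fixspace f h x (E x) :&: fixspace f h x (F x))%VS = 0%VS.
    apply/eqP; rewrite -subv0; apply/subvP => v; rewrite memv_cap !(mem_fixspace fr) memv0.
    move=> /andP[/eqP vE /eqP vF]; have := trans x _ vE.
    rewrite mulmx_compl vF subrr nrm0 pmulr_rle0// => v0.
    have [K' _ _] := fr x; rewrite -(can_eq K') linear0 -nrm_eq0.
    by rewrite eq_le v0 nrm_ge0.
  split=> //; apply/eqP; rewrite eqEdim subvf/= dimv_disjoint_sum//.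
  by rewrite !dim_fixspace// rE rF dim_fibre subnKC// ltnW.
- by move=> x; split; [exact: (fixspace_image OE rE)|exact: (fixspace_image OF rF)].
(* Doubling the constant makes the inequality strict. *)
- exists (2 * c), tau; split => //; first by rewrite mulr_gt0.
  move=> x n; apply: (@le_lt_trans _ _ (c * tau ^+ n)); last first.
    by rewrite ltr_pM2r ?exprn_gt0// ltr_pMl// ltr1n.
  apply: (norm_ratio_le (fr x) (fr (iter n T x)) (@bundle_iter_coord _ _ _ _ _ _ _ fr _ A n x)).
  - exact: cocycle_unit.
  - by rewrite dim_fixspace// rE.
  - by rewrite dim_fixspace// rF subn_gt0.
  - by rewrite mulr_gt0// exprn_gt0.
  - move=> u v; rewrite !(mem_fixspace fr) => /eqP uE /eqP vF.
    exact: dom.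
Qed.

End Splitting.

Theorem theorem1 (R : realType) (X : topologicalType)
    (hcompact : compact [set: X]) (hhausdorff : hausdorff_space X)
    (d : nat) (V : vector_bundle R X d) (g : continuous_inner_product V)
    (T : X -> X) (hT : homeomorphism T) (A : bundle_automorphism V T)
    (i : nat) (hi : (1 <= i <= d - 1)%N) :
  has_dominated_splitting g A i <->
  exists C tau : R, [/\ 0 < C, tau < 1 &
    forall (x : X) (n : nat),
      sigma (g x) (g (iter n T x)) i.+1 (bundle_iter A n x) /
      sigma (g x) (g (iter n T x)) i (bundle_iter A n x) < C * tau ^+ n].
Proof.
have [f [h fr]] := exists_frames g.
have [_ [S [TS ST] _]] := hT.
have id : (0 < i < d)%N by lia.
split; first exact: (dominated_singular_gap fr TS id).
move=> [C [tau [C0 t1 gap]]].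
(* The sign of [tau] can only be read off at a point, so the empty base, where any data form a
   dominated splitting, is treated apart. *)
have [[x0 _]|noX] := pselect (exists x0 : X, True); last first.
  have F (x : X) : False by apply: noX; exists x.
  exists (fun x => 0%VS), (fun x => 0%VS); split; split.
  - by move=> x; case: (F x).
  - by exists 0%N => x; case: (F x).
  - by move=> x; case: (F x).
  - by move=> x; case: (F x).
  - exists 1, (1 / 2); split => [//||x]; last by case: (F x).
    by rewrite divr_gt0// ltr_pdivrMr// mul1r ltr1n.
apply: (singular_gap_dominated fr hcompact TS ST id C0 _ gap).
(* The gap at time 1 bounds a nonnegative ratio strictly by C tau, which forces tau > 0. *)
rewrite t1 andbT -(pmulr_rgt0 _ C0) -[tau]expr1.
apply: le_lt_trans (gap x0 1%N).
have uM x : coord_mx f h A x \in unitmx := coord_mx_unit fr A x.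
have [e [s [H sE]]] := sigma_svd (fr x0) (fr (iter 1 T x0)) (cocycle_unit T 1 x0 uM)
  (@bundle_iter_coord _ _ _ _ _ _ _ fr _ A 1 x0).
have /andP[i0 iltd] := id.
rewrite sE// -[in sigma _ _ i _](prednK i0) sE ?prednK ?(ltnW iltd)//.
by rewrite divr_ge0// ltW// (svd_gt0 H)// prednK// ltnW.
Qed.
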